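(* Let $\xi_0\in\mathbb R$, $w\in\mathbb C$, and for $i=0,1$ let $$a_i=a_{i-}H(\xi_0-x)+a_{i+}H(x-\xi_0)+\sum_{j=0}^1A_{ij}\delta^{(j)}_{\xi_0},\qquad b_i=b_{i-}H(\xi_0-x)+b_{i+}H(x-\xi_0)+\sum_{j=0}^3B_{ij}\delta^{(j)}_{\xi_0},$$ where $a_{i\pm},b_{i\pm}\in\mathcal C^\infty(\mathbb R)$ and $A_{ij},B_{ij}\in\mathbb C$. Assume that $a_{0-}(\xi_0)+a_{1+}(\xi_0)\neq0$, and that $a_{0-}(x)+a_{1-}(x)\neq0$ and $a_{0+}(x)+a_{1+}(x)\neq0$ for all $x\in\mathbb R$. Consider the ODE $$\sum_{i=0}^{2}\binom{2}{i}\left(a_0^{(i)}*\phi^{(4-i)}+\phi^{(4-i)}*a_1^{(i)}\right)-w^2\left(b_0*\phi+\phi*b_1\right)=0 .$$ (i) If $\operatorname{ord}a_i\le1$ and $\operatorname{ord}b_i\le3$ for $i=0,1$, then every solution $\phi$ of the ODE is (the regular distribution of) a continuous function on $\mathbb R$. (ii) If $\operatorname{ord}a_i=0$ and $\operatorname{ord}b_i\le2$ for $i=0,1$, then every solution $\phi$ of the ODE is (the regular distribution of) a continuously differentiable function on $\mathbb R$.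
   Context: All functions and distributions are complex valued and all derivatives are distributional. $\mathcal D'$ is the space of Schwartz distributions on $\mathbb R$; locally integrable functions are identified with the associated regular distributions. $H$ is the Heaviside step function and $\delta_{x_0}$ the Dirac measure at $x_0$. $\mathcal C_p^\infty$ is the space of functions on $\mathbb R$ that are smooth except on a finite set of points, where they and all their derivatives have finite left and right limits. $\mathcal A\subset\mathcal D'$ is the space of all functions in $\mathcal C_p^\infty$, regarded as distributions, together with all their distributional derivatives of all orders. Equivalently, $F\in\mathcal A$ iff there are points $x_1<\dots<x_m$ such that, with $x_0=-\infty$, $x_{m+1}=+\infty$, $\Omega_i=(x_i,x_{i+1})$ and $\chi_{\Omega_i}$ the characteristic function of $\Omega_i$, $F=\sum_{i=1}^m\sum_{j=0}^n c_{ij}\delta^{(j)}_{x_i}+\sum_{i=0}^m f_i\chi_{\Omega_i}$ with $c_{ij}\in\mathbb C$ and $f_i\in\mathcal C^\infty(\mathbb R)$. Product $*$: for $F,G\in\mathcal A$, $F*G=\lim_{\epsilon\downarrow0}F(x)\cdot G(x+\epsilon)$ in the distributional sense, where for small $\epsilon>0$ the two factors have disjoint singular supports and $\cdot$ is the Hörmander product (locally, the product of a distribution by a smooth function). Explicitly, if $F=\sum_{i=1}^m\sum_{j=0}^n c_{ij}\delta^{(j)}_{x_i}+\sum_{i=0}^m f_i\chi_{\Omega_i}$ and $G=\sum_{i=1}^m\sum_{j=0}^n d_{ij}\delta^{(j)}_{x_i}+\sum_{i=0}^m g_i\chi_{\Omega_i}$ (same points for both, $f_i,g_i\in\mathcal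 C^\infty(\mathbb R)$), then $$F*G=\sum_{i=1}^m\sum_{j=0}^n\left[c_{ij}g_i+d_{ij}f_{i-1}\right]\delta^{(j)}_{x_i}+\sum_{i=0}^m f_ig_i\chi_{\Omega_i}\in\mathcal A .$$ Order: $\operatorname{ord}F=n$ iff $F$ is the $n$th distributional derivative, but not a lower order distributional derivative, of a regular distribution; so $\operatorname{ord}F=0$ iff $F$ is regular, and $\operatorname{ord}\delta^{(j)}_{x_0}=j+1$. A solution of the ODE is a $\phi\in\mathcal A$ satisfying it in the sense of distributions on $\mathbb R$. *)

(* Defs.v *)
From HB Require Import structures.
From mathcomp Require Import all_boot all_order all_algebra.
From mathcomp Require Import complex.
From mathcomp Require Import all_classical all_reals all_analysis.
From mathcomp Require Import ring.

Set Implicit Arguments.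
Unset Strict Implicit.
Unset Printing Implicit Defensive.

Import Order.TTheory GRing.Theory Num.Theory numFieldNormedType.Exports.

Local Open Scope classical_set_scope.
Local Open Scope ring_scope.
Local Open Scope complex_scope.

(* The library puts no topology on R[i], so limits, derivatives and integrals *)
(* of complex-valued functions are taken on real and imaginary parts.         *)

Section ComplexCalculus.
Variable R : realType.
Implicit Types f g : R -> R[i].

Definition reF {T : Type} (f : T -> R[i]) : T -> R := fun x => complex.Re (f x).
Definition imF {T : Type} (f : T -> R[i]) : T -> R := fun x => complex.Im (f x).

Definition ccvg_to {T : Type} (F : set_system T) (f : T -> R[i]) (l : R[i]) :=
  (reF f x @[x --> F] --> complex.Re l) /\
  (imF f x @[x --> F] --> complex.Im l).

Definition ccontinuous f := forall x, ccvg_to (nbhs x) f (f x).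

Definition cderivable f (x : R) :=
  derivable (reF f) x 1 /\ derivable (imF f) x 1.

Definition cderiv f : R -> R[i] :=
  fun x => derive1 (reF f) x +i* derive1 (imF f) x.

Definition cderivn n f : R -> R[i] := iter n cderiv f.

Definition smooth f := forall n x, cderivable (cderivn n f) x.

Definition continuously_differentiable f :=
  (forall x, cderivable f x) /\ ccontinuous (cderiv f).

Definition clocally_integrable f :=
  locally_integrable setT (reF f) /\ locally_integrable setT (imF f).

Definition cintegral f : R[i] :=
  \int[lebesgue_measure]_x (reF f x) +i* \int[lebesgue_measure]_x (imF f x).

(* cderivn n f is meaningful off s only; one-sided limits at points of s see  *)
(* no other values, and the values of f on s itself are unconstrained.        *)
Definition cpsmooth f := exists s : seq R,
  (forall n x, x \notin s -> cderivable (cderivn n f) x) /\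
  (forall n x, x \in s ->
     (exists l, ccvg_to x^'- (cderivn n f) l) /\
     (exists l, ccvg_to x^'+ (cderivn n f) l)).

Definition heaviside (x : R) : R[i] := if 0 < x then 1 else 0.

Definition supp f : set R := closure [set x | f x != 0].

End ComplexCalculus.

Section SmoothTheory.
Variable R : realType.
Implicit Types f g : R -> R[i].

Definition cdiffn n f := forall k x, (k <= n)%N -> cderivable (cderivn k f) x.

Lemma smoothE f : smooth f <-> forall n, cdiffn n f.
Proof.
by split=> [sf n k x _|h n x]; [exact: sf|exact: (h n)].
Qed.

Lemma cdiffn0 f : cdiffn 0 f <-> forall x, cderivable f x.
Proof.
split=> [h x|h k x]; first exact: (h 0%N).
by rewrite leqn0 => /eqP->; exact: h.
Qed.

Lemma cdiffnS n f :
  cdiffn n.+1 f <-> (forall x, cderivable f x) /\ cdiffn n (cderiv f).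
Proof.
split=> [h|[h0 h] [|k] x kn].
- split=> [x|k x kn]; first exact: (h 0%N).
  by rewrite /cderivn -iterSr; exact: (h k.+1).
- exact: h0.
- by rewrite /cderivn iterSr; exact: h.
Qed.

Lemma cdiffn_le n f : cdiffn n.+1 f -> cdiffn n f.
Proof. by move=> h k x kn; apply: h; rewrite (leq_trans kn). Qed.

Lemma reFD f g : reF (fun y => f y + g y) = reF f + reF g.
Proof.
by apply/funext => y; rewrite !fctE /reF; case: (f y) (g y) => [a b] [c d].
Qed.

Lemma imFD f g : imF (fun y => f y + g y) = imF f + imF g.
Proof.
by apply/funext => y; rewrite !fctE /imF; case: (f y) (g y) => [a b] [c d].
Qed.

Lemma cderivableD f g x :
  cderivable f x -> cderivable g x -> cderivable (fun y => f y + g y) x.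
Proof.
by move=> [fr fi] [gr gi]; split; rewrite ?reFD ?imFD; exact: derivableD.
Qed.

Lemma cderivD f g :
  (forall x, cderivable f x) -> (forall x, cderivable g x) ->
  cderiv (fun y => f y + g y) = (fun y => cderiv f y + cderiv g y).
Proof.
move=> df dg; apply/funext => x; rewrite /cderiv reFD imFD.
have [fr fi] := df x; have [gr gi] := dg x.
by rewrite !derive1E !deriveD.
Qed.

Lemma reFM f g :
  reF (fun y => f y * g y) = reF f * reF g - imF f * imF g.
Proof.
by apply/funext => y; rewrite !fctE /reF /imF; case: (f y) (g y) => [a b] [c d].
Qed.

Lemma imFM f g :
  imF (fun y => f y * g y) = reF f * imF g + imF f * reF g.
Proof.
by apply/funext => y; rewrite !fctE /reF /imF; case: (f y) (g y) => [a b] [c d].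
Qed.

Lemma cderivableM f g x :
  cderivable f x -> cderivable g x -> cderivable (fun y => f y * g y) x.
Proof.
move=> [fr fi] [gr gi]; split; rewrite ?reFM ?imFM.
- exact: (derivableB (derivableM fr gr) (derivableM fi gi)).
- exact: (derivableD (derivableM fr gi) (derivableM fi gr)).
Qed.

Lemma cderivM f g :
  (forall x, cderivable f x) -> (forall x, cderivable g x) ->
  cderiv (fun y => f y * g y) =
  (fun y => cderiv f y * g y + f y * cderiv g y).
Proof.
move=> df dg; apply/funext => x; rewrite /cderiv reFM imFM.
have [fr fi] := df x; have [gr gi] := dg x.
rewrite !derive1E (deriveB (derivableM fr gr) (derivableM fi gi)).
rewrite (deriveD (derivableM fr gi) (derivableM fi gr)).
rewrite (deriveM fr gr) (deriveM fi gi) (deriveM fr gi) (deriveM fi gr).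
move: ('D_1 (reF f) x) ('D_1 (imF f) x) ('D_1 (reF g) x) ('D_1 (imF g) x).
move=> p q r s; rewrite /reF /imF; case: (f x) (g x) => [a b] [c d].
by congr (_ +i* _); rewrite /GRing.scale /=; ring.
Qed.

Lemma smooth_cst (a : R[i]) : smooth (fun _ : R => a).
Proof.
suff h n b : cdiffn n (fun _ : R => b) by apply/smoothE.
have dc c x : cderivable (fun _ : R => c) x.
  by split; rewrite /reF /imF; exact: derivable_cst.
elim: n b => [|n IH] b; first exact/cdiffn0.
apply/cdiffnS; split; first exact: dc.
rewrite (_ : cderiv _ = fun=> 0); first exact: IH.
apply/funext => x; rewrite /cderiv /reF /imF.
by rewrite (derive1_cst (complex.Re b)) (derive1_cst (complex.Im b)).
Qed.

Lemma smoothD f g : smooth f -> smooth g -> smooth (fun x => f x + g x).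
Proof.
move=> /smoothE sf /smoothE sg; apply/smoothE => n.
elim: n f g {sf sg}(sf n) (sg n) => [|n IH] f g.
  by move=> /cdiffn0 sf /cdiffn0 sg; apply/cdiffn0 => x; exact: cderivableD.
move=> /cdiffnS[df sf] /cdiffnS[dg sg]; apply/cdiffnS; split=> [x|].
  exact: cderivableD.
by rewrite (cderivD df dg); exact: IH.
Qed.

Lemma smoothM f g : smooth f -> smooth g -> smooth (fun x => f x * g x).
Proof.
move=> /smoothE sf /smoothE sg; apply/smoothE => n.
elim: n f g {sf sg}(sf n) (sg n) => [|n IH] f g.
  by move=> /cdiffn0 sf /cdiffn0 sg; apply/cdiffn0 => x; exact: cderivableM.
move=> sf' sg'; have /cdiffn_le sf := sf'; have /cdiffn_le sg := sg'.
move: sf' sg' => /cdiffnS[df sf'] /cdiffnS[dg sg']; apply/cdiffnS; split=> [x|].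
  exact: cderivableM.
rewrite (cderivM df dg).
have cdiffnD u v : cdiffn n u -> cdiffn n v -> cdiffn n (fun x => u x + v x).
  elim: {IH sf sg sf' sg'} n u v => [|n IH] u v.
    by move=> /cdiffn0 su /cdiffn0 sv; apply/cdiffn0 => x; exact: cderivableD.
  move=> /cdiffnS[du su] /cdiffnS[dv sv]; apply/cdiffnS; split=> [x|].
    exact: cderivableD.
  by rewrite (cderivD du dv); exact: IH.
by apply: cdiffnD; exact: IH.
Qed.

Lemma smooth_cderiv f : smooth f -> smooth (cderiv f).
Proof. move=> sf n x; rewrite /cderivn -iterSr; exact: (sf n.+1). Qed.

Lemma is_derive_shift (f : R -> R) (e x : R) : derivable f (x + e) 1 ->
  is_derive x 1 (fun y => f (y + e)) (derive1 f (x + e)).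
Proof.
move=> df; have -> : (fun y => f (y + e)) = f \o (shift e) by [].
apply: is_derive_eq.
  apply: is_derive1_comp; first by apply/derivableP; exact: df.
by rewrite addr0 mulr1 derive1E.
Qed.

Lemma cderivable_shift f e x : cderivable f (x + e) ->
  cderivable (fun y => f (y + e)) x.
Proof.
move=> [fr fi]; split.
- by have [] := is_derive_shift fr.
- by have [] := is_derive_shift fi.
Qed.

Lemma cderiv_shift f e x : cderivable f (x + e) ->
  cderiv (fun y => f (y + e)) x = cderiv f (x + e).
Proof.
move=> [fr fi]; rewrite /cderiv; congr (_ +i* _).
- by rewrite derive1E (@derive_val _ _ _ _ _ _ _ (is_derive_shift fr)).
- by rewrite derive1E (@derive_val _ _ _ _ _ _ _ (is_derive_shift fi)).
Qed.

Lemma cderivn_shift n f e : smooth f ->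
  cderivn n (fun y => f (y + e)) = (fun y => cderivn n f (y + e)).
Proof.
move=> sf; elim: n => [|n IH]; first by [].
rewrite /cderivn iterS -/(cderivn n _) IH.
by apply/funext => y; rewrite (cderiv_shift (sf n (y + e))).
Qed.

Lemma smooth_shift f e : smooth f -> smooth (fun x => f (x + e)).
Proof.
move=> sf n x; rewrite (cderivn_shift n e sf); apply: cderivable_shift.
exact: (sf n).
Qed.

Lemma supp_notin f x : ~ supp f x -> \forall y \near x, f y = 0.
Proof.
move=> nx; have : open (~` supp f) by exact/closed_openC/closed_closure.
rewrite openE => /(_ x nx); apply: filterS => y ny.
apply/eqP/negP => /negP fy; apply: ny; exact: subset_closure.
Qed.

Lemma supp_sub f (A : set R) : closed A -> (forall x, ~ A x -> f x = 0) ->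
  supp f `<=` A.
Proof.
move=> cA fA; rewrite ((closure_id A).1 cA); apply: closureS => x fx.
by apply: contrapT => nA; move/eqP: fx; apply; exact: fA.
Qed.

Lemma compact_suppW f (A : set R) : compact A ->
  (forall x, ~ A x -> f x = 0) -> compact (supp f).
Proof.
move=> cA fA; apply: (subclosed_compact _ cA); first exact: closed_closure.
by apply: supp_sub => //; apply: compact_closed => //; exact: Rhausdorff.
Qed.

Lemma cderiv_notin_supp f x : ~ supp f x -> cderiv f x = 0.
Proof.
move=> /supp_notin f0; rewrite /cderiv !derive1E.
rewrite (@near_eq_derive _ _ _ (reF f) (cst 0)); last first.
  by near=> y; rewrite /reF (near f0 y).
rewrite (@near_eq_derive _ _ _ (imF f) (cst 0)); last first.
  by near=> y; rewrite /imF (near f0 y).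
by rewrite !derive_cst.
Unshelve. all: by end_near. Qed.

End SmoothTheory.

Section TestFunctions.
Variable R : realType.

Definition istest : {pred R -> R[i]} :=
  fun t => `[< smooth t /\ compact (supp t) >].

Record testfun := TestFun { testval :> R -> R[i]; _ : testval \in istest }.

HB.instance Definition _ := [isSub for testval].
HB.instance Definition _ := [Choice of testfun by <:].

Lemma istestP (t : R -> R[i]) :
  reflect (smooth t /\ compact (supp t)) (t \in istest).
Proof. exact: asboolP. Qed.

Lemma istest_submod : submod_closed istest.
Proof.
split=> [|a s t /istestP[ss cs] /istestP[st ct]]; apply/istestP; split.
- exact: smooth_cst.
- by apply: (@compact_suppW _ _ set0) => //; exact: compact0.
- exact: (smoothD (smoothM (smooth_cst a) ss) st).
- apply: (compact_suppW (compactU cs ct)) => x /not_orP[ns nt].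
  rewrite !fctE (nbhs_singleton (supp_notin ns)).
  by rewrite (nbhs_singleton (supp_notin nt)) scaler0 addr0.
Qed.

HB.instance Definition _ := GRing.isSubmodClosed.Build _ _ istest istest_submod.
HB.instance Definition _ := [SubChoice_isSubLmodule of testfun by <:].

Lemma testfunP (t : testfun) : smooth t /\ compact (supp t).
Proof. exact/istestP/valP. Qed.

Lemma istest_cderiv (t : testfun) : cderiv t \in istest.
Proof.
have [st ct] := testfunP t; apply/istestP; split; first exact: smooth_cderiv.
by apply: (compact_suppW ct) => x; exact: cderiv_notin_supp.
Qed.

Lemma istest_mul (h : R -> R[i]) (t : testfun) :
  smooth h -> (fun x => h x * t x) \in istest.
Proof.
have [st ct] := testfunP t => sh; apply/istestP; split; first exact: smoothM.
apply: (compact_suppW ct) => x nt.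
by rewrite (nbhs_singleton (supp_notin nt)) mulr0.
Qed.

Lemma istest_shift (e : R) (t : testfun) : (fun x => t (x + e)) \in istest.
Proof.
have [st ct] := testfunP t; apply/istestP; split; first exact: smooth_shift.
apply: (@compact_suppW _ _ ((fun x => x - e) @` supp t)).
  apply: continuous_compact => //; apply: continuous_subspaceT => x.
  by apply: cvgB; [exact: cvg_id|exact: cvg_cst].
move=> x nx; apply: (nbhs_singleton (supp_notin _)) => sx.
by apply: nx; exists (x + e) => //; rewrite addrK.
Qed.

Definition test_deriv (t : testfun) := TestFun (istest_cderiv t).
Definition test_shift (e : R) (t : testfun) := TestFun (istest_shift e t).

Record smoothfun := SmoothFun {
  smoothval :> R -> R[i];
  smoothfunP : smooth smoothval }.

Definition test_mul (h : smoothfun) (t : testfun) :=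
  TestFun (istest_mul t (smoothfunP h)).

End TestFunctions.

Section Distributions.
Variable R : realType.

Definition functional := testfun R -> R[i].
Implicit Types F G P : functional.

(* C-linear, and of finite order on each compact set                          *)
Definition is_distribution F :=
  linear F /\
  forall K : set R, compact K -> exists (M : R) (N : nat),
    forall (t : testfun R) (B : R), supp t `<=` K ->
      (forall k x, (k <= N)%N -> `|cderivn k t x| <= B%:C) ->
      `|F t| <= (M * B)%:C.

Definition regdist (f : R -> R[i]) : functional :=
  fun t => cintegral (fun x => f x * t x).

Definition delta (x : R) : functional := fun t => t x.

Definition dderiv F : functional := fun t => - F (test_deriv t).

Definition dderivn n F : functional := iter n dderiv F.

Definition smooth_mul (h : smoothfun R) F : functional :=
  fun t => F (test_mul h t).

(* F(x + e) *)
Definition translate (e : R) F : functional := fun t => F (test_shift (- e) t).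

Definition eq_on (U : set R) F G :=
  forall t : testfun R, supp t `<=` U -> F t = G t.

(* P = F . G for F, G with disjoint singular supports: near each point one of *)
(* the factors is a smooth function h, and P is h times the other factor.     *)
Definition is_hormander_prod F G P :=
  is_distribution P /\
  forall x : R, exists (U : set R) (h : smoothfun R), [/\ open U, U x &
    (eq_on U F (regdist h) /\ eq_on U P (smooth_mul h G)) \/
    (eq_on U G (regdist h) /\ eq_on U P (smooth_mul h F))].

Definition is_star F G P :=
  is_distribution P /\
  exists Q : R -> functional,
    (\forall e \near 0^'+, is_hormander_prod F (translate e G) (Q e)) /\
    forall t, ccvg_to 0^'+ (fun e => Q e t) (P t).

(* The limit is unique; the default value 0 is irrelevant for F, G in A,      *)
(* where the limit exists.                                                    *)
Definition star F G : functional := xget 0 [set P | is_star F G P].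

Definition in_A F :=
  exists (f : R -> R[i]) (n : nat), cpsmooth f /\ F = dderivn n (regdist f).

Definition is_regular_deriv n F :=
  exists f : R -> R[i], clocally_integrable f /\ F = dderivn n (regdist f).

Definition has_ord F n :=
  is_regular_deriv n F /\
  forall k : nat, (k < n)%N -> ~ is_regular_deriv k F.

Definition ord_le F n := exists k : nat, (k <= n)%N /\ has_ord F k.

Definition jump_distr (x0 : R) (fm fp : R -> R[i]) n (c : 'I_n -> R[i]) :
    functional :=
  regdist (fun x => fm x * heaviside (x0 - x) + fp x * heaviside (x - x0)) +
  \sum_(j < n) c j *: dderivn j (delta x0).

Definition is_solution (w : R[i]) (a b : 'I_2 -> functional)
    (phi : functional) :=
  in_A phi /\
  \sum_(i < 3) (star (dderivn i (a 0)) (dderivn (4 - i) phi) +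
                star (dderivn (4 - i) phi) (dderivn i (a 1))) *+ 'C(2, i)
  - w ^+ 2 *: (star (b 0) phi + star phi (b 1)) = 0.

End Distributions.

(* Main.v *)
(* An element of the algebra A is a function f, smooth off a finite set s and  *)
(* with one-sided limits of all derivatives, plus, at every p in s, a finite   *)
(* combination of derivatives of delta_p. The shift in the definition of the   *)
(* star product separates the singular supports, so the product is computed by *)
(* Leibniz' rule, the regular factor being evaluated at p- when it stands on   *)
(* the left and at p+ when it stands on the right. Inserting a solution phi in *)
(* the equation, let N be the order of the most singular delta at p that       *)
(* phi^(4) could contain. All other terms have lower order, so its coefficient *)
(* multiplied by a_0(p-) + a_1(p+) <> 0 must vanish. Applied successively,     *)
(* this kills the delta part of phi (N >= 4), the jump of phi (N = 3) and, in  *)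
(* case (ii), the jump of phi' (N = 2).                                        *)

Require Import Defs.
From mathcomp Require Import all_boot all_order all_algebra.
From mathcomp Require Import complex.
From mathcomp Require Import all_classical all_reals all_analysis.
From mathcomp Require Import measurable_realfun ring lra.

Set Implicit Arguments.
Unset Strict Implicit.
Unset Printing Implicit Defensive.

Import Order.TTheory GRing.Theory Num.Theory numFieldNormedType.Exports.

Local Open Scope classical_set_scope.
Local Open Scope ring_scope.
Local Open Scope complex_scope.

(** * Calculus of complex-valued functions *)

(** Every element of the algebra is brought to the normal form [rep s f c]: the regular distribution
    of a piecewise smooth [f] plus, at each point [p] of a finite list [s], a combination of
    derivatives of delta whose coefficients form the polynomial [c p]. Differentiation multiplies
    [c p] by ['X] and adds the jump of [f] as constant term ([dderiv_rep]). The star product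
    multiplies the regular parts and acts on each delta part by Leibniz' rule, with the left limits
    of the left factor and the right limits of the right factor ([star_rep]). Since [star] is
    defined by a limit of Hörmander products, this formula needs an explicit product for the shifted
    factors ([rep_hormander]), the passage to the limit, and uniqueness ([hormander_unique], by
    gluing).

    Testing against shrinking test functions shows that a distribution of order at most [n] has only
    polynomials of size at most [n] ([rep_size_le]). This turns the order hypotheses into degree
    bounds; for [n = 0] it shows that the zero distribution has no delta part ([rep_inj0]), so the
    equation may be compared coefficient by coefficient ([equation_coef]).

    Fix [p] in [s]. If no delta part other than that of phi^(4) reaches degree [N], the coefficient
    of degree [N] in the equation is a_0(p-) + a_1(p+) times that of phi^(4), and the first factor
    is nonzero ([top_coef], [glue_coef_neq0]). Taking for [N] the degree of [c p] plus 4, then 3,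
    then 2 removes the delta part of phi, its jump, and the jump of its derivative
    ([solution_regular], [solution_regular_deriv]). Without jumps, the right limit [rlim f] is a
    continuous, respectively continuously differentiable, representative of phi ([rlim_ccontinuous],
    [rlim_cderivable]). *)

Section ComplexLimits.
Variables (R : realType) (T : Type) (F : set_system T).
Context {FF : Filter F}.
Implicit Types f g : T -> R[i].

Lemma ccvg_cst (a : R[i]) : ccvg_to F (fun=> a) a.
Proof. by split; exact: cvg_cst. Qed.

Lemma ccvgD f g l m : ccvg_to F f l -> ccvg_to F g m ->
  ccvg_to F (fun x => f x + g x) (l + m).
Proof.
move=> [fr fi] [gr gi]; split.
- rewrite (_ : reF _ = fun x => reF f x + reF g x); last first.
    by apply/funext => x; rewrite /reF raddfD.
  by rewrite raddfD; exact: cvgD.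
- rewrite (_ : imF _ = fun x => imF f x + imF g x); last first.
    by apply/funext => x; rewrite /imF raddfD.
  by rewrite raddfD; exact: cvgD.
Qed.

Lemma ccvgM f g l m : ccvg_to F f l -> ccvg_to F g m ->
  ccvg_to F (fun x => f x * g x) (l * m).
Proof.
move=> [fr fi] [gr gi]; split.
- rewrite (_ : reF _ = fun x => reF f x * reF g x - imF f x * imF g x).
    rewrite (_ : complex.Re (l * m) = complex.Re l * complex.Re m - complex.Im l * complex.Im m).
      by apply: cvgB; exact: cvgM.
    by case: l m {fr fi gr gi} => [a b] [c d].
  by apply/funext => x; rewrite /reF /imF; case: (f x) (g x) => [a b] [c d].
- rewrite (_ : imF _ = fun x => reF f x * imF g x + imF f x * reF g x).
    rewrite (_ : complex.Im (l * m) = complex.Re l * complex.Im m + complex.Im l * complex.Re m).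
      by apply: cvgD; exact: cvgM.
    by case: l m {fr fi gr gi} => [a b] [c d].
  by apply/funext => x; rewrite /reF /imF; case: (f x) (g x) => [a b] [c d].
Qed.

Lemma ccvgZ a f l : ccvg_to F f l -> ccvg_to F (fun x => a * f x) (a * l).
Proof. by move=> fl; apply: ccvgM => //; exact: ccvg_cst. Qed.

Lemma ccvg_sum I (r : seq I) (P : pred I) (f : I -> T -> R[i]) (l : I -> R[i]) :
  (forall i, P i -> ccvg_to F (f i) (l i)) ->
  ccvg_to F (fun x => \sum_(i <- r | P i) f i x) (\sum_(i <- r | P i) l i).
Proof.
move=> fl; rewrite (_ : (fun x => _) = \sum_(i <- r | P i) f i); last first.
  by apply/funext => x; rewrite fct_sumE.
apply: (big_ind2 (fun u v => ccvg_to F u v)) => //; first exact: ccvg_cst.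
by move=> u lu v lv; exact: ccvgD.
Qed.

Lemma near_ccvg f g l : (\forall x \near F, f x = g x) ->
  ccvg_to F f l -> ccvg_to F g l.
Proof.
move=> fg [fr fi]; split.
- apply: cvg_trans fr; apply: near_eq_cvg.
  by apply: filterS fg => x; rewrite /reF => ->.
- apply: cvg_trans fi; apply: near_eq_cvg.
  by apply: filterS fg => x; rewrite /imF => ->.
Qed.

Lemma ccvg_comp S (G : set_system S) (h : S -> T) f l :
  h @ G `=>` F -> ccvg_to F f l -> ccvg_to G (fun x => f (h x)) l.
Proof.
by move=> hG [fr fi]; split; [exact: cvg_comp hG fr | exact: cvg_comp hG fi].
Qed.

Lemma ccvg_sub (G : set_system T) f l :
  G `=>` F -> ccvg_to F f l -> ccvg_to G f l.
Proof.
by move=> GF; apply: (@ccvg_comp _ _ id).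
Qed.

Lemma eq_complex_val (x y : R[i]) : complex.Re x = complex.Re y -> complex.Im x = complex.Im y -> x = y.
Proof. by case: x y => [a b] [c d] /= -> ->. Qed.

End ComplexLimits.

Lemma ccvg_unique (R : realType) (T : Type) (F : set_system T)
    {FF : ProperFilter F} (f : T -> R[i]) l m :
  ccvg_to F f l -> ccvg_to F f m -> l = m.
Proof.
move=> [fr fi] [fr' fi']; apply: eq_complex_val.
- exact: (cvg_unique (@Rhausdorff R) fr fr').
- exact: (cvg_unique (@Rhausdorff R) fi fi').
Qed.

Section LocalDerivatives.
Variable R : realType.
Implicit Types (f g : R -> R[i]) (U : set R) (x : R).

Lemma near_cderiv f g x : (\forall y \near x, f y = g y) ->
  cderiv f x = cderiv g x.
Proof.
move=> fg; rewrite /cderiv !derive1E; congr (_ +i* _).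
- by apply: near_eq_derive; apply: filterS fg => y; rewrite /reF => ->.
- by apply: near_eq_derive; apply: filterS fg => y; rewrite /imF => ->.
Qed.

Lemma near_cderivable f g x : (\forall y \near x, f y = g y) ->
  cderivable f x -> cderivable g x.
Proof.
move=> fg [fr fi]; split.
- apply: near_eq_derivable fr => //.
  by apply: filterS fg => y; rewrite /reF => ->.
- apply: near_eq_derivable fi => //.
  by apply: filterS fg => y; rewrite /imF => ->.
Qed.

(** A derivative at [y] needs equality near [y], not only at [y]. [near_join] supplies it: what
    holds near [x] holds near every point near [x]. *)
Lemma near_cderivn n f g x : (\forall y \near x, f y = g y) ->
  \forall y \near x, cderivn n f y = cderivn n g y.
Proof.
move=> /(@near_join R) fg; elim: n => [|n /(@near_join R) IH].
  exact: nbhs_singleton fg.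
by apply: filterS IH => y; exact: near_cderiv.
Qed.

Lemma cderivD_at f g x : cderivable f x -> cderivable g x ->
  cderiv (fun y => f y + g y) x = cderiv f x + cderiv g x.
Proof.
by move=> [fr fi] [gr gi]; rewrite /cderiv reFD imFD !derive1E !deriveD.
Qed.

Lemma cderivM_at f g x : cderivable f x -> cderivable g x ->
  cderiv (fun y => f y * g y) x = cderiv f x * g x + f x * cderiv g x.
Proof.
move=> [fr fi] [gr gi]; rewrite /cderiv reFM imFM.
rewrite !derive1E (deriveB (derivableM fr gr) (derivableM fi gi)).
rewrite (deriveD (derivableM fr gi) (derivableM fi gr)).
rewrite (deriveM fr gr) (deriveM fi gi) (deriveM fr gi) (deriveM fi gr).
move: ('D_1 (reF f) x) ('D_1 (imF f) x) ('D_1 (reF g) x) ('D_1 (imF g) x).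
move=> p q r s; rewrite /reF /imF; case: (f x) (g x) => [a b] [c d].
by congr (_ +i* _); rewrite /GRing.scale /=; ring.
Qed.

Lemma cderivable_cst (a : R[i]) x : cderivable (fun=> a) x.
Proof. by split; exact: derivable_cst. Qed.

Lemma cderiv_cst (a : R[i]) : cderiv (fun=> a) = (fun=> 0 : R[i]) :> (R -> _).
Proof.
apply/funext => x; rewrite /cderiv /reF /imF.
by rewrite (derive1_cst (complex.Re a)) (derive1_cst (complex.Im a)).
Qed.

Lemma cderivableZ_at (a : R[i]) f x : cderivable f x ->
  cderivable (fun y => a * f y) x.
Proof. by apply: cderivableM; exact: cderivable_cst. Qed.

Lemma cderivZ_at (a : R[i]) f x : cderivable f x ->
  cderiv (fun y => a * f y) x = a * cderiv f x.
Proof.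
move=> df; rewrite cderivM_at ?cderiv_cst ?mul0r ?add0r//.
exact: cderivable_cst.
Qed.

Lemma cderivable_sum I (r : seq I) (f : I -> R -> R[i]) x :
  (forall i, cderivable (f i) x) ->
  cderivable (fun y => \sum_(i <- r) f i y) x.
Proof.
move=> df; elim: r => [|i r IH].
  rewrite (_ : (fun y => _) = fun=> 0); first exact: cderivable_cst.
  by apply/funext => y; rewrite big_nil.
rewrite (_ : (fun y => _) = fun y => f i y + \sum_(j <- r) f j y).
  exact: cderivableD.
by apply/funext => y; rewrite big_cons.
Qed.

Lemma cderiv_sum I (r : seq I) (f : I -> R -> R[i]) x :
  (forall i, cderivable (f i) x) ->
  cderiv (fun y => \sum_(i <- r) f i y) x = \sum_(i <- r) cderiv (f i) x.
Proof.
move=> df; elim: r => [|i r IH].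
  rewrite (_ : (fun y => _) = fun=> 0) ?cderiv_cst ?big_nil//.
  by apply/funext => y; rewrite big_nil.
rewrite (_ : (fun y => _) = fun y => f i y + \sum_(j <- r) f j y).
  by rewrite cderivD_at ?big_cons ?IH//; exact: cderivable_sum.
by apply/funext => y; rewrite big_cons.
Qed.

Lemma cderivable_cvg f x : cderivable f x -> ccvg_to (nbhs x) f (f x).
Proof.
by move=> [/derivable1_diffP fr /derivable1_diffP fi]; split;
  exact: differentiable_continuous.
Qed.

Definition smooth_on U f := forall n x, U x -> cderivable (cderivn n f) x.

Lemma smooth_onT f : smooth f -> forall U, smooth_on U f.
Proof. by move=> sf U n x _; exact: sf. Qed.

Lemma cderivn_cderiv n f : cderivn n (cderiv f) = cderivn n.+1 f.
Proof. by rewrite /cderivn -iterSr. Qed.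

Lemma cderivn_add m n f : cderivn m (cderivn n f) = cderivn (m + n) f.
Proof. by rewrite /cderivn iterD. Qed.

Lemma smooth_on_cderivn U k f : smooth_on U f -> smooth_on U (cderivn k f).
Proof. by move=> sf n x Ux; rewrite cderivn_add; exact: sf. Qed.

Lemma cderivn_cst n (a : R[i]) :
  cderivn n.+1 (fun _ : R => a) = fun=> 0.
Proof.
rewrite /cderivn iterSr cderiv_cst; elim: n => //= n ->.
by rewrite cderiv_cst.
Qed.

Lemma open_nearP U x (P : R -> Prop) : open U -> U x ->
  (forall y, U y -> P y) -> \forall y \near x, P y.
Proof.
by move=> oU Ux UP; apply: filterS (open_nbhs_nbhs (conj oU Ux)).
Qed.

Lemma eq_on_cderivn n U f g : open U -> (forall y, U y -> f y = g y) ->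
  forall y, U y -> cderivn n f y = cderivn n g y.
Proof.
move=> oU fg y Uy; have := near_cderivn n (open_nearP oU Uy fg).
exact: nbhs_singleton.
Qed.

Lemma eq_smooth_on U f g : open U -> (forall y, U y -> f y = g y) ->
  smooth_on U f -> smooth_on U g.
Proof.
move=> oU fg sf n x Ux; apply: near_cderivable (sf n x Ux).
by apply: open_nearP (oU) Ux _; exact: eq_on_cderivn.
Qed.

Lemma cderivn_addf n U f g : open U -> smooth_on U f -> smooth_on U g ->
  forall x, U x ->
  cderivn n (fun y => f y + g y) x = cderivn n f x + cderivn n g x.
Proof.
move=> oU sf sg; elim: n => [//|n IH] x Ux.
rewrite /cderivn iterS -/(cderivn n _).
rewrite (@near_cderiv _ (fun y => cderivn n f y + cderivn n g y)).
  by rewrite cderivD_at//; [exact: sf|exact: sg].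
exact: open_nearP IH.
Qed.

Lemma smooth_onD U f g : open U -> smooth_on U f -> smooth_on U g ->
  smooth_on U (fun y => f y + g y).
Proof.
move=> oU sf sg n x Ux.
apply: (@near_cderivable (fun y => cderivn n f y + cderivn n g y)).
  by apply: open_nearP (oU) Ux _ => y Uy; rewrite (cderivn_addf n oU).
by apply: cderivableD; [exact: sf|exact: sg].
Qed.

(** Induction on [n]: Pascal's rule [binS] recombines the two sums obtained by differentiating
    either factor. *)
Lemma leibniz n U f g : open U -> smooth_on U f -> smooth_on U g ->
  forall x, U x ->
  cderivn n (fun y => f y * g y) x =
  \sum_(k < n.+1) (cderivn k f x * cderivn (n - k) g x) *+ 'C(n, k).
Proof.
move=> oU sf sg; elim: n => [|n IH] x Ux.
  by rewrite big_ord1 /= mulr1n.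
rewrite /cderivn iterS -/(cderivn n _).
pose h (k : 'I_n.+1) y := (cderivn k f y * cderivn (n - k) g y) *+ 'C(n, k).
have hE k : h k = fun y => ('C(n, k))%:R *
    (cderivn k f y * cderivn (n - k) g y).
  by apply/funext => y; rewrite /h mulr_natl.
have dh k : cderivable (h k) x.
  rewrite hE; apply/cderivableZ_at/cderivableM; [exact: sf|exact: sg].
rewrite (@near_cderiv _ (fun y => \sum_(k < n.+1) h k y)); last first.
  exact: open_nearP IH.
rewrite cderiv_sum//.
under eq_bigr => k _.
  rewrite hE cderivZ_at; last by apply: cderivableM; [exact: sf|exact: sg].
  rewrite cderivM_at; [|exact: sf|exact: sg].
  rewrite -!/(cderivn _.+1 _) mulrDr.
  over.
rewrite big_split/= [RHS]big_ord_recl/= /bump/=.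
under [in RHS]eq_bigr => i _ do rewrite add1n binS mulrnDr subSS.
rewrite big_split/= [X in _ = _ + (X + _)]big_ord_recr/=.
rewrite (@bin_small n n.+1)// mulr0n addr0.
rewrite addrC [in RHS]addrA; congr (_ + _); last first.
  by apply: eq_bigr => k _; rewrite mulr_natl.
rewrite big_ord_recl/= !bin0 mul1r subn0 mulr1n; congr (_ + _).
apply: eq_bigr => i _; rewrite /bump/= ?add0n ?add1n mulr_natl.
by rewrite -[in RHS](subSS i) subSn// ltn_ord.
Qed.

Lemma smooth_onM U f g : open U -> smooth_on U f -> smooth_on U g ->
  smooth_on U (fun y => f y * g y).
Proof.
move=> oU sf sg n x Ux.
apply: (@near_cderivable (fun y => \sum_(k < n.+1)
    (cderivn k f y * cderivn (n - k) g y) *+ 'C(n, k))).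
  by apply: open_nearP (oU) Ux _ => y Uy; rewrite (leibniz n oU).
apply: cderivable_sum => k.
rewrite (_ : (fun y => _) = fun y => ('C(n, k))%:R *
    (cderivn k f y * cderivn (n - k) g y)).
  by apply/cderivableZ_at/cderivableM; [exact: sf|exact: sg].
by apply/funext => y; rewrite mulr_natl.
Qed.

End LocalDerivatives.

Section RealToComplex.
Variable R : realType.
Implicit Types (u : R -> R) (f : R -> R[i]) (x : R).

Lemma reF_real u : reF (fun x => (u x)%:C) = u. Proof. by []. Qed.

Lemma imF_real u : imF (fun x => (u x)%:C) = cst 0. Proof. by []. Qed.

Lemma cderivable_real u x : derivable u x 1 -> cderivable (fun x => (u x)%:C) x.
Proof. by move=> du; split; [exact: du|exact: (derivable_cst (0 : R))]. Qed.

Lemma cderiv_real u x : cderiv (fun x => (u x)%:C) x = (derive1 u x)%:C.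
Proof.
rewrite /cderiv reF_real imF_real [X in _ +i* X](_ : _ = 0) //.
by rewrite derive1E derive_cst.
Qed.

Lemma is_derive_cderiv u x du : is_derive x 1 u du ->
  cderivable (fun x => (u x)%:C) x /\ cderiv (fun x => (u x)%:C) x = du%:C.
Proof.
move=> [du1 <-]; split; first exact: cderivable_real.
by rewrite cderiv_real derive1E.
Qed.

(** Avoids closed formulas for higher derivatives: it is enough to exhibit a family stable under
    differentiation. Used for the identity, for reciprocals and for exp(-1/x). *)
Lemma smooth_coind (S : set (R -> R[i])) :
  (forall f, S f -> (forall x, cderivable f x) /\ S (cderiv f)) ->
  forall f, S f -> smooth f.
Proof.
move=> SS f Sf n x; elim: n f Sf => [|n IH] f Sf; first by have [] := SS _ Sf.
by rewrite /cderivn iterSr; apply: IH; have [] := SS _ Sf.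
Qed.

Lemma smooth_real_derivable u x : smooth (fun x => (u x)%:C) -> derivable u x 1.
Proof. by move=> su; case: (su 0%N x) => + _; apply. Qed.

Lemma smooth_id : smooth (fun x : R => x%:C).
Proof.
apply: (@smooth_coind [set f | f = (fun x => x%:C) \/ exists a, f = fun=> a]).
  move=> f [->|[a ->]].
    have d x := is_derive_cderiv (is_derive_id x (1 : R)); split=> [x|].
      by have [] := d x.
    by right; exists 1; apply/funext => x; have [] := d x.
  split=> [x|]; first exact: cderivable_cst.
  by right; exists 0; rewrite cderiv_cst.
by left.
Qed.

Lemma smoothX f n : smooth f -> smooth (fun x => f x ^+ n).
Proof.
move=> sf; elim: n => [|n IH].
  rewrite (_ : (fun x => _) = fun=> 1); first exact: smooth_cst.
  by apply/funext => x; rewrite expr0.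
rewrite (_ : (fun x => _) = fun x => f x * f x ^+ n); first exact: smoothM.
by apply/funext => x; rewrite exprS.
Qed.

(** The stable family consists of the v u^(-k) with v smooth, whose derivative is (v' u - k v u')
    u^(-k-1). *)
Lemma smooth_realV u : (forall x, u x != 0) -> smooth (fun x => (u x)%:C) ->
  smooth (fun x => (u x)^-1%:C).
Proof.
move=> u0 su; pose S := [set f : R -> R[i] | exists v k, smooth v /\
  f = fun x => v x * ((u x)^-1 ^+ k)%:C].
apply: (@smooth_coind S); last first.
  exists (fun=> 1), 1%N; split; first exact: smooth_cst.
  by apply/funext => x; rewrite mul1r expr1.
move=> _ [v [k [sv ->]]].
have d x : is_derive x 1 (fun x => (u x)^-1 ^+ k)
    (- (k%:R * derive1 u x * (u x)^-1 ^+ k.+1)).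
  have dV : is_derive x 1 (fun x => (u x)^-1) (- (u x) ^- 2 *: 'D_1 u x).
    apply: DeriveDef; last by rewrite deriveV//; exact: smooth_real_derivable.
    by apply: derivableV => //; exact: smooth_real_derivable.
  have := is_deriveX k dV; rewrite (_ : _ ^+ k = (fun x => (u x)^-1 ^+ k)).
    move=> h; apply: is_derive_eq h _.
    rewrite /GRing.scale/= -derive1E -exprVn; case: k => [|k].
      by rewrite !mul0r oppr0.
    by rewrite /= !exprS expr0; ring.
  by apply/funext => y; rewrite exprfctE.
have dd x := is_derive_cderiv (d x).
split=> [x|]; first by apply: cderivableM; [exact: (sv 0%N)|have [] := dd x].
exists (fun x => cderiv v x * (u x)%:C + - k%:R * (v x * (derive1 u x)%:C)), k.+1.
split.
  have su' : smooth (fun x => (derive1 u x)%:C).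
    rewrite (_ : (fun x => _) = cderiv (fun x => (u x)%:C)).
      exact: (smooth_cderiv su).
    by apply/funext => x; rewrite cderiv_real.
  exact: (smoothD (smoothM (smooth_cderiv sv) su)
    (smoothM (smooth_cst (- k%:R)) (smoothM sv su'))).
apply/funext => x; rewrite cderivM_at; [|exact: (sv 0%N)|by have [] := dd x].
rewrite (dd x).2 exprSr rmorphN !rmorphM/= rmorph_nat.
have ux : (u x)%:C * (u x)^-1%:C = 1 by rewrite -rmorphM/= divff.
set c := ((u x)^-1 ^+ k)%:C; set z := ((u x)^-1)%:C in ux *.
rewrite mulrDl; congr (_ + _); last by ring.
by rewrite -(mulrA (cderiv v x)) [_ * (c * z)]mulrCA ux mulr1.
Qed.

End RealToComplex.

(** * Bump functions *)

Section Bump.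
Variable R : realType.
Implicit Types (x p d : R) (u : R -> R).

(* The factor x^-k makes the family stable under derivation up to smooth      *)
(* factors, which gives the smoothness of exp(-1/x) at 0 by coinduction.      *)
Definition flat k x : R := if 0 < x then x^-1 ^+ k * expR (- x^-1) else 0.

Lemma flat_ge0 k x : 0 <= flat k x.
Proof.
rewrite /flat; case: ifPn => // x0.
by rewrite mulr_ge0 ?expR_ge0// exprn_ge0// invr_ge0 ltW.
Qed.

Lemma flat_gt0 k x : 0 < x -> 0 < flat k x.
Proof. by rewrite /flat => x0; rewrite x0 mulr_gt0 ?expR_gt0// exprn_gt0// invr_gt0. Qed.

Lemma flat_eq0 k x : x <= 0 -> flat k x = 0.
Proof. by rewrite /flat => x0; rewrite ltNge x0. Qed.

(** With y = 1/x, the bound e^y >= y^(k+1)/(k+1)! gives y^k e^(-y) <= (k+1)!/y. It yields the limit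
    0 at the origin. *)
Lemma flat_le k x : flat k x <= (k.+1)`!%:R * `|x|.
Proof.
rewrite /flat; case: ifPn => [x0|_]; last by rewrite mulr_ge0.
have y0 : 0 < x^-1 by rewrite invr_gt0.
have := expR_ge1Dxn k (ltW y0); set y := x^-1 in y0 *; set c := _%:R => h.
have c0 : 0 < c by rewrite ltr0n fact_gt0.
have {}h : y ^+ k.+1 / c <= expR y by rewrite (le_trans _ h)// lerDr.
rewrite expRN ler_pdivrMr ?expR_gt0// gtr0_norm//.
have -> : y ^+ k = y ^+ k.+1 / c * (c * x).
  rewrite exprS; have := gt_eqF c0; have := gt_eqF x0; rewrite /y.
  by move=> x1 c1; field; rewrite x1 c1.
by rewrite mulrC ler_wpM2l// mulr_ge0// ltW.
Qed.

Lemma cvg_flat0 k : flat k x @[x --> 0^'] --> (0 : R).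
Proof.
apply: (@squeeze_cvgr _ _ _ _ (cst 0) (fun x => (k.+1)`!%:R * `|x|)).
- by apply: nearW => x; rewrite flat_ge0 flat_le.
- exact: cvg_cst.
- apply: cvg_within_filter.
  have h : (k.+1)`!%:R * `|x : R| @[x --> 0] --> (k.+1)`!%:R * `|0 : R|.
    by apply: cvgM; [exact: cvg_cst|apply: cvg_norm; exact: cvg_id].
  by rewrite normr0 mulr0 in h.
Qed.

Lemma flatS k x : x^-1 * flat k x = flat k.+1 x.
Proof. by rewrite /flat; case: ifP; rewrite ?mulr0// exprS mulrA. Qed.

Lemma is_derive_flat k x :
  is_derive x 1 (flat k) (flat k.+2 x * (1 - k%:R * x)).
Proof.
have [x0|x0|->] := ltrgtP x 0.
- rewrite flat_eq0 ?(ltW x0)// mul0r.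
  apply: (@near_eq_is_derive _ _ _ (cst 0)) => //.
  near=> y; rewrite flat_eq0//; apply/ltW; near: y; exact: lt_nbhsl.
- have xN : x != 0 by rewrite gt_eqF.
  apply: (@near_eq_is_derive _ _ _
      ((fun x => x^-1 ^+ k * expR (- x^-1)) : R -> R)) => //.
    near=> y; rewrite /flat ifT//; near: y; exact: lt_nbhsr.
  have dV : is_derive x 1 (fun x : R => x^-1) (- x ^- 2).
    have di : derivable (@id R) x 1 by [].
    apply: DeriveDef; first exact: (derivableV (f := id) xN di).
    by rewrite (deriveV (f := id) xN di) derive_id /GRing.scale/= mulr1.
  have dX := is_deriveX k dV.
  have dN : is_derive x 1 (fun x : R => - x^-1) (x ^- 2).
    by have := is_deriveN dV; rewrite opprK.
  have dE : is_derive x 1 (fun x : R => expR (- x^-1)) (expR (- x^-1) * x ^- 2).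
    have := @is_derive1_comp R expR (fun x : R => - x^-1) x _ _
      (is_derive_expR _) dN.
    exact.
  have := is_deriveM dX dE.
  rewrite (_ : _ * _ = (fun x => x^-1 ^+ k * expR (- x^-1)) :> (R -> R)); last first.
    by apply/funext => y; rewrite !fctE.
  move=> h; apply: is_derive_eq h _; rewrite /flat x0 ?exprfctE /GRing.scale/=.
  case: k {dX} => [|k].
    by rewrite !mul0r !mulr0 !expr0 !subr0; move: (expR _) => E; field.
  rewrite !exprS /= -natr1; move: (expR _) (x^-1 ^+ k) (k%:R) => E y c.
  by rewrite expr0 mulr1; field.
(* At the origin the difference quotient of [flat k] is [flat k.+1], which tends to 0. *)
- have d0 : h^-1 *: ((flat k \o shift 0) (h *: 1) - flat k 0) @[h --> 0^'] --> (0 : R).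
    rewrite (_ : (fun h => _) = flat k.+1); first exact: cvg_flat0.
    apply/funext => h /=; rewrite [flat k 0]flat_eq0// subr0 addr0.
    by rewrite /GRing.scale/= mulr1 flatS.
  rewrite flat_eq0// mul0r; apply: DeriveDef; first by apply/cvg_ex; exists 0.
  exact/cvg_lim.
Unshelve. all: by end_near. Qed.

(** The stable family consists of the v [flat k](u) with v smooth. Since [flat k](u) equals u^2
    [flat k.+2](u), the derivative is again a smooth factor times [flat k.+2](u). *)
Lemma smooth_flat u : smooth (fun x => (u x)%:C) ->
  smooth (fun x => (flat 0 (u x))%:C).
Proof.
move=> su; pose S := [set f : R -> R[i] | exists v k, smooth v /\
  f = fun x => v x * (flat k (u x))%:C].
apply: (@smooth_coind _ S); last first.
  exists (fun=> 1), 0%N; split; first exact: smooth_cst.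
  by apply/funext => x; rewrite mul1r.
move=> _ [v [k [sv ->]]].
have d x : is_derive x 1 (fun x => flat k (u x))
    (flat k.+2 (u x) * (1 - k%:R * u x) * derive1 u x).
  have du : is_derive x 1 u (derive1 u x).
    by rewrite derive1E; apply/derivableP/smooth_real_derivable.
  exact: (@is_derive1_comp R (flat k) u x _ _ (is_derive_flat k (u x)) du).
have dd x := is_derive_cderiv (d x).
split=> [x|]; first by apply: cderivableM; [exact: (sv 0%N)|have [] := dd x].
exists (fun x => cderiv v x * (u x)%:C ^+ 2 +
  (v x * (1 + (- k%:R) * (u x)%:C)) * cderiv (fun x => (u x)%:C) x), k.+2.
split.
  have s1 := smoothM (smooth_cderiv sv) (smoothX 2 su).
  have s2 := smoothD (smooth_cst (1 : R[i])) (smoothM (smooth_cst (- k%:R)) su).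
  exact: (smoothD s1 (smoothM (smoothM sv s2) (smooth_cderiv su))).
apply/funext => x; rewrite cderivM_at; [|exact: (sv 0%N)|by have [] := dd x].
rewrite (dd x).2 cderiv_real.
have -> : flat k (u x) = u x ^+ 2 * flat k.+2 (u x).
  rewrite -!flatS /flat; case: ifPn => [u0|]; last by rewrite !mulr0.
  by field; rewrite gt_eqF.
by rewrite !(rmorphM, rmorphXn, rmorphB, rmorph1, rmorph_nat)/=; ring.
Qed.

(** The bump is F(a)/(F(a) + F(b)) with F = [flat 0], where [a] is positive exactly for |x - p| < d
    and [b] exactly for |x - p| > d/2. One of the two is always positive, so the denominator never
    vanishes; squares replace absolute values to keep [a] and [b] smooth. *)
Lemma exists_bump p d : 0 < d -> exists u : R -> R,
  [/\ smooth (fun x => (u x)%:C),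
      forall x, 0 <= u x,
      forall x, `|x - p| <= d / 2 -> u x = 1 &
      forall x, d <= `|x - p| -> u x = 0].
Proof.
move=> d0; pose a x := d ^+ 2 - (x - p) ^+ 2.
pose b x := (x - p) ^+ 2 - (d / 2) ^+ 2.
have sq : smooth (fun x => (x - p)%:C ^+ 2).
  apply: smoothX; rewrite (_ : (fun x => _) = fun x => x%:C + (- p)%:C).
    exact: (smoothD (@smooth_id R) (smooth_cst (- p)%:C)).
  by apply/funext => y; rewrite -rmorphD.
have sa : smooth (fun x => (flat 0 (a x))%:C).
  apply: smooth_flat.
  rewrite (_ : (fun x => _) = fun x => (d ^+ 2)%:C + (- 1) * (x - p)%:C ^+ 2).
    exact: (smoothD (smooth_cst _) (smoothM (smooth_cst _) sq)).
  by apply/funext => y; rewrite mulN1r -rmorphXn -rmorphB.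
have sb : smooth (fun x => (flat 0 (b x))%:C).
  apply: smooth_flat.
  rewrite (_ : (fun x => _) = fun x => (x - p)%:C ^+ 2 + (- (d / 2) ^+ 2)%:C).
    exact: (smoothD sq (smooth_cst _)).
  by apply/funext => y; rewrite -rmorphXn -rmorphD.
have ab0 x : 0 < flat 0 (a x) + flat 0 (b x).
  have [a0|a0] := ltP 0 (a x); first by rewrite ltr_wpDr ?flat_gt0// flat_ge0.
  rewrite ltr_wpDl ?flat_ge0// flat_gt0// /b subr_gt0.
  move: a0; rewrite /a subr_le0; apply: lt_le_trans.
  by rewrite ltr_pXn2r ?nnegrE ?ltW ?divr_gt0// ltr_pdivrMr// ltr_pMr// ltr1n.
exists (fun x => flat 0 (a x) * (flat 0 (a x) + flat 0 (b x))^-1); split.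
- rewrite (_ : (fun x => _) = fun x => (flat 0 (a x))%:C *
    (flat 0 (a x) + flat 0 (b x))^-1%:C).
    have sab : smooth (fun x => (flat 0 (a x) + flat 0 (b x))%:C).
      rewrite (_ : (fun x => _) = fun x => (flat 0 (a x))%:C + (flat 0 (b x))%:C).
        exact: (smoothD sa sb).
      by apply/funext => y; rewrite -rmorphD.
    apply: (smoothM sa); apply: (smooth_realV _ sab) => x.
    by rewrite gt_eqF.
  by apply/funext => y; rewrite -rmorphM.
- by move=> x; rewrite mulr_ge0 ?flat_ge0// invr_ge0 ltW.
- move=> x xd; rewrite (@flat_eq0 _ (b x)).
    rewrite addr0 divff// gt_eqF// flat_gt0// subr_gt0 -real_normK ?num_real//.
    rewrite ltr_pXn2r ?nnegrE ?(ltW d0)// (le_lt_trans xd)//.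
    by rewrite ltr_pdivrMr// ltr_pMr// ltr1n.
  rewrite subr_le0 -real_normK ?num_real// ler_pXn2r ?nnegrE//.
  by rewrite divr_ge0// ltW.
- move=> x dx; rewrite flat_eq0 ?mul0r// subr_le0 -[leRHS]real_normK ?num_real//.
  by rewrite ler_pXn2r ?nnegrE// ltW.
Qed.

End Bump.

(** * Integration of piecewise smooth functions *)

Section RealIntegration.
Variable R : realType.
Local Notation mu := (@lebesgue_measure R).
Implicit Types (u v : R -> R) (s : seq R) (p x a b e B : R) (K : set R).

Lemma set_seq_nil : [set` [::] : seq R] = set0.
Proof. by apply/seteqP; split. Qed.

Lemma set_seq_cons p s : [set` p :: s] = [set p] `|` [set` s].
Proof.
apply/seteqP; split => x /=; rewrite inE.
  by move=> /predU1P[->|xs]; [left|right].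
by move=> [->|xs]; apply/predU1P; [left|right].
Qed.

Lemma finite_seq_set s : finite_set [set` s].
Proof. exact: finite_seq. Qed.

Lemma open_seqC s : open [set x : R | x \notin s].
Proof.
rewrite (_ : [set x | x \notin s] = ~` [set` s]); last first.
  by apply/seteqP; split => x /= /negP.
apply: closed_openC; elim: s => [|p s IH]; first by rewrite set_seq_nil; exact: closed0.
by rewrite set_seq_cons; apply: closedU => //; exact: closed1.
Qed.

Lemma measurable_seq s : measurable [set` s].
Proof.
elim: s => [|p s IH]; first by rewrite set_seq_nil; exact: measurable0.
by rewrite set_seq_cons; apply: measurableU.
Qed.

Lemma lebesgue_seq s : mu [set` s] = 0%E.
Proof.
by apply: countable_lebesgue_measure0; apply: finite_set_countable; exact: finite_seq_set.
Qed.

Lemma measurable_off_seq s u : (forall x, x \notin s -> {for x, continuous u}) ->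
  measurable_fun setT u.
Proof.
move=> cu; have -> : [set: R] = [set x | x \notin s] `|` [set` s].
  by apply/seteqP; split => x //= _; case: (x \in s); [right|left].
have mo : measurable [set x : R | x \notin s].
  by apply: open_measurable; exact: open_seqC.
apply/(measurable_funU _ mo (measurable_seq s)); split.
  apply: open_continuous_measurable_fun; first exact: open_seqC.
  by move=> x; rewrite inE; exact: cu.
move=> _ Y mY; apply: countable_measurable.
  by move=> x; exact: measurable_set1.
by apply: finite_set_countable; apply: finite_setIl; exact: finite_seq_set.
Qed.

Lemma ae_eq_seq s u v : measurable_fun setT u -> measurable_fun setT v ->
  (forall x, x \notin s -> u x = v x) ->
  \int[mu]_x u x = \int[mu]_x v x.
Proof.
move=> mu_ mv uv; congr fine; apply: ae_eq_integral => //.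
- exact/measurable_EFinP.
- exact/measurable_EFinP.
- exists [set` s]; split; [exact: measurable_seq|exact: lebesgue_seq|].
  move=> x /= H; apply/negPn/negP => xs; apply: H => _; rewrite uv//.
Qed.

Lemma integrable_compact_supp u K : compact K ->
  (forall x, ~ K x -> u x = 0) -> mu.-integrable K (EFin \o u) ->
  mu.-integrable setT (EFin \o u).
Proof.
move=> cK u0 iu; have := (integrable_mkcond (mu := mu) (EFin \o u) (compact_measurable cK)).1 iu.
congr (_.-integrable _ _); apply/funext => x; rewrite patchE.
by case: ifPn => // /negP; rewrite inE => /u0 /= ->.
Qed.

Lemma Rintegral_compact_supp u K : (forall x, ~ K x -> u x = 0) ->
  \int[mu]_x u x = \int[mu]_(x in K) u x.
Proof.
move=> u0; rewrite [RHS]Rintegral_mkcond; congr (Rintegral _ _ _).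
apply/funext => x; rewrite patchE.
by case: ifPn => // /negP; rewrite inE => /u0 ->.
Qed.

Lemma locally_integrableP u K : locally_integrable setT u -> compact K ->
  mu.-integrable K (EFin \o u).
Proof.
move=> [mu_ _ iu] cK; apply/integrableP; split; last exact: iu.
by apply/measurable_EFinP; apply: measurable_funS mu_.
Qed.

Lemma integrable_locM u v K B : locally_integrable setT u ->
  measurable_fun setT v -> compact K -> (forall x, ~ K x -> v x = 0) ->
  (forall x, `|v x| <= B) ->
  mu.-integrable setT (EFin \o (fun x => u x * v x)) /\
  `| \int[mu]_x (u x * v x) | <= B * \int[mu]_(x in K) `|u x|.
Proof.
move=> lu mv cK v0 vB; have mK := compact_measurable cK.
have iu := locally_integrableP lu cK; have [mu_ _ _] := lu.
have muv : measurable_fun setT (fun x => u x * v x) by exact: measurable_funM.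
have iB : mu.-integrable K (EFin \o (fun x => B * `|u x|)).
  have := integrableZl (mu := mu) mK B (integrable_norm iu).
  by apply: eq_integrable => // x _ /=; rewrite EFinM.
have uvB x : `|u x * v x| <= B * `|u x|.
  by rewrite normrM mulrC ler_wpM2r.
have iuv : mu.-integrable K (EFin \o (fun x => u x * v x)).
  apply: le_integrable iB => //.
    by apply/measurable_EFinP; exact: measurable_funS muv.
  by move=> x _ /=; rewrite lee_fin (le_trans (uvB x))// ler_norm.
have uv0 x : ~ K x -> u x * v x = 0 by move=> /v0 ->; rewrite mulr0.
split; first exact: integrable_compact_supp cK uv0 iuv.
rewrite (Rintegral_compact_supp uv0).
rewrite -RintegralZl//; last exact: (integrable_norm iu).
apply: le_trans (le_normr_Rintegral _ iuv) _ => //.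
by apply: le_Rintegral => //; exact: (integrable_norm iuv).
Qed.

Lemma bounded_compact u K : compact K ->
  (forall x, K x -> exists M, \forall y \near x, `|u y| <= M) ->
  exists M, forall x, K x -> `|u x| <= M.
Proof.
move=> /compact_near_coveringP cK uM.
have [|M [_ MK]] := cK R +oo (fun M x => `|u x| <= M) _.
  move=> x /uM[M uxM]; exists ([set y | `|u y| <= M], `[M, +oo[%classic).
    by split => //=; exists M; split; [exact: num_real|move=> y /ltW My; rewrite /= in_itv/= My].
  by move=> [y N] /= [uy]; rewrite in_itv/= andbT; exact: le_trans.
by exists (M + 1) => x Kx; apply: (MK (M + 1)) => //; rewrite ltrDl.
Qed.

Lemma locally_integrable_bounded u : measurable_fun setT u ->
  (forall x, exists M, \forall y \near x, `|u y| <= M) ->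
  locally_integrable setT u.
Proof.
move=> mu_ uM; split => //; first exact: openT.
move=> K _ cK; have [M KM] := bounded_compact cK (fun x _ => uM x).
have mK := compact_measurable cK.
have : mu.-integrable K (EFin \o u).
  apply: measurable_bounded_integrable => //.
  - exact: compact_finite_measure.
  - exact: measurable_funS mu_.
  - exists M; split; first exact: num_real.
    by move=> N /ltW MN x Kx; exact: le_trans (KM x Kx) MN.
by move=> /integrableP[].
Qed.

Lemma near_bounded_limits u x (l r : R) : u y @[y --> x^'-] --> l ->
  u y @[y --> x^'+] --> r -> exists M, \forall y \near x, `|u y| <= M.
Proof.
move=> ul ur; pose M := `|l| + `|r| + `|u x| + 1; exists M.
have lM : `|l| < M by rewrite /M -!addrA ltrDl !addrA ltr_wpDl// addr_ge0.
have rM : `|r| < M by rewrite /M -addrA (addrC `|l|) -addrA ltrDl addrA ltr_wpDl// addr_ge0.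
have xM : `|u x| <= M by rewrite /M -addrA addrC -addrA lerDl addr_ge0// addr_ge0.
have h1 : x^'- (fun y => `|u y| <= M).
  by apply: filterS (cvgr_norm_lt _ ul _ lM) => y; exact: ltW.
have h2 : x^'+ (fun y => `|u y| <= M).
  by apply: filterS (cvgr_norm_lt _ ur _ rM) => y; exact: ltW.
move: h1 h2; rewrite /at_left /at_right /within/= => h1 h2.
apply: filterS2 h1 h2 => y h1 h2; have [yx|xy|->//] := ltgtP y x.
  exact: h1.
exact: h2.
Qed.

(** Uniqueness of Lebesgue measure reduces translation invariance to half-open intervals. *)
Lemma lebesgue_pushforward_shift e A : measurable A ->
  pushforward mu (shift e : R -> measurableTypeR R) A = mu A.
Proof.
move=> mA; have ms : measurable_fun setT (fun x : R => x + e).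
  by apply: measurable_funD => //; exact: measurable_cst.
apply/esym/lebesgue_measure_unique => //= _ [[a b]] _ <-.
rewrite /pushforward (_ : _ @^-1` _ = `]a - e, b - e]%classic); last first.
  by apply/seteqP; split => x /=; rewrite !in_itv/= ltrBlDr lerBrDr.
rewrite !lebesgue_measure_itv/= !lte_fin ltrD2r.
by case: ifP => // _; rewrite -!EFinB opprB addrA subrK.
Qed.

Lemma Rintegral_shift u e : mu.-integrable setT (EFin \o u) ->
  mu.-integrable setT (EFin \o (fun x => u (x + e))) /\
  \int[mu]_x u (x + e) = \int[mu]_x u x.
Proof.
move=> iu; have [mu_ _] := integrableP _ _ _ iu.
pose phi : measurableTypeR R -> measurableTypeR R := shift e.
have ms : measurable_fun setT phi.
  by apply: measurable_funD => //; exact: measurable_cst.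
pose w x := (`|u x|)%:E.
have mw : measurable_fun setT w by apply/measurable_EFinP; apply: measurableT_comp => //; exact/measurable_EFinP.
have ip : mu.-integrable setT (EFin \o (fun x => u (x + e))).
  apply/integrableP; split; first exact: (measurableT_comp mu_ ms).
  move: (iu) => /integrableP[_]; apply: le_lt_trans.
  have := @ge0_integral_pushforward _ _ _ _ R _ ms mu setT w measurableT mw.
  rewrite preimage_setT => <-; last by move=> y _; rewrite lee_fin.
  rewrite (@eq_measure_integral _ _ _ setT mu)// => A mA _.
  exact: lebesgue_pushforward_shift.
split=> //; congr fine.
have := @integral_pushforward _ _ _ _ R phi ms mu setT (EFin \o u) mu_.
rewrite preimage_setT => /(_ ip measurableT) <-.
apply: eq_measure_integral => // A mA _.
exact: lebesgue_pushforward_shift.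
Qed.

End RealIntegration.

(** * The fundamental theorem of calculus in the presence of jumps *)

Section PiecewiseFTC.
Variable R : realType.
Local Notation mu := (@lebesgue_measure R).
Implicit Types (u : R -> R) (s : seq R) (p x a b M : R).

Definition rlimR u x : R := lim (u y @[y --> x^'+]).
Definition llimR u x : R := lim (u y @[y --> x^'-]).

Lemma rlimRE u x (l : R) : u y @[y --> x^'+] --> l -> rlimR u x = l.
Proof. by move=> ul; apply/cvg_lim. Qed.

Lemma llimRE u x (l : R) : u y @[y --> x^'-] --> l -> llimR u x = l.
Proof. by move=> ul; apply/cvg_lim. Qed.

Definition has_side_limits u := forall x,
  cvg (u y @[y --> x^'-]) /\ cvg (u y @[y --> x^'+]).

Lemma near_right_lt a b : a < b -> \forall y \near a^'+, a < y < b.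
Proof.
move=> ab; near=> y; apply/andP; split; first by near: y; exact: nbhs_right_gt.
by near: y; exact: nbhs_right_lt.
Unshelve. all: by end_near. Qed.

Lemma near_left_gt a b : a < b -> \forall y \near b^'-, a < y < b.
Proof.
move=> ab; near=> y; apply/andP; split; first by near: y; exact: nbhs_left_gt.
by near: y; exact: nbhs_left_lt.
Unshelve. all: by end_near. Qed.

(** Both [u] and its derivative are extended from the open interval to its end points by their
    one-sided limits ([ext]); the theorem for continuous functions on a closed interval then
    applies, and the end points do not affect the integral. *)
Lemma FTC_open u a b : a < b ->
  (forall x, x \in `]a, b[ -> derivable u x 1 /\ {for x, continuous (derive1 u)}) ->
  has_side_limits u -> has_side_limits (derive1 u) ->
  \int[mu]_(x in `[a, b]) derive1 u x = llimR u b - rlimR u a.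
Proof.
move=> ab du lu lu'.
pose ext (v : R -> R) x :=
  if x <= a then rlimR v a else if b <= x then llimR v b else v x.
have extE v x : a < x < b -> ext v x = v x.
  by move=> /andP[ax xb]; rewrite /ext leNgt ax/= leNgt xb.
have exta v : ext v a = rlimR v a by rewrite /ext lexx.
have extb v : ext v b = llimR v b by rewrite /ext leNgt ab/= lexx.
have extr v : has_side_limits v -> ext v y @[y --> a^'+] --> ext v a.
  move=> /(_ a)[_ cv]; rewrite exta; apply: cvg_trans cv.
  by apply: near_eq_cvg; apply: filterS (near_right_lt ab) => y /extE ->.
have extl v : has_side_limits v -> ext v y @[y --> b^'-] --> ext v b.
  move=> /(_ b)[cv _]; rewrite extb; apply: cvg_trans cv.
  by apply: near_eq_cvg; apply: filterS (near_left_gt ab) => y /extE ->.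
have nearE v x : x \in `]a, b[ -> \forall y \near x, v y = ext v y.
  move=> xab; have := @interval_open R (BRight a) (BLeft b) isT isT.
  rewrite openE => /(_ x xab); apply: filterS => y /=; rewrite in_itv/=.
  by move=> /extE ->.
have cext : {within `[a, b], continuous (ext (derive1 u))}.
  apply/(continuous_within_itvP _ ab); split; [|exact: extr|exact: extl].
  move=> x xab; have [_ cu] := du x xab.
  rewrite /prop_for /continuous_at extE; last by rewrite in_itv/= in xab.
  apply: cvg_trans cu; apply: near_eq_cvg; exact: nearE.
have dext : derivable_oo_LRcontinuous (ext u) a b.
  split; [|exact: extr|exact: extl] => x xab; have [dx _] := du x xab.
  by apply: near_eq_derivable dx; apply: filterS (nearE u x xab).
have eext : {in `]a, b[, (ext u)^`()%classic =1 ext (derive1 u)}.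
  move=> x xab; rewrite [RHS]extE; last by rewrite in_itv/= in xab.
  by rewrite !derive1E; apply/esym/near_eq_derive; exact: nearE.
have := continuous_FTC2 ab cext dext eext.
rewrite exta extb -EFinB => /(congr1 fine)/= <-.
rewrite /Rintegral; congr fine.
have mu' : measurable_fun (`]a, b[%classic : set R) (EFin \o derive1 u).
  apply/measurable_EFinP; apply: open_continuous_measurable_fun.
    exact: interval_open.
  by move=> x; rewrite inE => xab; have [] := du x xab.
rewrite (integral_itv_bndoo _ _ mu') (@integral_itv_bndoo R a b).
  by apply: eq_integral => x; rewrite inE/= in_itv/= => xab; rewrite extE.
apply/measurable_EFinP; apply: open_continuous_measurable_fun.
  exact: interval_open.
move=> x; rewrite inE => xab; have [_ cu] := du x xab.
rewrite /prop_for /continuous_at extE; last by rewrite /= in_itv/= in xab.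
by apply: cvg_trans cu; apply: near_eq_cvg; exact: nearE.
Qed.

(** Induction on the break points, which [path] lists in increasing order between [a] and [b].
    Joining the intervals on the two sides of a break point leaves minus its jump. *)
Lemma FTC_piecewise u s a b : path <%R a (rcons s b) ->
  (forall x, x \in `]a, b[ -> x \notin s ->
     derivable u x 1 /\ {for x, continuous (derive1 u)}) ->
  has_side_limits u -> has_side_limits (derive1 u) ->
  locally_integrable setT (derive1 u) ->
  \int[mu]_(x in `[a, b]) derive1 u x =
  llimR u b - rlimR u a - \sum_(p <- s) (rlimR u p - llimR u p).
Proof.
move=> ps du lu lu' iu'; elim: s a ps du => [|p s IH] a /=.
  rewrite andbT => ab du; rewrite big_nil subr0; apply: FTC_open => // x xab.
  exact: du.
move=> /andP[ap ps] du.
have pb : p < b.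
  by have /allP := order_path_min lt_trans ps; apply; rewrite mem_rcons mem_head.
have sp x : x \in s -> p < x.
  move=> xs; have /allP := order_path_min lt_trans ps; apply.
  by rewrite mem_rcons inE xs orbT.
have iab : mu.-integrable `[a, b] (EFin \o derive1 u).
  by apply: locally_integrableP => //; exact: segment_compact.
have := @Rintegral_itvB R (derive1 u) (BLeft a) (BRight b) p iab.
rewrite !bnd_simp => /(_ (ltW ap) (ltW pb)) /eqP; rewrite subr_eq => /eqP ->.
rewrite Rintegral_itv_obnd_cbnd; last first.
  apply: integrableS iab => //; apply: subset_itvr.
  by rewrite bnd_simp ltW.
rewrite IH//; last first.
  move=> x; rewrite in_itv/= => /andP[px xb] xs; apply: du.
    by rewrite in_itv/= (lt_trans ap px).
  by rewrite inE negb_or xs gt_eqF.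
rewrite FTC_open// => [|x]; first by rewrite big_cons; ring.
rewrite in_itv/= => /andP[ax xp]; apply: du.
  by rewrite in_itv/= ax (lt_trans xp pb).
rewrite inE negb_or lt_eqF//=; apply/negP => /sp px.
by have := lt_trans px xp; rewrite ltxx.
Qed.

(** With [M] a bound for both [K] and [s], the integral is taken over [-(M+1), M+1]: the boundary
    limits vanish and all break points lie inside. Sorting [s] makes it a path. *)
Lemma FTC_compact_supp u s K : uniq s -> compact K ->
  (forall x, ~ K x -> u x = 0) ->
  (forall x, x \notin s ->
     derivable u x 1 /\ {for x, continuous (derive1 u)}) ->
  has_side_limits u -> has_side_limits (derive1 u) ->
  locally_integrable setT (derive1 u) ->
  \int[mu]_x derive1 u x = - \sum_(p <- s) (rlimR u p - llimR u p).
Proof.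
move=> us cK u0 du lu lu' iu'.
have [M [M0 KM sM]] : exists M, [/\ 0 < M, forall x, K x -> `|x| <= M &
    forall x, x \in s -> `|x| <= M].
  have [N [_ KN]] := compact_bounded cK.
  pose N' := `|N| + 1 + \sum_(p <- s) `|p|.
  have s0 : 0 <= \sum_(p <- s) `|p| by apply: sumr_ge0.
  exists N'; split.
  - by rewrite /N' -addrA ltr_wpDl// ltr_pwDl.
  - move=> x Kx; apply: (KN N') => //.
    by rewrite /N' -addrA (le_lt_trans (ler_norm N))// ltrDl ltr_pwDl.
  - move=> x xs; rewrite /N' (big_rem x)//= addrCA lerDl.
    by rewrite addr_ge0 ?addr_ge0// sumr_ge0.
have {}u0 x : M < `|x| -> u x = 0.
  by move=> Mx; apply: u0 => /KM; rewrite leNgt Mx.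
have side (F : set_system R) : ProperFilter F ->
    F [set y | M < `|y|] -> lim (u y @[y --> F]) = 0.
  move=> PF FM; apply/cvg_lim => //; apply: (@cvg_trans _ (cst (0 : R) y @[y --> F])).
    by apply: near_eq_cvg; apply: filterS FM => y /= /u0 ->.
  exact: cvg_cst.
have M1 : M < M + 1 by rewrite ltrDl.
have NM1 : - (M + 1) < - M by rewrite ltrN2.
have MM : - (M + 1) < M + 1 by rewrite (lt_trans NM1)// (lt_trans _ M1)// gtrN.
have lM : llimR u (M + 1) = 0.
  apply: side; apply: filterS (near_left_gt M1) => y /andP[My _] /=.
  by rewrite (lt_le_trans My)// ler_norm.
have rM : rlimR u (- (M + 1)) = 0.
  apply: side; apply: filterS (near_right_lt NM1) => y /andP[_ yM] /=.
  by rewrite -normrN (lt_le_trans _ (ler_norm _))// ltrNr.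
have u'0 x : ~ `[- (M + 1), M + 1]%classic x -> derive1 u x = 0.
  rewrite /= in_itv/= => /negP; rewrite -ler_norml -ltNge => Mx.
  rewrite derive1E (@near_eq_derive _ _ _ u (cst 0)) ?derive_cst//.
  have : \forall y \near x, M < `|y|.
    have := @norm_continuous R R x; rewrite /continuous_at => cx.
    by apply: (cvgr_gt _ cx); exact: lt_trans Mx.
  by move=> nM; apply: filterS nM => y /u0 ->.
rewrite (Rintegral_compact_supp u'0).
pose s' := sort <=%R s.
have srt : path <%R (- (M + 1)) (rcons s' (M + 1)).
  have sM' x : x \in s -> - (M + 1) < x < M + 1.
    by move=> /sM xM; rewrite -ltr_norml (le_lt_trans xM).
  rewrite rcons_path lt_path_sortedE sort_lt_sorted us andbT; apply/andP; split.
    by apply/allP => x; rewrite mem_sort => /sM'/andP[].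
  have := mem_last (- (M + 1)) s'; rewrite inE => /predU1P[->//|].
  by rewrite mem_sort => /sM'/andP[].
have -> : \sum_(p <- s) (rlimR u p - llimR u p) =
    \sum_(p <- s') (rlimR u p - llimR u p).
  by apply: perm_big; rewrite perm_sym; exact/permPl/perm_sort.
rewrite (FTC_piecewise srt)// ?lM ?rM ?subrr ?sub0r// => x _.
by rewrite mem_sort; exact: du.
Qed.

End PiecewiseFTC.

Section ComplexNorm.
Variable R : realType.
Implicit Types (z : R[i]) (r : R).

Lemma normc_le_ReIm z : `|z| <= (`|complex.Re z| + `|complex.Im z|)%:C.
Proof.
rewrite normc_def lecR -(ger0_norm (addr_ge0 (normr_ge0 _) (normr_ge0 _))).
rewrite -sqrtr_sqr ler_wsqrtr// sqrrD !real_normK ?num_real//.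
by rewrite lerD2r lerDl mulrn_wge0// mulr_ge0.
Qed.

Lemma normc_le_Re z r : `|z| <= r%:C -> `|complex.Re z| <= r.
Proof. by move=> zr; rewrite -lecR; exact: le_trans (normc_ge_Re z) zr. Qed.

Lemma normc_le_Im z r : `|z| <= r%:C -> `|complex.Im z| <= r.
Proof.
rewrite normc_def lecR; apply: le_trans.
by rewrite -sqrtr_sqr ler_wsqrtr// lerDr sqr_ge0.
Qed.

End ComplexNorm.

(** * Complex-valued integrals and dominated convergence *)

Section ComplexIntegral.
Variable R : realType.
Local Notation mu := (@lebesgue_measure R).
Implicit Types (f g v : R -> R[i]) (s : seq R) (p x a b e B : R) (K : set R).

Definition cintegrable f :=
  mu.-integrable setT (EFin \o reF f) /\ mu.-integrable setT (EFin \o imF f).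

Definition cmeasurable f :=
  measurable_fun setT (reF f) /\ measurable_fun setT (imF f).

Lemma cintegralD f g : cintegrable f -> cintegrable g ->
  cintegral (fun x => f x + g x) = cintegral f + cintegral g.
Proof.
move=> [fr fi] [gr gi]; rewrite /cintegral reFD imFD.
by rewrite (RintegralD measurableT fr gr) (RintegralD measurableT fi gi).
Qed.

Lemma reFZ (a : R[i]) f : reF (fun x => a * f x) =
  (fun x => complex.Re a * reF f x - complex.Im a * imF f x).
Proof. by apply/funext => x; rewrite /reF /imF; case: (f x) a => [? ?] []. Qed.

Lemma imFZ (a : R[i]) f : imF (fun x => a * f x) =
  (fun x => complex.Re a * imF f x + complex.Im a * reF f x).
Proof. by apply/funext => x; rewrite /reF /imF; case: (f x) a => [? ?] []. Qed.

Lemma integrable_realZ (c : R) (u : R -> R) : mu.-integrable setT (EFin \o u) ->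
  mu.-integrable setT (EFin \o (fun x => c * u x)).
Proof.
move=> iu; have := integrableZl (mu := mu) measurableT c iu.
by apply: eq_integrable => // x _ /=; rewrite EFinM.
Qed.

Lemma cintegrableZ (a : R[i]) f : cintegrable f -> cintegrable (fun x => a * f x).
Proof.
move=> [fr fi]; rewrite /cintegrable reFZ imFZ; split.
- have := integrableB measurableT (integrable_realZ (complex.Re a) fr)
    (integrable_realZ (complex.Im a) fi).
  by apply: eq_integrable => // x _; rewrite /= -EFinB.
- have := integrableD measurableT (integrable_realZ (complex.Re a) fi)
    (integrable_realZ (complex.Im a) fr).
  by apply: eq_integrable => // x _; rewrite /= -EFinD.
Qed.

Lemma cintegralZ (a : R[i]) f : cintegrable f ->
  cintegral (fun x => a * f x) = a * cintegral f.
Proof.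
move=> [fr fi]; rewrite /cintegral reFZ imFZ.
rewrite (RintegralB measurableT (integrable_realZ (complex.Re a) fr)
    (integrable_realZ (complex.Im a) fi)).
rewrite (RintegralD measurableT (integrable_realZ (complex.Re a) fi)
    (integrable_realZ (complex.Im a) fr)).
rewrite !(RintegralZl _ measurableT fr) !(RintegralZl _ measurableT fi).
by case: a.
Qed.

Lemma cintegral_shift f e : cintegrable f ->
  cintegrable (fun x => f (x + e)) /\
  cintegral (fun x => f (x + e)) = cintegral f.
Proof.
move=> [fr fi]; have [ir er] := Rintegral_shift e fr.
have [ii ei] := Rintegral_shift e fi; split; first by split.
by rewrite /cintegral; congr (_ +i* _).
Qed.

Lemma cintegral_ae s f g : cmeasurable f -> cmeasurable g ->
  (forall x, x \notin s -> f x = g x) -> cintegral f = cintegral g.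
Proof.
move=> [fr fi] [gr gi] fg; rewrite /cintegral; congr (_ +i* _).
- by apply: (ae_eq_seq (s := s)) => // x xs; rewrite /reF fg.
- by apply: (ae_eq_seq (s := s)) => // x xs; rewrite /imF fg.
Qed.

Lemma cmeasurableM f g : cmeasurable f -> cmeasurable g ->
  cmeasurable (fun x => f x * g x).
Proof.
move=> [fr fi] [gr gi]; rewrite /cmeasurable reFM imFM; split.
- exact: (measurable_funB (measurable_funM fr gr) (measurable_funM fi gi)).
- exact: (measurable_funD (measurable_funM fr gi) (measurable_funM fi gr)).
Qed.

Lemma clocally_integrable_measurable f : clocally_integrable f -> cmeasurable f.
Proof. by move=> [[? _ _] [? _ _]]. Qed.

(** The bound, a constant depending on [f] and [K] times a bound of [v], is the continuity estimate
    that makes [regdist f] a distribution. The factor 2 appears because each part of [f] is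
    multiplied by both parts of [v]. *)
Lemma cintegrable_locM f v K B : clocally_integrable f -> cmeasurable v ->
  compact K -> (forall x, ~ K x -> v x = 0) ->
  (forall x, `|v x| <= B%:C) ->
  cintegrable (fun x => f x * v x) /\
  `|cintegral (fun x => f x * v x)| <=
  (2 * (\int[mu]_(x in K) `|reF f x| + \int[mu]_(x in K) `|imF f x|) * B)%:C.
Proof.
move=> [fr fi] [vr vi] cK v0 vB.
have rB x : `|reF v x| <= B by exact: normc_le_Re.
have iB x : `|imF v x| <= B by exact: normc_le_Im.
have r0 x : ~ K x -> reF v x = 0 by move=> /v0; rewrite /reF => ->.
have i0 x : ~ K x -> imF v x = 0 by move=> /v0; rewrite /imF => ->.
have [irr brr] := integrable_locM fr vr cK r0 rB.
have [iri bri] := integrable_locM fr vi cK i0 iB.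
have [iir bir] := integrable_locM fi vr cK r0 rB.
have [iii bii] := integrable_locM fi vi cK i0 iB.
split.
  rewrite /cintegrable reFM imFM; split.
    have := integrableB measurableT irr iii.
    by apply: eq_integrable => // x _; rewrite /= -EFinB.
  have := integrableD measurableT iri iir.
  by apply: eq_integrable => // x _; rewrite /= -EFinD.
apply: le_trans (normc_le_ReIm _) _; rewrite lecR /cintegral reFM imFM/=.
rewrite (RintegralB measurableT irr iii) (RintegralD measurableT iri iir).
have := ler_normB (\int[mu]_x (reF f x * reF v x)) (\int[mu]_x (imF f x * imF v x)).
have := ler_normD (\int[mu]_x (reF f x * imF v x)) (\int[mu]_x (imF f x * reF v x)).
by move: brr bri bir bii; lra.
Qed.

Lemma dominated_seq s (h : nat -> R -> R) (h0 G : R -> R) :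
  (forall n, measurable_fun setT (h n)) -> measurable_fun setT h0 ->
  mu.-integrable setT (EFin \o G) ->
  (forall n x, `|h n x| <= G x) ->
  (forall x, x \notin s -> h n x @[n --> \oo] --> h0 x) ->
  \int[mu]_x h n x @[n --> \oo] --> \int[mu]_x h0 x.
Proof.
move=> mh mh0 iG hG hh0.
have mh' n : measurable_fun setT (EFin \o h n) by exact/measurable_EFinP.
have mh0' : measurable_fun setT (EFin \o h0) by exact/measurable_EFinP.
have [] := @dominated_convergence _ _ R mu setT measurableT
  (fun n => EFin \o h n) (EFin \o h0) (EFin \o G) mh' mh0' _ iG _.
- exists [set` s]; split; [exact: measurable_seq|exact: lebesgue_seq|].
  move=> x /= H; apply/negPn/negP => xs; apply: H => _.
  by apply: cvg_EFin; [exact: nearW|exact: hh0].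
- by apply: aeW => x n _; rewrite /= lee_fin.
move=> ih0 _ hc.
rewrite /Rintegral; apply: fine_cvg; rewrite fineK//.
by apply: integrable_fin_num.
Qed.

Lemma dominated_at_right s (h : R -> R -> R) (h0 : R -> R) K B :
  compact K ->
  (forall e, 0 < e < 1 -> measurable_fun setT (h e)) -> measurable_fun setT h0 ->
  (forall e x, 0 < e < 1 -> ~ K x -> h e x = 0) ->
  (forall e x, 0 < e < 1 -> `|h e x| <= B) ->
  (forall x, x \notin s -> h e x @[e --> 0^'+] --> h0 x) ->
  \int[mu]_x h e x @[e --> 0^'+] --> \int[mu]_x h0 x.
Proof.
move=> cK mh mh0 hK hB hh0.
(* The bounds hold for [e < 1] only, whereas the sequential criterion ranges over all positive
   sequences tending to 0. Truncation does not change the limit. *)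
pose h' e := if e < 1 then h e else cst 0.
have h'E : \forall e \near 0^'+, h' e = h e.
  by apply: filterS (near_right_lt ltr01) => e /andP[_ e1]; rewrite /h' e1.
suff : \int[mu]_x h' e x @[e --> 0^'+] --> \int[mu]_x h0 x.
  by move=> H; apply: cvg_trans H; apply: near_eq_cvg; apply: filterS h'E => e ->.
apply/cvg_at_rightP => u [u0 uc].
have B0 : 0 <= B.
  by apply: le_trans (hB (2^-1) 0 _) => //; rewrite invr_gt0 ltr0n/= invf_lt1// ltr1n.
apply: (@dominated_seq s _ _ (fun x => B * \1_K x)) => //.
- move=> n; rewrite /h'; case: ifPn => [un|_]; last exact: measurable_cst.
  by apply: mh; rewrite u0.
- apply: integrable_realZ; apply: (integrable_compact_supp cK).
    by move=> x nK; rewrite indicE memNset.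
  have mK := compact_measurable cK.
  apply: (measurable_bounded_integrable (mu := mu) mK (compact_finite_measure cK)).
    by apply: (measurable_funS measurableT) => //; exact: measurable_indic.
  exists 1; split => // M M1 x _ /=; rewrite ger0_norm ?indicE//.
  by rewrite (le_trans _ (ltW M1))//; case: (x \in K).
- move=> n x; rewrite /h'; case: ifPn => [un|_]; last first.
    by rewrite normr0 mulr_ge0// indicE.
  rewrite indicE; have [Kx|/negP] := boolP (x \in K).
    by rewrite mulr1; apply: hB; rewrite u0.
  by rewrite inE => nK; rewrite hK ?u0// normr0 mulr0.
- move=> x xs; have /cvg_at_rightP := hh0 x xs => /(_ u (conj u0 uc)).
  move=> H; apply: cvg_trans H; apply: near_eq_cvg.
  apply: filterS (cvgr_lt _ uc _ ltr01) => n un.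
  by rewrite /h' un.
Qed.

End ComplexIntegral.

(** * Piecewise smooth functions and their one-sided limits *)

Section PiecewiseSmooth.
Variable R : realType.
Local Notation mu := (@lebesgue_measure R).
Implicit Types (f g : R -> R[i]) (s : seq R) (p x a b e B : R) (K : set R).

Definition offs s : set R := [set x | x \notin s].

(** One-sided limits are asked for at every point; off [s] they follow from derivability. In this
    form [s] can be enlarged ([psmooth_sub]), so that all functions in the equation can share one
    list. *)
Definition psmooth s f := smooth_on (offs s) f /\ forall n x,
  (exists l, ccvg_to x^'- (cderivn n f) l) /\
  (exists l, ccvg_to x^'+ (cderivn n f) l).

Definition rlim f x : R[i] := rlimR (reF f) x +i* rlimR (imF f) x.
Definition llim f x : R[i] := llimR (reF f) x +i* llimR (imF f) x.

Lemma rlimE f x l : ccvg_to x^'+ f l -> rlim f x = l.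
Proof. by case: l => a b [/= fr fi]; rewrite /rlim (rlimRE fr) (rlimRE fi). Qed.

Lemma llimE f x l : ccvg_to x^'- f l -> llim f x = l.
Proof. by case: l => a b [/= fr fi]; rewrite /llim (llimRE fr) (llimRE fi). Qed.

Lemma psmooth_rlim s f x : psmooth s f -> ccvg_to x^'+ f (rlim f x).
Proof. by move=> [_ /(_ 0%N x)[_ [l fl]]]; rewrite (rlimE fl). Qed.

Lemma psmooth_llim s f x : psmooth s f -> ccvg_to x^'- f (llim f x).
Proof. by move=> [_ /(_ 0%N x)[[l fl] _]]; rewrite (llimE fl). Qed.

Lemma open_offs s : open (offs s).
Proof. exact: open_seqC. Qed.
Arguments open_offs : clear implicits.

Lemma near_offs s x : \forall y \near x, y != x -> y \notin s.
Proof.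
have : (offs [seq z <- s | z != x]) x by rewrite /offs/= mem_filter eqxx.
have := open_offs [seq z <- s | z != x]; rewrite openE => h /h.
by apply: filterS => y; rewrite /offs/= mem_filter negb_and negbK => /orP[->|].
Qed.

Lemma right_offs s x : x^'+ (offs s).
Proof.
have := near_offs s x; rewrite /at_right /within/=.
by apply: filterS => y ys xy; apply: ys; rewrite gt_eqF.
Qed.

Lemma left_offs s x : x^'- (offs s).
Proof.
have := near_offs s x; rewrite /at_left /within/=.
by apply: filterS => y ys xy; apply: ys; rewrite lt_eqF.
Qed.

Lemma smooth_on_psmooth s f : smooth_on (offs s) f ->
  (forall n x, x \in s -> (exists l, ccvg_to x^'- (cderivn n f) l) /\
     (exists l, ccvg_to x^'+ (cderivn n f) l)) -> psmooth s f.
Proof.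
move=> sf lf; split=> // n x; have [/lf//|xs] := boolP (x \in s).
have h := cderivable_cvg (sf n x xs).
by split; exists (cderivn n f x); apply: ccvg_sub h; exact: cvg_within.
Qed.

Lemma cpsmoothP f : cpsmooth f -> exists s, uniq s /\ psmooth s f.
Proof.
move=> [s [sf lf]]; exists (undup s); split; first exact: undup_uniq.
apply: smooth_on_psmooth => n x; rewrite /offs/= mem_undup; first exact: sf.
exact: lf.
Qed.

Lemma psmooth_sub s s' f : {subset s <= s'} -> psmooth s f -> psmooth s' f.
Proof.
move=> ss' [sf lf]; split=> // n x xs'; apply: sf.
by apply: contra xs'; exact: ss'.
Qed.

Lemma smooth_psmooth s f : smooth f -> psmooth s f.
Proof.
move=> sf; apply: (@psmooth_sub [::]); first by [].
by apply: smooth_on_psmooth; first exact: smooth_onT sf _.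
Qed.

Lemma psmooth_cderivn s k f : psmooth s f -> psmooth s (cderivn k f).
Proof.
move=> [sf lf]; split; first exact: smooth_on_cderivn.
by move=> n x; rewrite cderivn_add; exact: lf.
Qed.

Lemma psmooth_cderiv s f : psmooth s f -> psmooth s (cderiv f).
Proof. exact: (@psmooth_cderivn s 1). Qed.

Lemma psmoothD s f g : psmooth s f -> psmooth s g ->
  psmooth s (fun x => f x + g x).
Proof.
move=> [sf lf] [sg lg]; split; first exact: (smooth_onD (open_offs s) sf sg).
move=> n x; have [[lf1 lfP1] [lf2 lfP2]] := lf n x.
have [[lg1 lgP1] [lg2 lgP2]] := lg n x.
split; [exists (lf1 + lg1)|exists (lf2 + lg2)].
- apply: near_ccvg (ccvgD lfP1 lgP1).
  by apply: filterS (left_offs s x) => y ys; rewrite (cderivn_addf n (open_offs s)).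
- apply: near_ccvg (ccvgD lfP2 lgP2).
  by apply: filterS (right_offs s x) => y ys; rewrite (cderivn_addf n (open_offs s)).
Qed.

Lemma psmoothM s f g : psmooth s f -> psmooth s g ->
  psmooth s (fun x => f x * g x).
Proof.
move=> pf pg; have [sf _] := pf; have [sg _] := pg.
split; first exact: (smooth_onM (open_offs s) sf sg).
move=> n x; split.
- exists (\sum_(k < n.+1) ('C(n, k))%:R *
    (llim (cderivn k f) x * llim (cderivn (n - k) g) x)).
  apply: (@near_ccvg _ _ _ _ (fun y => \sum_(k < n.+1) ('C(n, k))%:R *
      (cderivn k f y * cderivn (n - k) g y))).
    apply: filterS (left_offs s x) => y ys; rewrite (leibniz n (open_offs s))//.
    by apply: eq_bigr => k _; rewrite mulr_natl.
  apply: ccvg_sum => k _; apply: ccvgZ; apply: ccvgM.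
    exact: (psmooth_llim (s := s) x (psmooth_cderivn k pf)).
  exact: (psmooth_llim (s := s) x (psmooth_cderivn (n - k) pg)).
- exists (\sum_(k < n.+1) ('C(n, k))%:R *
    (rlim (cderivn k f) x * rlim (cderivn (n - k) g) x)).
  apply: (@near_ccvg _ _ _ _ (fun y => \sum_(k < n.+1) ('C(n, k))%:R *
      (cderivn k f y * cderivn (n - k) g y))).
    apply: filterS (right_offs s x) => y ys; rewrite (leibniz n (open_offs s))//.
    by apply: eq_bigr => k _; rewrite mulr_natl.
  apply: ccvg_sum => k _; apply: ccvgZ; apply: ccvgM.
    exact: (psmooth_rlim (s := s) x (psmooth_cderivn k pf)).
  exact: (psmooth_rlim (s := s) x (psmooth_cderivn (n - k) pg)).
Qed.

Lemma psmooth_has_side_limits s f : psmooth s f ->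
  has_side_limits (reF f) /\ has_side_limits (imF f).
Proof.
move=> [_ lf]; split=> x; have [[l [lr li]] [r [rr ri]]] := lf 0%N x; split;
  by apply/cvg_ex; eexists; eassumption.
Qed.

Lemma smooth_on_continuous s f x : smooth_on (offs s) f -> x \notin s ->
  {for x, continuous (reF f)} /\ {for x, continuous (imF f)}.
Proof. by move=> sf xs; exact: (cderivable_cvg (sf 0%N x xs)). Qed.

Lemma psmooth_locint s f : psmooth s f -> clocally_integrable f.
Proof.
move=> pf; have [sf lf] := pf; split; apply: locally_integrable_bounded.
- apply: (@measurable_off_seq _ s) => x xs; by have [] := smooth_on_continuous sf xs.
- move=> x; have [[l [lr li]] [r [rr ri]]] := lf 0%N x.
  exact: near_bounded_limits lr rr.
- apply: (@measurable_off_seq _ s) => x xs; by have [] := smooth_on_continuous sf xs.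
- move=> x; have [[l [lr li]] [r [rr ri]]] := lf 0%N x.
  exact: near_bounded_limits li ri.
Qed.

Lemma psmooth_measurable s f : psmooth s f -> cmeasurable f.
Proof. by move=> /psmooth_locint; exact: clocally_integrable_measurable. Qed.

Lemma psmooth_bounded s f K : psmooth s f -> compact K ->
  exists2 B, 0 <= B & forall x, K x -> `|f x| <= B%:C.
Proof.
move=> [_ lf] cK.
have [M1 KM1] : exists M, forall x, K x -> `|reF f x| <= M.
  apply: bounded_compact => // x _; have [[l [lr li]] [r [rr ri]]] := lf 0%N x.
  exact: near_bounded_limits lr rr.
have [M2 KM2] : exists M, forall x, K x -> `|imF f x| <= M.
  apply: bounded_compact => // x _; have [[l [lr li]] [r [rr ri]]] := lf 0%N x.
  exact: near_bounded_limits li ri.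
exists (`|M1| + `|M2|); first exact: addr_ge0.
move=> x Kx; apply: le_trans (normc_le_ReIm _) _; rewrite lecR lerD//.
- exact: le_trans (KM1 x Kx) (ler_norm _).
- exact: le_trans (KM2 x Kx) (ler_norm _).
Qed.

Lemma cFTC s f K : uniq s -> psmooth s f -> compact K ->
  (forall x, ~ K x -> f x = 0) ->
  cintegral (cderiv f) = - \sum_(p <- s) (rlim f p - llim f p).
Proof.
move=> us pf cK f0; have [sf lf] := pf.
have pf' := psmooth_cderiv pf; have [sf' _] := pf'.
have [lr li] := psmooth_has_side_limits pf.
have [lr' li'] := psmooth_has_side_limits pf'.
have [ir' ii'] := psmooth_locint pf'.
apply: eq_complex_val; rewrite raddfN raddf_sum /cintegral /=.
- rewrite [LHS](@FTC_compact_supp R (reF f) s K us cK _ _ lr lr' ir').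
  + by congr (- _); apply: eq_bigr => p _; rewrite raddfB.
  + by move=> x /f0; rewrite /reF => ->.
  + move=> x xs; split; first by case: (sf 0%N x xs).
    by have [] := smooth_on_continuous sf' xs.
- rewrite [LHS](@FTC_compact_supp R (imF f) s K us cK _ _ li li' ii').
  + by congr (- _); apply: eq_bigr => p _; rewrite raddfB.
  + by move=> x /f0; rewrite /imF => ->.
  + move=> x xs; split; first by case: (sf 0%N x xs).
    by have [] := smooth_on_continuous sf' xs.
Qed.

End PiecewiseSmooth.

Arguments open_offs {R} s.

(** * Distributions with point singularities *)

Section RegularDistributions.
Variable R : realType.
Implicit Types (f g : R -> R[i]) (s : seq R) (p x a b e B : R) (K : set R).
Implicit Types (t : testfun R) (F G : functional R).

Lemma functionalD F G t : (F + G) t = F t + G t. Proof. by []. Qed.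
Lemma functionalZ (a : R[i]) F t : (a *: F) t = a * F t. Proof. by []. Qed.

Lemma test0 t x : ~ supp t x -> t x = 0.
Proof. by move=> /supp_notin/nbhs_singleton. Qed.

Lemma test_smooth t : smooth t. Proof. by case: (testfunP t). Qed.

Lemma test_compact t : compact (supp t). Proof. by case: (testfunP t). Qed.
Arguments test_smooth : clear implicits.
Arguments test_compact : clear implicits.

Lemma test_bounded t : exists2 B, 0 <= B & forall x, `|t x| <= B%:C.
Proof.
have [B B0 tB] := psmooth_bounded (smooth_psmooth [::] (test_smooth t)) (test_compact t).
exists B => // x; have [|nx] := pselect (supp t x); first exact: tB.
by rewrite test0// normr0 lecR.
Qed.

Lemma test_measurable t : cmeasurable t.
Proof. exact: psmooth_measurable (smooth_psmooth [::] (test_smooth t)). Qed.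

Lemma cintegrable_test f t : clocally_integrable f ->
  cintegrable (fun x => f x * t x).
Proof.
move=> lf; have [B _ tB] := test_bounded t.
by have [] := cintegrable_locM lf (test_measurable t) (test_compact t) (@test0 t) tB.
Qed.

Lemma regdistD f g : clocally_integrable f -> clocally_integrable g ->
  regdist (fun x => f x + g x) = regdist f + regdist g.
Proof.
move=> lf lg; apply/funext => t; rewrite functionalD /regdist.
rewrite -(cintegralD (cintegrable_test t lf) (cintegrable_test t lg)).
by congr cintegral; apply/funext => x; rewrite mulrDl.
Qed.

Lemma regdistZ (a : R[i]) f : clocally_integrable f ->
  regdist (fun x => a * f x) = a *: regdist f.
Proof.
move=> lf; apply/funext => t; rewrite functionalZ /regdist.
rewrite -(cintegralZ a (cintegrable_test t lf)).
by congr cintegral; apply/funext => x; rewrite mulrA.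
Qed.

Lemma regdist_ae s f g : cmeasurable f -> cmeasurable g ->
  (forall x, x \notin s -> f x = g x) -> regdist f = regdist g.
Proof.
move=> mf mg fg; apply/funext => t; apply: (cintegral_ae (s := s)).
- exact: cmeasurableM mf (test_measurable t).
- exact: cmeasurableM mg (test_measurable t).
- by move=> x xs; rewrite fg.
Qed.

Lemma regdist_linear f : clocally_integrable f -> linear (regdist f).
Proof.
move=> lf a t t'; transitivity (a * regdist f t + regdist f t'); last by [].
rewrite /regdist -(cintegralZ a (cintegrable_test t lf)).
rewrite -(cintegralD _ (cintegrable_test t' lf)); last first.
  exact/cintegrableZ/cintegrable_test.
by congr cintegral; apply/funext => x; rewrite /= !fctE /GRing.scale/= mulrDr mulrCA.
Qed.

Lemma regdist_distribution f : clocally_integrable f -> is_distribution (regdist f).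
Proof.
move=> lf; split; first exact: regdist_linear.
move=> K cK; eexists; exists 0%N => t B tK tB.
have tB' x : `|t x| <= B%:C by exact: (tB 0%N).
have t0 x : ~ K x -> t x = 0 by move=> nK; apply: test0 => /tK.
by have [_] := cintegrable_locM lf (test_measurable t) cK t0 tB'; apply.
Qed.

(** The classical jump formula. The integral of (f t)' is minus the sum of the jumps of f t, and by
    continuity of the test function t the jump of f t at p is t(p) times the jump of f. *)
Lemma dderiv_regdist s f : uniq s -> psmooth s f ->
  dderiv (regdist f) =
  regdist (cderiv f) + \sum_(p <- s) (rlim f p - llim f p) *: delta p.
Proof.
move=> us pf; apply/funext => t; have [sf _] := pf.
have pt := smooth_psmooth s (test_smooth t); have [stt _] := pt.
have pu := psmoothM pf pt.
have u0 x : ~ supp t x -> f x * t x = 0 by move=> /test0 ->; rewrite mulr0.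
have := cFTC us pu (test_compact t) u0.
have lf := psmooth_locint pf; have lf' := psmooth_locint (psmooth_cderiv pf).
(* The product rule is available off [s] only, which is enough under the integral. *)
rewrite (@cintegral_ae _ s _ (fun x => cderiv f x * t x + f x * test_deriv t x)).
- rewrite (cintegralD (cintegrable_test t lf') (cintegrable_test (test_deriv t) lf)).
  move=> h; rewrite functionalD fct_sumE.
  rewrite (eq_bigr (fun p => rlim (fun x => f x * t x) p -
      llim (fun x => f x * t x) p)).
    rewrite -[X in _ = _ + X]opprK -h /dderiv /regdist/=.
    by rewrite opprD addNKr.
  move=> p _; have tp := cderivable_cvg (test_smooth t 0%N p).
  rewrite (rlimE (ccvgM (psmooth_rlim p pf) (ccvg_sub _ tp))); last exact: cvg_within.
  rewrite (llimE (ccvgM (psmooth_llim p pf) (ccvg_sub _ tp))); last exact: cvg_within.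
  by rewrite functionalZ /delta -mulrBl.
- exact/psmooth_measurable/psmooth_cderiv/pu.
- have pt' := smooth_psmooth s (test_smooth (test_deriv t)).
  exact: psmooth_measurable
    (psmoothD (psmoothM (psmooth_cderiv pf) pt) (psmoothM pf pt')).
- move=> x xs; apply: cderivM_at; [exact: (sf 0%N)|exact: (stt 0%N)].
Qed.

End RegularDistributions.

Arguments test_smooth {R} t.
Arguments test_compact {R} t.

(** * Finite sums of derivatives of delta, encoded as polynomials *)

Section DeltaPolynomials.
Variable R : realType.
Local Notation C := R[i].
Implicit Types (f g : R -> C) (s : seq R) (p q x e : R) (c d : {poly C}).
Implicit Types (t : testfun R) (F G P : functional R) (u : nat -> C).

(* The polynomial c encodes \sum_j c`_j delta_p^(j), so that differentiation  *)
(* is multiplication by 'X and size bounds the order.                         *)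
Definition dpoly p c : functional R :=
  fun t => \sum_(j < size c) c`_j * ((- 1) ^+ j * cderivn j t p).

Lemma dpolyE n p c t : (size c <= n)%N ->
  dpoly p c t = \sum_(j < n) c`_j * ((- 1) ^+ j * cderivn j t p).
Proof.
move=> cn; rewrite /dpoly (big_ord_widen n (fun j => c`_j * ((- 1) ^+ j * cderivn j t p)))//.
rewrite big_mkcond/=; apply: eq_bigr => j _; case: ifPn => //.
by rewrite -leqNgt => /leq_sizeP ->; rewrite ?mul0r.
Qed.

Lemma dpolyD p c d : dpoly p (c + d) = dpoly p c + dpoly p d.
Proof.
apply/funext => t; rewrite functionalD.
pose n := maxn (size c) (size d).
rewrite (@dpolyE n _ (c + d)) ?(leq_trans (size_polyD _ _))//.
rewrite (@dpolyE n _ c) ?leq_maxl// (@dpolyE n _ d) ?leq_maxr// -big_split/=.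
by apply: eq_bigr => j _; rewrite coefD mulrDl.
Qed.

Lemma dpolyZ p (a : C) c : dpoly p (a *: c) = a *: dpoly p c.
Proof.
apply/funext => t; rewrite functionalZ (@dpolyE (size c)) ?size_scale_leq//.
rewrite /dpoly mulr_sumr.
by apply: eq_bigr => j _; rewrite coefZ -mulrA.
Qed.

Lemma dpoly0 p : dpoly p 0 = 0.
Proof. by rewrite -(scale0r (0 : {poly C})) dpolyZ scale0r. Qed.

Lemma dpolyMn p c n t : dpoly p (c *+ n) t = n%:R * dpoly p c t.
Proof.
elim: n => [|n IH]; first by rewrite mulr0n mul0r dpoly0.
by rewrite mulrS dpolyD functionalD IH -natr1 mulrDl mul1r addrC.
Qed.

Lemma dpoly_sum p n (c : 'I_n -> {poly C}) :
  dpoly p (\sum_(i < n) c i) = \sum_(i < n) dpoly p (c i).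
Proof.
apply: (big_ind2 (fun c F => dpoly p c = F)) => //; first exact: dpoly0.
by move=> c1 F1 c2 F2 <- <-; rewrite dpolyD.
Qed.

Lemma dderivn_delta j p t : dderivn j (delta p) t = (- 1) ^+ j * cderivn j t p.
Proof.
elim: j t => [|j IH] t; first by rewrite expr0 mul1r.
rewrite /dderivn iterS -/(dderivn _ _) /dderiv IH exprS mulN1r mulNr.
by rewrite /= cderivn_cderiv.
Qed.

Lemma dpolyXn p j : dpoly p 'X^j = dderivn j (delta p).
Proof.
apply/funext => t; rewrite dderivn_delta /dpoly size_polyXn big_ord_recr/=.
rewrite coefXn eqxx mul1r big1 ?add0r// => i _.
by rewrite coefXn ltn_eqF ?mul0r.
Qed.

Lemma dpolyC p (a : C) : dpoly p a%:P = a *: delta p.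
Proof. by rewrite -[a%:P]mulr1 mul_polyC dpolyZ -(expr0 'X) dpolyXn. Qed.

Lemma dderivD F G : dderiv (F + G) = dderiv F + dderiv G.
Proof. by apply/funext => t; rewrite /dderiv !functionalD opprD. Qed.

Lemma dderiv0 : dderiv (0 : functional R) = 0.
Proof. by apply/funext => t; rewrite /dderiv oppr0. Qed.

Lemma dderiv_sum (I : Type) (r : seq I) (F : I -> functional R) :
  dderiv (\sum_(i <- r) F i) = \sum_(i <- r) dderiv (F i).
Proof.
apply: (big_ind2 (fun F G => dderiv F = G)) => //; first exact: dderiv0.
by move=> F1 G1 F2 G2 <- <-; rewrite dderivD.
Qed.

Lemma dderiv_dpoly p c : dderiv (dpoly p c) = dpoly p (c * 'X).
Proof.
apply/funext => t; rewrite /dderiv (@dpolyE (size c).+1 _ (c * 'X)); last first.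
  by rewrite (leq_trans (size_polyMleq _ _))// size_polyX addn2.
rewrite big_ord_recl coefMX/= mul0r add0r -sumrN; apply: eq_bigr => j _.
by rewrite coefMX/= exprS mulN1r mulNr mulrN cderivn_cderiv.
Qed.

(** Normal form of an element of the algebra. The list is taken duplicate-free whenever coefficients
    are read off, since a repeated point would count its polynomial twice. *)
Definition rep s f (c : R -> {poly C}) : functional R :=
  regdist f + \sum_(p <- s) dpoly p (c p).

Definition jump f p : C := rlim f p - llim f p.

Lemma dderiv_rep s f (c : R -> {poly C}) : uniq s -> psmooth s f -> dderiv (rep s f c) =
  rep s (cderiv f) (fun p => c p * 'X + (jump f p)%:P).
Proof.
move=> us pf; rewrite /rep dderivD dderiv_sum (dderiv_regdist us pf) -addrA.
congr (_ + _); rewrite -big_split/=; apply: eq_bigr => p _.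
by rewrite dpolyD dpolyC dderiv_dpoly addrC.
Qed.

Lemma rep_regdist s f : regdist f = rep s f (fun=> 0).
Proof. by rewrite /rep big1 ?addr0// => p _; exact: dpoly0. Qed.

Lemma repD s f g (c d : R -> {poly C}) : clocally_integrable f -> clocally_integrable g ->
  rep s f c + rep s g d = rep s (fun x => f x + g x) (fun p => c p + d p).
Proof.
move=> lf lg; rewrite /rep (regdistD lf lg) addrACA; congr (_ + _).
by rewrite -big_split/=; apply: eq_bigr => p _; rewrite dpolyD.
Qed.

Lemma repZ s (a : C) f (c : R -> {poly C}) : clocally_integrable f ->
  a *: rep s f c = rep s (fun x => a * f x) (fun p => a *: c p).
Proof.
move=> lf; rewrite /rep (regdistZ a lf) scalerDr scaler_sumr; congr (_ + _).
by apply: eq_bigr => p _; rewrite dpolyZ.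
Qed.

Lemma eq_rep s f (c d : R -> {poly C}) : {in s, c =1 d} -> rep s f c = rep s f d.
Proof.
by move=> cd; rewrite /rep; congr (_ + _); apply: eq_big_seq => p /cd ->.
Qed.

(* Leibniz' rule for h . \sum_j c`_j delta_p^(j), where u i is the i-th        *)
(* derivative of h at p.                                                      *)
Definition pmul u c : {poly C} := \sum_(i < size c) ((- 1) ^+ i * u i) *: c^`N(i).

Lemma size_nderivn_le n c : (size c^`N(n) <= size c - n)%N.
Proof.
apply/leq_sizeP => j cj; rewrite coef_nderivn.
by rewrite (leq_sizeP _ _ (leqnn _)) ?mul0rn// -leq_subLR.
Qed.

Lemma pmulE n u c : (size c <= n)%N ->
  pmul u c = \sum_(i < n) ((- 1) ^+ i * u i) *: c^`N(i).
Proof.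
move=> cn; rewrite /pmul (big_ord_widen n (fun i => ((- 1) ^+ i * u i) *: c^`N(i)))//.
rewrite big_mkcond/=; apply: eq_bigr => i _; case: ifPn => //.
rewrite -leqNgt => ci; suff -> : c^`N(i) = 0 by rewrite scaler0.
by apply/eqP; rewrite -size_poly_eq0 -leqn0 (leq_trans (size_nderivn_le _ _))// leqn0 subn_eq0.
Qed.

Lemma pmulD u c d : pmul u (c + d) = pmul u c + pmul u d.
Proof.
pose n := maxn (size c) (size d).
rewrite (@pmulE n _ (c + d)) ?(leq_trans (size_polyD _ _))//.
rewrite (@pmulE n _ c) ?leq_maxl// (@pmulE n _ d) ?leq_maxr// -big_split/=.
by apply: eq_bigr => i _; rewrite raddfD/= scalerDr.
Qed.

Lemma pmulZ u (a : C) c : pmul u (a *: c) = a *: pmul u c.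
Proof.
rewrite (@pmulE (size c)) ?size_scale_leq// /pmul scaler_sumr.
by apply: eq_bigr => i _; rewrite linearZ/= !scalerA mulrC.
Qed.

Lemma pmul_sum u n (c : 'I_n -> {poly C}) :
  pmul u (\sum_(i < n) c i) = \sum_(i < n) pmul u (c i).
Proof.
apply: (big_ind2 (fun c d => pmul u c = d)) => //.
  by rewrite /pmul size_poly0 big_ord0.
by move=> c1 F1 c2 F2 <- <-; rewrite pmulD.
Qed.

Lemma size_pmul u c : (size (pmul u c) <= size c)%N.
Proof.
apply: (leq_trans (size_sum _ _ _)); apply/bigmax_leqP => i _.
rewrite (leq_trans (size_scale_leq _ _))// (leq_trans (size_nderivn_le _ _))//.
exact: leq_subr.
Qed.

(** Hasse derivatives of positive order lower the degree, so only the undifferentiated term,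
    weighted by the value [u 0] of the smooth factor, reaches degree [n]. *)
Lemma coef_pmul_top u c n : (size c <= n.+1)%N -> (pmul u c)`_n = u 0%N * c`_n.
Proof.
move=> cn; rewrite (pmulE u cn) big_ord_recl expr0 mul1r nderivn0 coefD coefZ.
rewrite coef_sum big1 ?addr0// => i _; rewrite coefZ coef_nderivn.
by rewrite (leq_sizeP _ _ cn) ?mul0rn ?mulr0// lift0 addSn ltnS leq_addl.
Qed.

(** By linearity it suffices to treat monomials, where Leibniz' rule for the test function applies:
    the sign splits as (-1)^j = (-1)^i (-1)^(j-i), and the binomials are those of the Hasse
    derivatives of X^j. *)
Lemma dpoly_smooth_mul (h : smoothfun R) q c :
  smooth_mul h (dpoly q c) = dpoly q (pmul (fun i => cderivn i h q) c).
Proof.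
set u := fun i => cderivn i h q.
have XE j t : dpoly q 'X^j (test_mul h t) = dpoly q (pmul u 'X^j) t.
  rewrite dpolyXn dderivn_delta.
  rewrite (leibniz j (@openT R) (@smooth_onT _ _ (@smoothfunP _ h) setT)
    (@smooth_onT _ _ (test_smooth t) setT))//.
  rewrite (@pmulE j.+1) ?size_polyXn// dpoly_sum fct_sumE mulr_sumr.
  apply: eq_bigr => i _.
  transitivity (((- 1) ^+ i * u i) * dpoly q ('X^j)^`N(i) t); last first.
    by rewrite -functionalZ -dpolyZ.
  rewrite nderivnXn dpolyMn dpolyXn dderivn_delta.
  have -> : (- 1 : C) ^+ j = (- 1) ^+ i * (- 1) ^+ (j - i).
    by rewrite -exprD subnKC// -ltnS.
  rewrite -mulr_natl /u; ring.
apply/funext => t; rewrite /smooth_mul -(coefK c) poly_def.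
rewrite pmul_sum !dpoly_sum !fct_sumE; apply: eq_bigr => j _.
by rewrite pmulZ !dpolyZ !functionalZ XE.
Qed.

End DeltaPolynomials.

(** * Uniqueness and computation of the star product *)

Section Locality.
Variable R : realType.
Local Notation C := R[i].
Local Notation mu := (@lebesgue_measure R).
Implicit Types (f g : R -> C) (s : seq R) (p q x y e : R) (U K : set R).
Implicit Types (t : testfun R) (F G P Q : functional R) (h : smoothfun R).

Lemma open_ball_radius U x : open U -> U x ->
  exists2 d, 0 < d & forall y, `|y - x| < d -> U y.
Proof.
rewrite openE => /(_ x) /[apply]; rewrite /interior => -[d /= d0 dU].
by exists d => // y yx; apply: dU; rewrite /= distrC.
Qed.

Lemma exists_cutoff U x : open U -> U x ->
  exists (u : R -> R) (d : R), [/\ 0 < d, smooth (fun y => (u y)%:C),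
    forall y, 0 <= u y, forall y, `|y - x| < d -> u y = 1 &
    exists2 K, closed K /\ K `<=` U & forall y, ~ K y -> u y = 0].
Proof.
move=> oU Ux; have [d d0 dU] := open_ball_radius oU Ux.
have d2 : 0 < d / 2 by rewrite divr_gt0.
have [u [su u0 u1 uE]] := exists_bump x d2.
exists u, (d / 2 / 2); split => //; first by rewrite divr_gt0.
  by move=> y /ltW; exact: u1.
exists [set y | `|y - x| <= d / 2]; last first.
  by move=> y /= /negP; rewrite -ltNge => /ltW; exact: uE.
split; last by move=> y /= yd; apply: dU; rewrite (le_lt_trans yd)// ltr_pdivrMr// ltr_pMr// ltr1n.
rewrite (_ : [set y | _] = (fun y => `|y - x|) @^-1` [set z | z <= d / 2])//.
apply: preimage_closed; last exact: closed_le.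
by move=> y _; apply: cvg_norm; apply: cvgB; [exact: cvg_id|exact: cvg_cst].
Qed.

Lemma supp_mul_sub f t (A : set R) : supp t `<=` A -> supp (fun x => f x * t x) `<=` A.
Proof.
move=> tA; apply: subset_trans tA; apply: closureS => x /=.
by apply: contra => /eqP ->; rewrite mulr0.
Qed.

(** A cutoff supported off [s] turns [f] into a globally smooth function, as the Hörmander product
    requires, without changing it near [x]. *)
Lemma localization_smooth s f x : smooth_on (offs s) f -> x \notin s ->
  exists U h, [/\ open U, U x, U `<=` offs s & forall y, U y -> h y = f y].
Proof.
move=> sf xs; have [u [d [d0 su _ u1 [K [cK Ks] uK]]]] := @exists_cutoff (offs s) x (open_offs s) xs.
have sh : smooth (fun y => (u y)%:C * f y).
  move=> n y; have [ys|ys] := boolP (y \in s); last first.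
    exact: (smooth_onM (open_offs s) (@smooth_onT _ _ su (offs s)) sf n ys).
  have oK : open (~` K) by exact: closed_openC.
  apply: (@eq_smooth_on _ (~` K) (fun=> 0)) => //.
  - by move=> z /uK ->; rewrite mul0r.
  - exact: (@smooth_onT _ _ (smooth_cst 0) (~` K)).
  - by move=> /Ks; rewrite /offs/= ys.
exists (ball x d `&` offs s), (SmoothFun sh); split.
- by apply: openI; [exact: ball_open|exact: open_offs].
- by split => //; exact: ballxx.
- by move=> y [].
- by move=> y [] /=; rewrite /ball/= distrC => /u1 -> _; rewrite mul1r.
Qed.

(** Fundamental lemma of the calculus of variations. If the real part were positive at [x], it would
    be at least half its value [c] on an interval of radius [r]; testing against a nonnegative bump
    equal to 1 there gives an integral of at least 2 r c > 0. *)
Lemma smooth_vanish_Re f U x : smooth f -> open U ->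
  (forall t, supp t `<=` U -> regdist f t = 0) -> U x -> complex.Re (f x) <= 0.
Proof.
move=> sf oU f0 Ux; rewrite leNgt; apply/negP => fx.
have cf y : {for y, continuous (reF f)} by have [] := cderivable_cvg (sf 0%N y).
have [d1 d10 fd] : exists2 d, 0 < d & forall y, `|y - x| < d -> U y /\ 0 < reF f y.
  have [d1 d10 dU] := open_ball_radius oU Ux.
  have /cvgr_gt/(_ _ fx) : reF f y @[y --> x] --> reF f x by exact: cf.
  move=> [d2 /= d20 df]; exists (Num.min d1 d2); first by rewrite lt_min d10.
  move=> y; rewrite lt_min => /andP[y1 y2]; split; first exact: dU.
  by apply: df; rewrite /= distrC.
have oV : open (ball x d1) by exact: ball_open.
have [u [d [d0 su u0 u1 [K [cK KV] uK]]]] := exists_cutoff oV (ballxx x d10).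
have Kd y : K y -> `|y - x| < d1 by move=> /KV; rewrite /ball/= distrC.
have cpt : compact K.
  apply: (subclosed_compact cK (@segment_compact _ (x - d1) (x + d1))).
  by move=> y /Kd; rewrite ltr_distl /= in_itv/= => /andP[/ltW -> /ltW ->].
have ut : (fun y => (u y)%:C) \in @istest R.
  by apply/istestP; split => //; apply: compact_suppW cpt _ => y /uK ->.
pose t := TestFun ut.
have tU : supp t `<=` U.
  apply: (@subset_trans _ K); last by move=> y /Kd/fd[].
  by apply: supp_sub => // y /uK /= ->.
have [iw _] := cintegrable_test t (psmooth_locint (smooth_psmooth [::] sf)).
have := f0 t tU; rewrite /regdist/cintegral => -[I0 _]; move: iw I0.
set w := reF _.
have wE y : w y = reF f y * u y.
  by rewrite /w reFM !fctE imF_real /= mulr0 subr0.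
have w0 y : 0 <= w y.
  rewrite wE; have [/Kd/fd[_ fy]|nK] := pselect (K y); first by rewrite mulr_ge0// ltW.
  by rewrite uK// mulr0.
move=> iw I0; pose c := reF f x / 2; have c0 : 0 < c by rewrite divr_gt0.
have [r [r0 rd rc]] : exists r, [/\ 0 < r, r < d & forall y, `|y - x| <= r -> c <= reF f y].
  have cfx : c < reF f x by rewrite /c ltr_pdivrMr// ltr_pMr// ltr1n.
  have /cvgr_gt/(_ _ cfx) : reF f y @[y --> x] --> reF f x by exact: cf.
  move=> [d2 /= d20 df]; exists (Num.min d d2 / 2).
  have m0 : 0 < Num.min d d2 by rewrite lt_min d0.
  have mh : Num.min d d2 / 2 < Num.min d d2 by rewrite ltr_pdivrMr// ltr_pMr// ltr1n.
  split; first by rewrite divr_gt0.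
    by rewrite (lt_le_trans mh)// ge_min lexx.
  move=> y yr; apply/ltW/df; rewrite /= distrC (le_lt_trans yr)// (lt_le_trans mh)//.
  by rewrite ge_min lexx orbT.
pose A := `[x - r, x + r]%classic.
have iA : mu.-integrable setT (EFin \o (fun y => c * \1_A y)).
  by apply: integrable_realZ; exact: integrable_indic_itv.
have : \int[mu]_y (c * \1_A y) <= \int[mu]_y w y.
  apply: le_Rintegral => // y _; rewrite indicE.
  have [|_] := boolP (y \in A); last by rewrite mulr0.
  rewrite inE /A/= in_itv/= -ler_distl => yr; rewrite mulr1 wE.
  by rewrite u1 ?mulr1 ?rc// (le_lt_trans yr).
have xr : x - r < x + r by rewrite ltrD2l gtrN.
have := lebesgue_measure_itv `[x - r, x + r]; rewrite /= lte_fin xr -EFinB => mA.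
have IA : \int[mu]_y \1_A y = (x + r) - (x - r).
  rewrite /Rintegral integral_indic; [|by []|exact: measurable_itv].
  rewrite (_ : A `&` _ = A); first exact: (congr1 fine mA).
  by apply/seteqP; split => [y []|y Ay].
rewrite I0 (RintegralZl c measurableT (integrable_indic_itv (x - r) (x + r) true false)).
by rewrite IA leNgt mulr_gt0// subr_gt0.
Qed.

(** The previous lemma applied to a f gives Re(a f(x)) <= 0 for every complex a; the choices 1, -1,
    i and -i force f(x) = 0. *)
Lemma smooth_vanish f U x : smooth f -> open U ->
  (forall t, supp t `<=` U -> regdist f t = 0) -> U x -> f x = 0.
Proof.
move=> sf oU f0 Ux; have lf := psmooth_locint (smooth_psmooth [::] sf).
have key (a : C) : complex.Re (a * f x) <= 0.
  apply: (@smooth_vanish_Re (fun y => a * f y) U x _ oU) => //.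
    exact: (smoothM (smooth_cst a) sf).
  by move=> t tU; rewrite regdistZ// functionalZ f0// mulr0.
have keyE p q : p * complex.Re (f x) - q * complex.Im (f x) <= 0.
  by have := key (p +i* q); case: (f x).
have h1 := keyE 1 0; have h2 := keyE (- 1) 0.
have h3 := keyE 0 1; have h4 := keyE 0 (- 1).
by apply: eq_complex_val => /=; lra.
Qed.

End Locality.

(** * Gluing of local equalities and uniqueness of the products *)

Section Gluing.
Variable R : realType.
Local Notation C := R[i].
Implicit Types (f g : R -> C) (s : seq R) (p q x y e : R) (U K : set R).
Implicit Types (t : testfun R) (F G P Q : functional R) (h : smoothfun R).

Lemma eq_test t t' : (forall x, t x = t' x) -> t = t'.
Proof. by move=> tt'; apply/val_inj/funext. Qed.

Lemma linear_test0 F : linear F -> F 0 = 0.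
Proof.
move=> lF; have := lF 1 0 0; rewrite scaler0 addr0 scale1r.
by move/eqP; rewrite -subr_eq subrr eq_sym => /eqP.
Qed.

Lemma linear_testD F t t' : linear F -> F (t + t') = F t + F t'.
Proof. by move=> lF; have := lF 1 t t'; rewrite !scale1r. Qed.

(* With bumps chi_1, ..., chi_n equal to 1 on a cover of the support of t,    *)
(* t \prod_i (1 - chi_i) = 0, and expanding this product one factor at a time *)
(* writes t as a sum of test functions with small supports.                   *)
Lemma gluing F G : linear F -> linear G ->
  (forall x, exists U, [/\ open U, U x & eq_on U F G]) -> F = G.
Proof.
move=> lF lG FG.
have /choice[D HD] : forall x, exists ud : (R -> R) * R, [/\ 0 < ud.2,
    smooth (fun y => (ud.1 y)%:C), forall y, `|y - x| < ud.2 -> ud.1 y = 1 &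
    forall t t', (forall y, t y = (ud.1 y)%:C * t' y) -> F t = G t].
  move=> x; have [U [oU Ux FGU]] := FG x.
  have [u [d [d0 su _ u1 [K [cK KU] uK]]]] := exists_cutoff oU Ux.
  exists (u, d); split => // t t' tE; apply: FGU; apply: subset_trans KU.
  by apply: supp_sub => // y /uK uy; rewrite tE /= uy mul0r.
pose chi x y : C := ((D x).1 y)%:C.
have ind (l : seq R) t : (forall y, t y * \prod_(x <- l) (1 - chi x y) = 0) -> F t = G t.
  elim: l t => [|x l IH] t tl.
    have -> : t = 0 by apply: eq_test => y; have := tl y; rewrite big_nil mulr1.
    by rewrite !linear_test0.
  have [_ su _ FGx] := HD x.
  have sv : smooth (fun y => 1 - chi x y).
    have := smoothD (smooth_cst 1) (smoothM (smooth_cst (-1)) su).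
    by congr smooth; apply/funext => y; rewrite mulN1r.
  have -> : t = test_mul (SmoothFun su) t + test_mul (SmoothFun sv) t.
    by apply: eq_test => y /=; rewrite !fctE /= -mulrDl addrC subrK mul1r.
  rewrite !linear_testD// (FGx _ t)// (IH (test_mul _ t))// => y.
  by rewrite -[RHS](tl y) big_cons /= mulrCA mulrA.
apply/funext => t.
have := test_compact t; rewrite compact_cover => cc.
have [||l _ tl] := cc R setT (fun x => ball x (D x).2).
- by move=> x _; have [d0 _ _ _] := HD x; exact: ball_open.
- by move=> y _; exists y => //; have [d0 _ _ _] := HD y; exact: ballxx.
apply: (ind (finmap.enum_fset l) t) => y; have [ty|nt] := pselect (supp t y); last first.
  by rewrite test0// mul0r.
have [x /= xl] := tl y ty; rewrite /ball/= distrC => yx.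
have [_ _ u1 _] := HD x.
by rewrite (big_rem x)//= /chi u1// subrr mul0r mulr0.
Qed.

Lemma supp_test_mul U h t : supp t `<=` U -> supp (test_mul h t) `<=` U.
Proof. exact: supp_mul_sub. Qed.

Lemma eq_on_smooth U h h' : open U ->
  (forall t, supp t `<=` U -> regdist h t = regdist h' t) ->
  forall x, U x -> h x = h' x.
Proof.
move=> oU hh' x Ux; have [sh sh'] := (@smoothfunP _ h, @smoothfunP _ h').
have sN := smoothM (smooth_cst (-1 : C)) sh'.
have lh := psmooth_locint (smooth_psmooth [::] sh).
have lh' := psmooth_locint (smooth_psmooth [::] sh').
have lN := psmooth_locint (smooth_psmooth [::] sN).
have : h x + -1 * h' x = 0.
  apply: (smooth_vanish (smoothD sh sN) oU) => // t tU.
  by rewrite regdistD// regdistZ// functionalD functionalZ hh'// mulN1r subrr.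
by rewrite mulN1r => /eqP; rewrite subr_eq0 => /eqP.
Qed.

(** Gluing makes the question local, and four cases arise from the choice of the smooth factor in
    each product. If it is the same factor, the smooth functions agree on the overlap
    ([eq_on_smooth]); otherwise both factors are smooth there and both products are the regular
    distribution of h h'. *)
Lemma hormander_unique F G P P' : is_hormander_prod F G P ->
  is_hormander_prod F G P' -> P = P'.
Proof.
move=> [[lP _] hP] [[lP' _] hP']; apply: gluing => // x.
have [U [h [oU Ux PU]]] := hP x; have [U' [h' [oU' Ux' PU']]] := hP' x.
exists (U `&` U'); split; [exact: openI|by []|move=> t tUU'].
have tU : supp t `<=` U by move=> y /tUU'[].
have tU' : supp t `<=` U' by move=> y /tUU'[].
have same (H : functional R) : eq_on U H (regdist h) -> eq_on U' H (regdist h') ->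
    test_mul h t = test_mul h' t.
  move=> Hh Hh'; apply: eq_test => y /=.
  have [/tUU' ty|nt] := pselect (supp t y); last by rewrite test0// !mulr0.
  rewrite (@eq_on_smooth (U `&` U') h h' (openI oU oU'))// => t' t'U.
  by rewrite -Hh ?Hh'// => z /t'U[].
have mixed (H H' : functional R) : eq_on U H (regdist h) -> eq_on U' H' (regdist h') ->
    H' (test_mul h t) = H (test_mul h' t).
  move=> Hh Hh'; rewrite Hh' ?Hh; [|exact: supp_test_mul..].
  by rewrite /regdist; congr cintegral; apply/funext => y /=; rewrite mulrCA.
case: PU => -[Fh Ph]; case: PU' => -[Fh' Ph']; rewrite Ph// Ph'// /smooth_mul.
- by rewrite (same F).
- exact: (mixed F G).
- exact: (mixed G F).
- by rewrite (same G).
Qed.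

Lemma star_unique F G P P' : is_star F G P -> is_star F G P' -> P = P'.
Proof.
move=> [_ [Q [hQ QP]]] [_ [Q' [hQ' QP']]]; apply/funext => t.
apply: ccvg_unique (QP' t); apply: near_ccvg (QP t).
by apply: filterS2 hQ hQ' => e hQ hQ'; rewrite (hormander_unique hQ hQ').
Qed.

Lemma starE F G P : is_star F G P -> star F G = P.
Proof.
by move=> FGP; apply: xget_unique => // P' FGP'; exact: star_unique FGP' FGP.
Qed.

End Gluing.

(** * The Hörmander product of normal forms with disjoint singular points *)

Section HormanderProduct.
Variable R : realType.
Local Notation C := R[i].
Implicit Types (f g : R -> C) (s : seq R) (p q x y e : R) (U K : set R).
Implicit Types (t : testfun R) (F G P Q : functional R) (h : smoothfun R).

Lemma distribution0 : is_distribution (0 : functional R).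
Proof.
split; first by move=> a t t'; rewrite scaler0 addr0.
by move=> K cK; exists 0, 0%N => t B _ _; rewrite normr0 mul0r.
Qed.

Lemma distributionD F G : is_distribution F -> is_distribution G ->
  is_distribution (F + G).
Proof.
move=> [lF dF] [lG dG]; split.
  by move=> a t t'; rewrite !functionalD lF lG scalerDr addrACA.
move=> K cK; have [M [N FK]] := dF K cK; have [M' [N' GK]] := dG K cK.
exists (M + M'), (maxn N N') => t B tK tB; rewrite functionalD.
rewrite (le_trans (ler_normD _ _))// mulrDl rmorphD/= lerD//.
- by apply: FK => // k x kN; apply: tB; rewrite (leq_trans kN)// leq_maxl.
- by apply: GK => // k x kN; apply: tB; rewrite (leq_trans kN)// leq_maxr.
Qed.

Lemma distribution_sum (I : Type) (r : seq I) (F : I -> functional R) :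
  (forall i, is_distribution (F i)) -> is_distribution (\sum_(i <- r) F i).
Proof.
by move=> dF; apply: (big_ind (@is_distribution R)) => //;
  [exact: distribution0|exact: distributionD].
Qed.

Lemma cderivn_linear n (a : C) t t' x :
  cderivn n (a *: t + t') x = a * cderivn n t x + cderivn n t' x.
Proof.
have st := test_smooth t; have st' := test_smooth t'.
have sa := smoothM (smooth_cst a) st.
rewrite (_ : (a *: t + t' : R -> C) = (fun y => a * t y + t' y))//.
rewrite (cderivn_addf n (@openT R) (@smooth_onT _ _ sa setT) (@smooth_onT _ _ st' setT))//.
congr (_ + _).
suff -> : cderivn n (fun y => a * t y) = (fun y => a * cderivn n t y) by [].
elim: n => [//|n IH].
rewrite /cderivn iterS -/(cderivn n _) IH; apply/funext => y.
by rewrite cderivZ_at//; exact: st.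
Qed.

Lemma dpoly_distribution p (c : {poly C}) : is_distribution (dpoly p c).
Proof.
split.
  move=> a t t'; transitivity (a * dpoly p c t + dpoly p c t'); last by [].
  rewrite /dpoly mulr_sumr -big_split/=.
  by apply: eq_bigr => j _; rewrite cderivn_linear; ring.
move=> K cK; exists (\sum_(j < size c) (`|complex.Re c`_j| + `|complex.Im c`_j|)).
exists (size c) => t B tK tB.
rewrite (le_trans (ler_norm_sum _ _ _))// mulr_suml rmorph_sum/= ler_sum// => j _.
rewrite !normrM normrX normrN1 expr1n mul1r rmorphM ler_pM ?normr_ge0//.
- exact: normc_le_ReIm.
- by apply: tB; rewrite ltnW.
Qed.

Lemma rep_distribution s f (c : R -> {poly C}) :
  clocally_integrable f -> is_distribution (rep s f c).
Proof.
move=> lf; apply: distributionD; first exact: regdist_distribution.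
by apply: distribution_sum => p; exact: dpoly_distribution.
Qed.

Lemma dpoly_notin_supp p (c : {poly C}) t : ~ supp t p -> dpoly p c t = 0.
Proof.
move=> /supp_notin t0; rewrite /dpoly big1// => j _.
rewrite (nbhs_singleton (near_cderivn j t0)); case: (nat_of_ord j) => [|k].
  by rewrite /= !mulr0.
by rewrite cderivn_cst !mulr0.
Qed.

(** The Hörmander product of [rep s f c] and [rep s' g d] for disjoint lists: each factor is smooth
    near the singular points of the other, so that its genuine derivatives there enter [pmul]. *)
Definition rep_prod s s' f g (c d : R -> {poly C}) : functional R :=
  regdist (fun x => f x * g x) +
  \sum_(p <- s) dpoly p (pmul (fun i => cderivn i g p) (c p)) +
  \sum_(q <- s') dpoly q (pmul (fun i => cderivn i f q) (d q)).

Lemma rep_prodC s s' f g (c d : R -> {poly C}) :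
  rep_prod s s' f g c d = rep_prod s' s g f d c.
Proof.
rewrite /rep_prod addrAC; congr (_ + _ + _).
by congr regdist; apply/funext => x; rewrite mulrC.
Qed.

Lemma rep_prod_local s s' f g (c d : R -> {poly C}) x :
  smooth_on (offs s) f -> x \notin s -> exists U h, [/\ open U, U x,
    eq_on U (rep s f c) (regdist h) &
    eq_on U (rep_prod s s' f g c d) (smooth_mul h (rep s' g d))].
Proof.
move=> sf xs; have [U [h [oU Ux Us hf]]] := localization_smooth sf xs.
exists U, h; split=> // t tU.
- rewrite /rep functionalD fct_sumE big_seq big1 ?addr0 => [|p ps].
    rewrite /regdist; congr cintegral; apply/funext => y.
    have [/tU/hf ->//|nt] := pselect (supp t y); by rewrite test0// !mulr0.
  by rewrite dpoly_notin_supp// => /tU/Us; rewrite /offs/= ps.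
- rewrite /smooth_mul /rep_prod /rep !functionalD !fct_sumE.
  rewrite [X in _ + X + _]big_seq [X in _ + X + _]big1 ?addr0 => [|p ps]; last first.
    by rewrite dpoly_notin_supp// => /tU/Us; rewrite /offs/= ps.
  congr (_ + _).
    rewrite /regdist; congr cintegral; apply/funext => y /=.
    have [/tU/hf ->|nt] := pselect (supp t y); last by rewrite test0// !mulr0.
    by rewrite mulrCA mulrA.
  apply: eq_bigr => q _; rewrite -[RHS]/(smooth_mul h (dpoly q (d q)) t).
  rewrite dpoly_smooth_mul; have [/tU Uq|nt] := pselect (supp t q); last first.
    by rewrite !dpoly_notin_supp.
  congr (dpoly _ (pmul _ _) _); apply/funext => i.
  by apply/esym; exact: (@eq_on_cderivn _ i U).
Qed.

Lemma rep_hormander s s' f g (c d : R -> {poly C}) :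
  psmooth s f -> psmooth s' g -> (forall x, x \in s -> x \notin s') ->
  is_hormander_prod (rep s f c) (rep s' g d) (rep_prod s s' f g c d).
Proof.
move=> pf pg ss'; split.
  have pf' : psmooth (s ++ s') f.
    by apply: psmooth_sub pf => x; rewrite mem_cat => ->.
  have pg' : psmooth (s ++ s') g.
    by apply: psmooth_sub pg => x; rewrite mem_cat orbC => ->.
  apply: distributionD; first apply: distributionD.
  - exact/regdist_distribution/psmooth_locint/(psmoothM pf' pg').
  - by apply: distribution_sum => p; exact: dpoly_distribution.
  - by apply: distribution_sum => p; exact: dpoly_distribution.
move=> x; have [xs|xs] := boolP (x \in s).
  have [sg _] := pg.
  have [U [h [oU Ux h1 h2]]] := rep_prod_local s f d c sg (ss' x xs).
  by exists U, h; split => //; right; rewrite rep_prodC.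
have [sf _] := pf; have [U [h [oU Ux h1 h2]]] := rep_prod_local s' g c d sf xs.
by exists U, h; split => //; left.
Qed.

End HormanderProduct.

(** * Translation of normal forms *)

Section Translation.
Variable R : realType.
Local Notation C := R[i].
Implicit Types (f g : R -> C) (s : seq R) (p q x y e : R).

(** No smoothness is assumed, which suits piecewise smooth functions: translation commutes with the
    difference quotients themselves, hence also with the value that [derive1] takes where they do
    not converge. *)
Lemma cderivn_translate n f e :
  cderivn n (fun y => f (y + e)) = (fun y => cderivn n f (y + e)).
Proof.
have d1 (u : R -> R) x : derive1 (fun y => u (y + e)) x = derive1 u (x + e).
  rewrite /derive1 (_ : (fun h => _) =
    (fun h => h^-1 *: (u (h + (x + e)) - u (x + e))))//.
  by apply/funext => h; rewrite addrA.
elim: n => [//|n IH]; rewrite /cderivn iterS -/(cderivn n _) IH.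
apply/funext => x; transitivity (cderiv (cderivn n f) (x + e)); last by [].
by rewrite /cderiv -!d1.
Qed.

Lemma right_translate x e : (fun y => y + e) @ x^'+ `=>` (x + e)^'+.
Proof.
have c : (fun y => y + e) @ x --> x + e by apply: cvgD; [exact: cvg_id|exact: cvg_cst].
move=> A hA; change (nbhs x (fun y => x < y -> A (y + e))).
have hB : nbhs x (fun y => x + e < y + e -> A (y + e)) := c _ hA.
by apply: filterS hB => y /= Ay xy; apply: Ay; rewrite ltrD2r.
Qed.

Lemma left_translate x e : (fun y => y + e) @ x^'- `=>` (x + e)^'-.
Proof.
have c : (fun y => y + e) @ x --> x + e by apply: cvgD; [exact: cvg_id|exact: cvg_cst].
move=> A hA; change (nbhs x (fun y => y < x -> A (y + e))).
have hB : nbhs x (fun y => y + e < x + e -> A (y + e)) := c _ hA.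
by apply: filterS hB => y /= Ay xy; apply: Ay; rewrite ltrD2r.
Qed.

Lemma right_approach p : (fun e => p + e) @ 0^'+ `=>` p^'+.
Proof.
have := @right_translate 0 p; rewrite add0r => h A hA.
by rewrite (_ : (fun e => p + e) = (fun e => e + p)); [exact: h|apply/funext => e; rewrite addrC].
Qed.

Lemma left_approach p : (fun e => p - e) @ 0^'+ `=>` p^'-.
Proof.
have c : (fun e => p - e) @ (0 : R) --> p.
  rewrite -[X in _ --> X]subr0; apply: cvgB; [exact: cvg_cst|exact: cvg_id].
move=> A hA; change (nbhs (0 : R) (fun y => 0 < y -> A (p - y))).
have hB : nbhs (0 : R) (fun y => p - y < p -> A (p - y)) := c _ hA.
by apply: filterS hB => y /= Ay xy; apply: Ay; rewrite gtrBl.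
Qed.

Lemma psmooth_translate s f e : psmooth s f ->
  psmooth (map (fun p => p - e) s) (fun x => f (x + e)).
Proof.
move=> [sf lf]; split => n x; rewrite cderivn_translate.
  move=> xs; apply: cderivable_shift; apply: sf; rewrite /offs/=.
  by apply: contra xs => xs; apply/mapP; exists (x + e) => //; rewrite addrK.
have [[l fl] [r fr]] := lf n (x + e); split; [exists l|exists r].
- exact: ccvg_comp (left_translate (e := e)) fl.
- exact: ccvg_comp (right_translate (e := e)) fr.
Qed.

Lemma translate_rep s f (c : R -> {poly C}) e : clocally_integrable f ->
  translate e (rep s f c) =
  rep (map (fun p => p - e) s) (fun x => f (x + e)) (fun q => c (q + e)).
Proof.
move=> lf; apply/funext => t; rewrite /translate /rep !functionalD !fct_sumE.
congr (_ + _).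
  have [_ E] := cintegral_shift e (cintegrable_test (test_shift (- e) t) lf).
  transitivity (cintegral (fun x => f x * test_shift (- e) t x)); first by [].
  by rewrite -E /regdist; congr cintegral; apply/funext => x /=; rewrite addrK.
rewrite big_map; apply: eq_bigr => p _; rewrite subrK /dpoly.
by apply: eq_bigr => j _ /=; rewrite cderivn_translate.
Qed.

Lemma near_translate_disjoint s :
  \forall e \near 0^'+, forall x, x \in s -> x \notin map (fun p => p - e) s.
Proof.
have H : \forall e \near 0^'+, forall x, x \in s -> x + e \notin s.
  suff h (l : seq R) : \forall e \near 0^'+, forall x, x \in l -> x + e \notin s by exact: h.
  elim: l => [|p l IH]; first by apply: nearW.
  apply: filterS2 IH (right_approach (right_offs s p)) => e h1 h2 x.
  by rewrite inE => /predU1P[->|]; [exact: h2|exact: h1].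
apply: filterS H => e H x xs; apply/mapP => -[q qs xE].
by have := H x xs; rewrite xE subrK qs.
Qed.

End Translation.

(** * The star product of normal forms *)

Section StarProduct.
Variable R : realType.
Local Notation C := R[i].
Implicit Types (f g : R -> C) (s : seq R) (p q x y e : R) (t : testfun R).

Lemma ccvg_dpoly (T : Type) (F : set_system T) {FF : Filter F} (q : T -> R)
    (u : T -> nat -> C) p (u0 : nat -> C) (c : {poly C}) t :
  (forall i, ccvg_to F (fun z => u z i) (u0 i)) ->
  (forall j, ccvg_to F (fun z => cderivn j t (q z)) (cderivn j t p)) ->
  ccvg_to F (fun z => dpoly (q z) (pmul (u z) c) t) (dpoly p (pmul u0 c) t).
Proof.
move=> uu tq; pose n := size c.
have E q' v : dpoly q' (pmul v c) t = \sum_(j < n)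
    (\sum_(i < n) ((- 1) ^+ i * v i) * (c^`N(i))`_j) *
    ((- 1) ^+ j * cderivn j t q').
  rewrite (dpolyE q' t (size_pmul v c)); apply: eq_bigr => j _.
  by rewrite coef_sum; congr (_ * _); apply: eq_bigr => i _; rewrite coefZ.
rewrite E (_ : (fun z => _) = fun z => \sum_(j < n)
    (\sum_(i < n) ((- 1) ^+ i * u z i) * (c^`N(i))`_j) *
    ((- 1) ^+ j * cderivn j t (q z))); last by apply/funext => z; exact: E.
apply: ccvg_sum => j _; apply: ccvgM; last exact: ccvgZ (tq j).
apply: ccvg_sum => i _; apply: ccvgM; last exact: ccvg_cst.
exact: ccvgZ (uu i).
Qed.

Lemma ccvg_regdist_translate s f g t : psmooth s f -> psmooth s g ->
  ccvg_to 0^'+ (fun e => regdist (fun x => f x * g (x + e)) t)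
    (regdist (fun x => f x * g x) t).
Proof.
move=> pf pg; have [N [_ KN]] := compact_bounded (test_compact t).
pose M := `|N| + 1.
have KM x : supp t x -> `|x| <= M.
  by move=> xt; apply: (KN M) => //; rewrite /M (le_lt_trans (ler_norm N))// ltrDl.
(* The right end is [M + 1] because the shift [e] stays below 1, so [x + e] remains in the segment
   for [x] in the support of [t]. *)
have [B1 B10 fB] := psmooth_bounded pf (@segment_compact _ (- M) (M + 1)).
have [B2 B20 gB] := psmooth_bounded pg (@segment_compact _ (- M) (M + 1)).
have [B3 B30 tB] := test_bounded t.
have hB e x : 0 < e < 1 -> `|f x * g (x + e) * t x| <= (B1 * B2 * B3)%:C.
  move=> /andP[e0 e1]; have [/KM|nx] := pselect (supp t x); last first.
    by rewrite test0// mulr0 normr0 lecR !mulr_ge0.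
  rewrite ler_norml => /andP[Mx xM]; rewrite !normrM !rmorphM.
  rewrite !ler_pM ?mulr_ge0 ?normr_ge0//.
  - by apply: fB; rewrite /= in_itv/= Mx/= (le_trans xM)// lerDl.
  - by apply: gB; rewrite /= in_itv/= lerD ?(ltW e1)// andbT (le_trans Mx)// lerDl ltW.
have h0 e x : ~ supp t x -> f x * g (x + e) * t x = 0.
  by move=> nx; rewrite test0// mulr0.
have mh e : cmeasurable (fun x => f x * g (x + e) * t x).
  apply: cmeasurableM (test_measurable t); apply: cmeasurableM.
    exact: psmooth_measurable pf.
  exact: psmooth_measurable (psmooth_translate e pg).
have mh0 : cmeasurable (fun x => f x * g x * t x).
  apply: cmeasurableM (test_measurable t).
  exact: psmooth_measurable (psmoothM pf pg).
have hc x : x \notin s ->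
    ccvg_to 0^'+ (fun e => f x * g (x + e) * t x) (f x * g x * t x).
  move=> xs; have [sg _] := pg; apply: ccvgM; last exact: ccvg_cst.
  apply: ccvgM; first exact: ccvg_cst.
  apply: ccvg_comp (right_approach (p := x)) _.
  by apply: ccvg_sub (cderivable_cvg (sg 0%N x xs)); exact: cvg_within.
split.
- apply: (@dominated_at_right R s
    (fun e => reF (fun x => f x * g (x + e) * t x))
    (reF (fun x => f x * g x * t x)) (supp t) (B1 * B2 * B3)).
  + exact: test_compact.
  + by move=> e _; have [] := mh e.
  + by have [] := mh0.
  + by move=> e x _ /(h0 e); rewrite /reF => ->.
  + by move=> e x e01; exact: normc_le_Re (hB e x e01).
  + by move=> x /hc[].
- apply: (@dominated_at_right R s
    (fun e => imF (fun x => f x * g (x + e) * t x))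
    (imF (fun x => f x * g x * t x)) (supp t) (B1 * B2 * B3)).
  + exact: test_compact.
  + by move=> e _; have [] := mh e.
  + by have [] := mh0.
  + by move=> e x _ /(h0 e); rewrite /imF => ->.
  + by move=> e x e01; exact: normc_le_Im (hB e x e01).
  + by move=> x /hc[].
Qed.

(** For small e > 0 the shift moves the singular points of the right factor to p - e, where [f] is
    evaluated, while at p the right factor is evaluated as g(p + e). Letting e tend to 0 produces
    left limits of [f] and right limits of [g]; the regular parts converge by dominated
    convergence. *)
Lemma star_rep s f g (c d : R -> {poly C}) : psmooth s f -> psmooth s g ->
  star (rep s f c) (rep s g d) = rep s (fun x => f x * g x) (fun p =>
    pmul (fun i => rlim (cderivn i g) p) (c p) +
    pmul (fun i => llim (cderivn i f) p) (d p)).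
Proof.
move=> pf pg; have pfg := psmoothM pf pg; apply: starE; split.
  exact/rep_distribution/(psmooth_locint pfg).
exists (fun e => rep_prod s (map (fun p => p - e) s) f (fun x => g (x + e))
  c (fun q => d (q + e))); split.
  apply: filterS (near_translate_disjoint s) => e dis.
  rewrite (translate_rep _ _ _ (psmooth_locint pg)).
  exact: rep_hormander pf (psmooth_translate e pg) dis.
move=> t; have st := test_smooth t.
pose Q1 e := regdist (fun x => f x * g (x + e)) t.
pose Q2 e := \sum_(p <- s) dpoly p (pmul (fun i => cderivn i g (p + e)) (c p)) t.
pose Q3 e := \sum_(p <- s) dpoly (p - e) (pmul (fun i => cderivn i f (p - e)) (d p)) t.
rewrite [X in ccvg_to _ X _](_ : _ = fun e => Q1 e + Q2 e + Q3 e); last first.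
  apply/funext => e; rewrite /rep_prod !functionalD !fct_sumE big_map.
  congr (_ + _ + _); apply: eq_bigr => p _; last by rewrite subrK.
  congr (dpoly _ (pmul _ _) _); apply/funext => i.
  by rewrite cderivn_translate.
rewrite (_ : rep _ _ _ _ = regdist (fun x => f x * g x) t +
    \sum_(p <- s) dpoly p (pmul (fun i => rlim (cderivn i g) p) (c p)) t +
    \sum_(p <- s) dpoly p (pmul (fun i => llim (cderivn i f) p) (d p)) t); last first.
  rewrite /rep functionalD fct_sumE -addrA -big_split/=; congr (_ + _).
  by apply: eq_bigr => p _; rewrite dpolyD.
apply: ccvgD; first apply: ccvgD.
- exact: ccvg_regdist_translate t pf pg.
- apply: ccvg_sum => p _; apply: ccvg_dpoly => [i|j]; last exact: ccvg_cst.
  apply: ccvg_comp (right_approach (p := p)) _.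
  exact: (psmooth_rlim (s := s) p (psmooth_cderivn i pg)).
- apply: ccvg_sum => p _; apply: ccvg_dpoly => [i|j].
    apply: ccvg_comp (left_approach (p := p)) _.
    exact: (psmooth_llim (s := s) p (psmooth_cderivn i pf)).
  apply: ccvg_comp (left_approach (p := p)) _.
  by apply: ccvg_sub (cderivable_cvg (st j p)); exact: cvg_within.
Qed.

End StarProduct.

(** * Order of a distribution *)

Section OrderBound.
Variable R : realType.
Local Notation C := R[i].
Local Notation mu := (@lebesgue_measure R).
Implicit Types (f g : R -> C) (s : seq R) (p q x y a : R) (t : testfun R).

Lemma cderiv_affine f a p x : smooth f ->
  cderivable (fun y => f (a * (y - p))) x /\
  cderiv (fun y => f (a * (y - p))) x = a%:C * cderiv f (a * (x - p)).
Proof.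
move=> sf; have [fr fi] := sf 0%N (a * (x - p)).
have da : is_derive x 1 (fun y => a * (y - p)) a.
  have H : is_derive x 1 (fun y => a * (y - p)) (a *: (1 - 0)) :=
    is_deriveZ a (is_deriveB (is_derive_id x (1 : R)) (is_derive_cst p x (1 : R))).
  by apply: is_derive_eq H _; rewrite subr0 /GRing.scale/= mulr1.
have d (u : R -> R) : derivable u (a * (x - p)) 1 ->
    is_derive x 1 (fun y => u (a * (y - p))) (derive1 u (a * (x - p)) * a).
  move=> du; have du' : is_derive (a * (x - p)) 1 u (derive1 u (a * (x - p))).
    by rewrite derive1E; exact/derivableP.
  exact: (@is_derive1_comp R u (fun y => a * (y - p)) x _ _ du' da).
have [dr er] := d _ fr; have [di ei] := d _ fi; split; first by split.
apply: eq_complex_val => /=.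
- by rewrite mul0r subr0 [RHS]mulrC derive1E; exact: er.
- by rewrite mul0r addr0 [RHS]mulrC derive1E; exact: ei.
Qed.

Lemma cderivn_affine n f a p : smooth f ->
  cderivn n (fun y => f (a * (y - p))) =
  (fun y => a%:C ^+ n * cderivn n f (a * (y - p))).
Proof.
move=> sf; elim: n => [|n IH]; first by apply/funext => y; rewrite expr0 mul1r.
rewrite /cderivn iterS -/(cderivn n _) IH; apply/funext => x.
have sfn : smooth (cderivn n f) by move=> k y; rewrite cderivn_add; exact: sf.
have [d e] := cderiv_affine a p x sfn.
by rewrite cderivZ_at// e exprSr mulrA.
Qed.

Lemma smooth_affine f a p : smooth f -> smooth (fun y => f (a * (y - p))).
Proof.
move=> sf n x; rewrite cderivn_affine//; apply: cderivableZ_at.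
have sfn : smooth (cderivn n f) by move=> k y; rewrite cderivn_add; exact: sf.
by have [] := cderiv_affine a p x sfn.
Qed.

Lemma istest_affine t a p : 0 < a -> (fun y => t (a * (y - p))) \in @istest R.
Proof.
move=> a0; apply/istestP; split; first exact: smooth_affine (test_smooth t).
apply: (@compact_suppW _ _ ((fun y => y / a + p) @` supp t)).
  apply: continuous_compact; last exact: test_compact.
  apply: continuous_subspaceT => y; apply: cvgD; last exact: cvg_cst.
  by apply: cvgM; [exact: cvg_id|exact: cvg_cst].
move=> y ny; apply: test0 => ty; apply: ny; exists (a * (y - p)) => //.
by rewrite mulrC mulKf ?gt_eqF// subrK.
Qed.

(** The dilation factor is [n.+1], hence positive for every [n]. *)
Definition test_affine t n p : testfun R :=
  TestFun (istest_affine t p (ltr0Sn R n)).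

(** The supports shrink to [p], so the integrand is eventually 0 at every other point, and it is
    dominated by [G], a multiple of |Re g| + |Im g| on a fixed segment around [p]. *)
Lemma cvg_affine_integral g t p : clocally_integrable g ->
  ccvg_to \oo (fun n => regdist g (test_affine t n p)) 0.
Proof.
move=> lg; have [lr li] := lg; have [mr mi] := clocally_integrable_measurable lg.
have [B B0 tB] := test_bounded t.
have [N [_ KN]] := compact_bounded (test_compact t).
pose L := `|N| + 1.
have KL x : L < `|x| -> t x = 0.
  move=> Lx; apply: test0 => tx; move: Lx; apply/negP; rewrite -leNgt.
  by apply: (KN L) => //; rewrite /L (le_lt_trans (ler_norm N))// ltrDl.
pose K := `[p - L, p + L]%classic.
have cK : compact K by exact: segment_compact.
have nK n x : ~ K x -> test_affine t n p x = 0.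
  rewrite /K /= in_itv/= -ler_distl => /negP; rewrite -ltNge => Lx /=.
  apply: KL; rewrite normrM (lt_le_trans Lx)// ler_peMl// ger0_norm//.
  by rewrite ler1n.
have mK : measurable_fun setT (\1_K : R -> R).
  by apply: measurable_indic; exact: compact_measurable.
have K0 x : ~ K x -> \1_K x = 0 :> R by move=> nKx; rewrite indicE memNset.
have K1 x : `|\1_K x| <= 1 :> R by rewrite indicE ger0_norm//; case: (x \in K).
have [ir _] := integrable_locM lr mK cK K0 K1.
have [ii _] := integrable_locM li mK cK K0 K1.
pose G x := B * (`|reF g x * \1_K x| + `|imF g x * \1_K x|).
have iG : mu.-integrable setT (EFin \o G).
  apply: integrable_realZ.
  have := integrableD measurableT (integrable_norm ir) (integrable_norm ii).
  by apply: eq_integrable => // x _; rewrite /= -EFinD.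
have bG n x : `|complex.Re (g x * test_affine t n p x)| <= G x /\
              `|complex.Im (g x * test_affine t n p x)| <= G x.
  have [Kx|nKx] := pselect (K x); last first.
    rewrite nK// mulr0 normr0 /G K0// !mulr0 normr0 addr0 mulr0.
    by split.
  have E1 : \1_K x = 1 :> R by rewrite indicE mem_set.
  rewrite /G E1 !mulr1 /reF /imF; set v := test_affine t n p x.
  have vr : `|complex.Re v| <= B by exact: normc_le_Re (tB _).
  have vi : `|complex.Im v| <= B by exact: normc_le_Im (tB _).
  have h1 (z1 z2 : R) : `|z2| <= B -> `|z1 * z2| <= B * `|z1|.
    by move=> zB; rewrite normrM mulrC ler_wpM2r.
  have Mr : complex.Re (g x * v) = complex.Re (g x) * complex.Re v - complex.Im (g x) * complex.Im v.
    by case: (g x) (v) => [? ?] [].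
  have Mi : complex.Im (g x * v) = complex.Re (g x) * complex.Im v + complex.Im (g x) * complex.Re v.
    by case: (g x) (v) => [? ?] [].
  rewrite Mr Mi mulrDr; split.
    by rewrite (le_trans (ler_normB _ _))// lerD// h1.
  by rewrite (le_trans (ler_normD _ _))// lerD// h1.
have h0 x : x \notin [:: p] -> \forall n \near \oo, g x * test_affine t n p x = 0.
  rewrite inE => xp; have d0 : 0 < `|x - p| by rewrite normr_gt0 subr_eq0.
  near=> n; rewrite /= KL ?mulr0// normrM (@ger0_norm _ n.+1%:R)//.
  rewrite -ltr_pdivrMr//; apply: (@lt_trans _ _ n%:R); last by rewrite ltr_nat.
  near: n; exact: nbhs_infty_gtr.
have mg n : cmeasurable (fun x => g x * test_affine t n p x).
  exact: cmeasurableM (clocally_integrable_measurable lg) (test_measurable _).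
rewrite /regdist/cintegral; split.
- rewrite (_ : complex.Re 0 = \int[mu]_x (cst 0 x)); last first.
    by rewrite /Rintegral integral0.
  apply: (@dominated_seq R [:: p] (fun n => reF (fun x => g x * test_affine t n p x))
    (cst 0) G) => //.
  + by move=> n; have [] := mg n.
  + by move=> n x; have [] := bG n x.
  + move=> x /h0 hx; apply: (@cvg_trans _ (0 @[n --> \oo])); last exact: cvg_cst.
    by apply: near_eq_cvg; apply: filterS hx => n; rewrite /reF => ->.
- rewrite (_ : complex.Im 0 = \int[mu]_x (cst 0 x)); last first.
    by rewrite /Rintegral integral0.
  apply: (@dominated_seq R [:: p] (fun n => imF (fun x => g x * test_affine t n p x))
    (cst 0) G) => //.
  + by move=> n; have [] := mg n.
  + by move=> n x; have [] := bG n x.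
  + move=> x /h0 hx; apply: (@cvg_trans _ (0 @[n --> \oo])); last exact: cvg_cst.
    by apply: near_eq_cvg; apply: filterS hx => n; rewrite /imF => ->.
Unshelve. all: by end_near. Qed.

Lemma cderivn_monomial m j :
  cderivn j (fun x : R => x%:C ^+ m) =
  (fun x : R => (m ^_ j)%:R * x%:C ^+ (m - j)).
Proof.
have cX n : cderiv (fun x : R => x%:C ^+ n) = (fun x : R => n%:R * x%:C ^+ n.-1).
  elim: n => [|n IH].
    rewrite [X in cderiv X](_ : _ = (fun=> 1)) ?cderiv_cst//.
    by apply/funext => x; rewrite mul0r.
  apply/funext => x; rewrite [X in cderiv X](_ : _ = (fun x : R => x%:C * x%:C ^+ n)); last first.
    by apply/funext => y; rewrite exprS.
  have [dx ex] := is_derive_cderiv (is_derive_id x (1 : R)).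
  rewrite cderivM_at//; last exact: (smoothX n (@smooth_id R) 0%N x).
  rewrite ex IH mul1r -natr1 mulrDl mul1r addrC; congr (_ + _).
  by case: n {IH} => [|n]; rewrite ?mul0r ?mulr0// mulrCA exprS.
elim: j => [|j IH]; first by apply/funext => x; rewrite ffactn0 mul1r subn0.
rewrite /cderivn iterS -/(cderivn j _) IH; apply/funext => x.
rewrite cderivZ_at; last exact: (smoothX _ (@smooth_id R) 0%N x).
by rewrite cX mulrA -natrM ffactnSr subnS.
Qed.

(** The jet isolates one coefficient: the right-hand side is m! for j = m and 0 otherwise, through
    the power of 0 if j < m and through the falling factorial if j > m. *)
Lemma exists_test_monomial m : exists t : testfun R,
  forall j, cderivn j t 0 = (m ^_ j)%:R * 0 ^+ (m - j).
Proof.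
have [u [su _ u1 u0]] := exists_bump (0 : R) (ltr01 : 0 < 1 :> R).
have tt : (fun x : R => x%:C ^+ m * (u x)%:C) \in @istest R.
  apply/istestP; split; first exact: smoothM (smoothX m (@smooth_id R)) su.
  apply: (compact_suppW (@segment_compact _ (-1) 1)) => x.
  rewrite /= in_itv/= -ler_norml => /negP; rewrite -ltNge => /ltW x1.
  by rewrite u0 ?mulr0// subr0.
exists (TestFun tt) => j.
rewrite -[RHS]/((fun x : R => (m ^_ j)%:R * x%:C ^+ (m - j)) 0) -cderivn_monomial.
have h : 0 < 1 / 2 :> R by rewrite divr_gt0.
have E : \forall y \near (0 : R), TestFun tt y = y%:C ^+ m.
  apply: filterS (@nbhsx_ballx R R 0 _ h) => y.
  rewrite /ball/= sub0r normrN => y1.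
  by rewrite u1 ?mulr1// subr0 ltW.
exact: nbhs_singleton (near_cderivn j E).
Qed.

Lemma dderivn_eval k (F : functional R) t :
  dderivn k F t = (- 1) ^+ k * F (iter k (@test_deriv R) t).
Proof.
elim: k t => [|k IH] t; first by rewrite expr0 mul1r.
by rewrite /dderivn iterS -/(dderivn k F) /dderiv IH -iterSr exprS mulN1r mulNr.
Qed.

Lemma iter_test_deriv k t x : iter k (@test_deriv R) t x = cderivn k t x.
Proof. by elim: k t => [//|k IH] t; rewrite iterSr IH cderivn_cderiv. Qed.

(* Test against t(n (x - p)) as n -> oo, where t is x^m near 0 and m is the    *)
(* degree of c p: the delta part grows like n^m, whereas a k-th derivative of *)
(* a locally integrable function contributes o(n^k).                          *)
Lemma rep_size_le s f g (c : R -> {poly C}) k p : uniq s -> psmooth s f ->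
  clocally_integrable g -> rep s f c = dderivn k (regdist g) -> p \in s ->
  (size (c p) <= k)%N.
Proof.
move=> us pf lg fg ps; rewrite leqNgt; apply/negP => kc.
pose m := (size (c p)).-1.
have cm : size (c p) = m.+1 by rewrite /m prednK// (leq_ltn_trans _ kc).
have km : (k <= m)%N by rewrite -ltnS -cm.
have [t tE] := exists_test_monomial m.
pose T n := test_affine t n p.
have dT n j x : cderivn j (T n) x = n.+1%:R%:C ^+ j * cderivn j t (n.+1%:R * (x - p)).
  by rewrite (cderivn_affine j _ p (test_smooth t)).
have kt : cderivn k t \in @istest R.
  elim: k {fg kc km} => [|k IH]; first exact: valP.
  exact: istest_cderiv (TestFun IH).
have dk n : dderivn k (regdist g) (T n) =
    (- 1) ^+ k * (n.+1%:R%:C ^+ k * regdist g (test_affine (TestFun kt) n p)).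
  rewrite dderivn_eval; congr (_ * _).
  rewrite /regdist -cintegralZ; last exact: cintegrable_test lg.
  by congr cintegral; apply/funext => x; rewrite iter_test_deriv dT mulrCA.
have near_supp q : q != p -> \forall n \near \oo, ~ supp (T n) q.
  move=> qp; have [N [_ KN]] := compact_bounded (test_compact t).
  pose L := `|N| + 1.
  have tL x : L < `|x| -> t x = 0.
    move=> Lx; apply: test0 => tx; move: Lx; apply/negP; rewrite -leNgt.
    by apply: (KN L) => //; rewrite /L (le_lt_trans (ler_norm N))// ltrDl.
  have d0 : 0 < `|q - p| by rewrite normr_gt0 subr_eq0.
  near=> n.
  have qn : L < n.+1%:R * `|q - p|.
    rewrite -ltr_pdivrMr//; apply: (@lt_trans _ _ n%:R); last by rewrite ltr_nat.
    near: n; exact: nbhs_infty_gtr.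
  pose A := [set x : R | n.+1%:R * `|x - p| <= L].
  have cA : closed A.
    rewrite (_ : A = (fun x => n.+1%:R * `|x - p|) @^-1` [set z | z <= L])//.
    apply: preimage_closed; last exact: closed_le.
    move=> y _; apply: cvgM; first exact: cvg_cst.
    by apply: cvg_norm; apply: cvgB; [exact: cvg_id|exact: cvg_cst].
  have TA : supp (T n) `<=` A.
    apply: supp_sub => // x /negP; rewrite -ltNge => xL /=.
    by apply: tL; rewrite normrM ger0_norm.
  by move=> /TA; rewrite /A/= leNgt qn.
(* For large [n] the other points of [s] have left the support of [T n], and at [p] the jet of [t]
   retains only the leading coefficient of [c p]. *)
have rs : \forall n \near \oo, rep s f c (T n) = regdist f (T n) +
    (c p)`_m * ((- 1) ^+ m * (n.+1%:R%:C ^+ m * m`!%:R)).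
  have far : \forall n \near \oo, forall q, q \in rem p s -> ~ supp (T n) q.
    have : {subset rem p s <= predC1 p}.
      by move=> q; rewrite mem_rem_uniq// inE => /andP[].
    elim: (rem p s) => [_|q l IH ql]; first by apply: nearW => n q.
    have qp : q != p by have := ql q (mem_head _ _).
    have {}IH := IH (fun r rl => ql r (@mem_behead _ (q :: l) r rl)).
    apply: filterS2 IH (near_supp q qp) => n h1 h2 r.
    by rewrite inE => /predU1P[->|]; [exact: h2|exact: h1].
  apply: filterS far => n far; rewrite /rep functionalD fct_sumE; congr (_ + _).
  rewrite (perm_big _ (perm_to_rem ps)) big_cons big_seq big1 ?addr0 => [|q /far].
    rewrite /dpoly cm big_ord_recr/= big1 ?add0r => [|j _].
      by rewrite dT subrr mulr0 tE subnn expr0 mulr1 ffactnn addr0.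
    by rewrite -[X in _ * (_ * X)]/(cderivn j (T n) p) dT subrr mulr0 tE expr0n subn_eq0 leqNgt ltn_ord !mulr0.
  exact: dpoly_notin_supp.
pose c0 := (c p)`_m * ((- 1) ^+ m * m`!%:R).
(* The assumed equality, tested against [T n] and divided by (n+1)^m; [harmonic n] is 1/(n+1). The
   left side tends to 0, because k <= m and both integrals do, whereas the right side is
   constant. *)
have c0E : \forall n \near \oo,
    (- 1) ^+ k * ((harmonic n)%:C ^+ (m - k) * regdist g (test_affine (TestFun kt) n p)) +
    - 1 * ((harmonic n)%:C ^+ m * regdist f (T n)) = c0.
  apply: filterS rs => n; rewrite fg dk => E.
  set z := n.+1%:R%:C in E; have z0 : z != 0 by rewrite /z fmorph_eq0 pnatr_eq0.
  have -> : (harmonic n)%:C = z^-1 by rewrite /harmonic fmorphV.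
  have zm : z ^+ m != 0 by rewrite expf_neq0.
  apply: (mulfI zm); rewrite mulrDr /c0.
  rewrite (_ : z ^+ m * ((- 1) ^+ k * (z^-1 ^+ (m - k) * _)) =
    (-1) ^+ k * (z ^+ k * regdist g (test_affine (TestFun kt) n p))); last first.
    rewrite mulrCA; congr (_ * _); rewrite mulrA; congr (_ * _).
    by rewrite -{1}(subnKC km) exprD exprVn -mulrA divff ?mulr1// expf_neq0.
  have -> X : z ^+ m * (- 1 * (z^-1 ^+ m * X)) = - X.
    by rewrite mulN1r mulrN mulrA exprVn divff// mul1r.
  by rewrite E addrC addKr; ring.
have hc j : ccvg_to \oo (fun n => (@harmonic R n)%:C ^+ j) (0 ^+ j).
  have h1 : ccvg_to \oo (fun n => (@harmonic R n)%:C) 0.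
    by split; [exact: cvg_harmonic|exact: cvg_cst].
  elim: j => [|j IH].
    by rewrite expr0 (_ : (fun n => _) = fun=> 1); [exact: ccvg_cst|apply/funext => n; rewrite expr0].
  rewrite exprS (_ : (fun n => _) = fun n => (@harmonic R n)%:C * (@harmonic R n)%:C ^+ j).
    exact: ccvgM.
  by apply/funext => n; rewrite exprS.
have lf := psmooth_locint pf.
have c00 : ccvg_to \oo (fun _ : nat => c0)
    ((- 1) ^+ k * (0 ^+ (m - k) * 0) + - 1 * (0 ^+ m * 0)).
  apply: near_ccvg c0E _; apply: ccvgD; apply: ccvgZ; apply: ccvgM.
  - exact: hc.
  - exact: cvg_affine_integral lg.
  - exact: hc.
  - exact: cvg_affine_integral lf.
rewrite !mulr0 addr0 in c00.
have : c0 = 0 by apply: ccvg_unique c00; exact: ccvg_cst.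
move/eqP; rewrite /c0 !mulf_eq0 signr_eq0 pnatr_eq0 eqn0Ngt fact_gt0/= orbF.
by rewrite -[(c p)`_m]/(lead_coef (c p)) lead_coef_eq0 -size_poly_eq0 cm.
Unshelve. all: by end_near. Qed.

End OrderBound.

(** * Vanishing jumps *)

Section RemovableJumps.
Variable R : realType.
Local Notation C := R[i].
Implicit Types (f g : R -> C) (s : seq R) (p q x y : R) (u : R -> R).

(** By the mean value theorem, a difference quotient at [p] is the derivative at an intermediate
    point, which lies in the punctured neighbourhood where the derivative is close to [L]. *)
Lemma is_derive_limit u p (d L : R) : 0 < d ->
  (forall y, 0 < `|y - p| < d -> derivable u y 1) -> {for p, continuous u} ->
  derive1 u y @[y --> p^'] --> L -> is_derive p 1 u L.
Proof.
move=> d0 du cu u'L.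
suff H : h^-1 *: ((u \o shift p) (h *: 1) - u p) @[h --> 0^'] --> L.
  by apply: DeriveDef; [apply/cvg_ex; exists L|exact/cvg_lim].
have cu' y : `|y - p| < d -> {for y, continuous u}.
  move=> yd; have [->//|yp] := eqVneq y p.
  apply/differentiable_continuous/derivable1_diffP/du.
  by rewrite yd normr_gt0 subr_eq0 yp.
apply/cvgrPdist_le => e e0.
have [r /= r0 rL] : \forall y \near p^', `|L - derive1 u y| <= e.
  by move/cvgrPdist_le : u'L => /(_ e e0).
exists (Num.min d r) => /=; first by rewrite lt_min d0.
move=> h; rewrite /= sub0r normrN lt_min => /andP[hd hr] h0.
have mvt a b : a < b -> (forall y, y \in `[a, b] -> `|y - p| < d) ->
    (forall y, y \in `]a, b[ -> 0 < `|y - p| < d /\ `|y - p| < r) ->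
    exists2 c, `|L - derive1 u c| <= e & u b - u a = derive1 u c * (b - a).
  move=> ab abd abr.
  have [||c cab uc] := @MVT R u (derive1 u) a b ab.
  - move=> y /abr[yd _]; rewrite derive1E; exact/derivableP/du.
  - by apply: continuous_in_subspaceT => y; rewrite inE => /abd; exact: cu'.
  exists c => //; apply: rL; have [/andP[c0 _] cr] := abr c cab.
    by rewrite /= distrC.
  by move: c0; rewrite normr_gt0 subr_eq0.
rewrite /GRing.scale/= mulr1.
move: h0; rewrite neq_lt => /orP[h0|h0].
- have hn : `|h| = - h by rewrite ltr0_norm.
  have [|y|y|c ce uc] := mvt (h + p) p.
  + by rewrite gtrDr.
  + rewrite in_itv/= => /andP[y1 y2]; rewrite ler0_norm ?subr_le0//.
    by move: hd; rewrite hn; lra.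
  + rewrite in_itv/= => /andP[y1 y2]; rewrite ltr0_norm ?subr_lt0//.
    by move: hd hr; rewrite hn => hd hr; split; [apply/andP; split|]; lra.
  have -> : u (h + p) - u p = derive1 u c * h by move: uc; lra.
  by rewrite mulrC mulfK ?lt_eqF.
- have hn : `|h| = h by rewrite gtr0_norm.
  have [|y|y|c ce uc] := mvt p (h + p).
  + by rewrite ltrDr.
  + rewrite in_itv/= => /andP[y1 y2]; rewrite ger0_norm ?subr_ge0//.
    by move: hd; rewrite hn; lra.
  + rewrite in_itv/= => /andP[y1 y2]; rewrite gtr0_norm ?subr_gt0//.
    by move: hd hr; rewrite hn => hd hr; split; [apply/andP; split|]; lra.
  have -> : u (h + p) - u p = derive1 u c * h by move: uc; rewrite addrK.
  by rewrite mulrC mulfK ?gt_eqF.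
Qed.

Lemma rlim_offs s f x : psmooth s f -> x \notin s -> rlim f x = f x.
Proof.
move=> [sf _] xs; apply: rlimE.
by apply: ccvg_sub (cderivable_cvg (sf 0%N x xs)); exact: cvg_within.
Qed.

(** Passing to [rlim f] alters [f] on [s] only, where the value becomes the right limit; a vanishing
    jump makes it the left limit too. *)
Lemma rlim_ccontinuous s f : psmooth s f -> (forall p, p \in s -> jump f p = 0) ->
  ccontinuous (rlim f).
Proof.
move=> pf jf x.
have lr : llim f x = rlim f x.
  have [xs|xs] := boolP (x \in s).
    by have /eqP := jf x xs; rewrite subr_eq0 => /eqP.
  rewrite (rlim_offs pf xs); apply: llimE; have [sf _] := pf.
  by apply: ccvg_sub (cderivable_cvg (sf 0%N x xs)); exact: cvg_within.
have hr : ccvg_to x^'+ (rlim f) (rlim f x).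
  apply: near_ccvg (psmooth_rlim x pf).
  by apply: filterS (right_offs s x) => y ys; rewrite (rlim_offs pf).
have hl : ccvg_to x^'- (rlim f) (rlim f x).
  rewrite -[X in ccvg_to _ _ X]lr; apply: near_ccvg (psmooth_llim x pf).
  by apply: filterS (left_offs s x) => y ys; rewrite (rlim_offs pf).
move: hr hl => [rr ri] [lre lim_]; split.
- exact/left_right_continuousP.
- exact/left_right_continuousP.
Qed.

(** At a point of [s], [is_derive_limit] applies: the vanishing jump of [f] gives continuity, and
    that of [cderiv f] gives the limit of the derivative. *)
Lemma rlim_cderivable s f : psmooth s f -> (forall p, p \in s -> jump f p = 0) ->
  (forall p, p \in s -> jump (cderiv f) p = 0) ->
  forall x, cderivable (rlim f) x /\ cderiv (rlim f) x = rlim (cderiv f) x.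
Proof.
move=> pf jf jf' x; have cf := rlim_ccontinuous pf jf.
have pf' := psmooth_cderiv pf; have cf' := rlim_ccontinuous pf' jf'.
have [sf _] := pf.
have off y : y \notin s ->
    cderivable (rlim f) y /\ cderiv (rlim f) y = rlim (cderiv f) y.
  move=> ys; have E : \forall z \near y, f z = rlim f z.
    by apply: (open_nearP (open_offs s)) ys _ => z zs; rewrite (rlim_offs pf zs).
  split; first exact: near_cderivable E (sf 0%N y ys).
  by rewrite (rlim_offs pf' ys); apply: near_cderiv; apply: filterS E => z ->.
have [xs|] := boolP (x \in s); last exact: off.
have [d d0 dx] : exists2 d, 0 < d & forall y, 0 < `|y - x| < d -> y \notin s.
  have [d /= d0 dP] := near_offs s x; exists d => // y /andP[yx yd].
  by apply: dP; [rewrite /= distrC|rewrite -subr_eq0 -normr_gt0].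
have nx : \forall y \near x^', y \notin s.
  exists d => // y /= yd yx; apply: dx.
  by rewrite normr_gt0 subr_eq0 yx distrC.
have c' : ccvg_to x^' (cderiv (rlim f)) (rlim (cderiv f) x).
  have : ccvg_to x^' (rlim (cderiv f)) (rlim (cderiv f) x).
    by apply: ccvg_sub (cf' x); exact: cvg_within.
  by apply: near_ccvg; apply: filterS nx => y /off[_ ->].
have [c'r c'i] := c'; have [cr ci] := cf x.
have Dr : is_derive x 1 (reF (rlim f)) (complex.Re (rlim (cderiv f) x)).
  by apply: is_derive_limit d0 _ cr c'r => y /dx/off[[]].
have Di : is_derive x 1 (imF (rlim f)) (complex.Im (rlim (cderiv f) x)).
  by apply: is_derive_limit d0 _ ci c'i => y /dx/off[[]].
split; first by split; [case: Dr|case: Di].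
by apply: eq_complex_val => /=; rewrite derive1E; [case: Dr|case: Di].
Qed.

Lemma rlim_regdist s f : psmooth s f -> (forall p, p \in s -> jump f p = 0) ->
  regdist f = regdist (rlim f).
Proof.
move=> pf jf; have cf := rlim_ccontinuous pf jf.
apply: (@regdist_ae _ s); first exact: psmooth_measurable pf.
  by split; apply: continuous_measurable_fun => x; have [] := cf x.
by move=> x xs; rewrite (rlim_offs pf).
Qed.

End RemovableJumps.

(** * The differential equation *)

Section Representation.
Variable R : realType.
Local Notation C := R[i].
Implicit Types (f g : R -> C) (s : seq R) (p q x : R) (F G : functional R).
Implicit Types (c d : R -> {poly C}).

(** Delta part at [p] of the [n]-th derivative of [rep s f c]. *)
Fixpoint dcoef f c n p : {poly C} :=
  if n is m.+1 then dcoef f c m p * 'X + (jump (cderivn m f) p)%:P else c p.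

Lemma dderivn_rep n s f c : uniq s -> psmooth s f ->
  dderivn n (rep s f c) = rep s (cderivn n f) (dcoef f c n).
Proof.
move=> us pf; elim: n => [//|n IH].
by rewrite /dderivn iterS -/(dderivn n _) IH (dderiv_rep _ us (psmooth_cderivn n pf)).
Qed.

Lemma size_mulX_addC (c : {poly C}) (a : C) k :
  (size c <= k)%N -> (size (c * 'X + a%:P)%R <= k.+1)%N.
Proof.
move=> ck; rewrite (leq_trans (size_polyD _ _))// geq_max.
rewrite (leq_trans (size_polyC_leq1 _))// andbT.
by rewrite (leq_trans (size_polyMleq _ _))// size_polyX addn2.
Qed.

Lemma size_dcoef f c p j k n : (size (dcoef f c j p) <= k)%N ->
  (size (dcoef f c (n + j) p) <= n + k)%N.
Proof. by move=> h; elim: n => [//|n IH]; rewrite addSn size_mulX_addC. Qed.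

(** Jumps enter in degree 0 and are only shifted afterwards. In the fourth derivative, the
    coefficient of degree m of [c p], the jump of [f] and the jump of [cderiv f] therefore sit in
    degrees m + 4, 3 and 2. *)
Lemma coef_dcoef f c p j k n :
  (dcoef f c (n + j) p)`_(n + k) = (dcoef f c j p)`_k.
Proof.
elim: n => [//|n IH].
by rewrite !addSn /= coefD coefMX coefC /= addr0.
Qed.

(** The zero distribution is regular, so the degree bound of [rep_size_le] with [k = 0] leaves only
    zero polynomials. *)
Lemma rep_inj0 s f c : uniq s -> psmooth s f -> rep s f c = 0 ->
  forall p, p \in s -> c p = 0.
Proof.
move=> us pf r0 p ps; have p0 := smooth_psmooth s (smooth_cst (0 : C)).
have z0 : regdist (fun _ : R => 0 : C) = 0.
  have := regdistZ 0 (psmooth_locint p0); rewrite scale0r => E; rewrite -[RHS]E.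
  by congr regdist; apply/funext => x; rewrite mul0r.
apply/eqP; rewrite -size_poly_eq0 -leqn0.
apply: (rep_size_le (k := 0) us pf (psmooth_locint p0) _ ps).
by rewrite r0 -[LHS]z0.
Qed.

(** The regular part is kept existential, as the argument compares delta parts only. *)
Definition has_rep s F c := exists2 f, psmooth s f & F = rep s f c.

Lemma has_repD s F G c d : has_rep s F c -> has_rep s G d ->
  has_rep s (F + G) (fun p => c p + d p).
Proof.
move=> [f pf ->] [g pg ->]; exists (fun x => f x + g x); first exact: psmoothD.
exact: repD (psmooth_locint pf) (psmooth_locint pg).
Qed.

Lemma has_repZ s (a : C) F c : has_rep s F c -> has_rep s (a *: F) (fun p => a *: c p).
Proof.
move=> [f pf ->]; exists (fun x => a * f x); last exact: repZ (psmooth_locint pf).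
exact: psmoothM (smooth_psmooth s (smooth_cst a)) pf.
Qed.

Lemma has_repMn s n F c : has_rep s F c -> has_rep s (F *+ n) (fun p => c p *+ n).
Proof.
move=> rF; rewrite -scaler_nat (_ : (fun p => _) = fun p => n%:R *: c p).
  exact: has_repZ.
by apply/funext => p; rewrite scaler_nat.
Qed.

Lemma has_rep_star s f g c d : psmooth s f -> psmooth s g ->
  has_rep s (star (rep s f c) (rep s g d)) (fun p =>
    pmul (fun i => rlim (cderivn i g) p) (c p) +
    pmul (fun i => llim (cderivn i f) p) (d p)).
Proof.
move=> pf pg; exists (fun x => f x * g x); first exact: psmoothM.
exact: star_rep.
Qed.

Lemma in_A_rep F : in_A F -> exists s f c, [/\ uniq s, psmooth s f & F = rep s f c].
Proof.
move=> [f [n [/cpsmoothP[s [us pf]] ->]]].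
exists s, (cderivn n f), (dcoef f (fun=> 0) n); split=> //.
  exact: psmooth_cderivn.
by rewrite (rep_regdist s) dderivn_rep.
Qed.

Lemma rep_extend s s' f c : uniq s -> uniq s' -> {subset s <= s'} ->
  rep s f c = rep s' f (fun p => if p \in s then c p else 0).
Proof.
move=> us us' ss'; rewrite /rep; congr (_ + _).
have -> : \sum_(p <- s') dpoly p (if p \in s then c p else 0) =
    \sum_(p <- s' | p \in s) dpoly p (c p).
  by rewrite [RHS]big_mkcond; apply: eq_bigr => p _; case: ifP; rewrite ?dpoly0.
rewrite -[RHS]big_filter; apply: perm_big; apply: uniq_perm => //.
  exact: filter_uniq.
by move=> x; rewrite mem_filter; case: (boolP (x \in s)) => //= /ss' ->.
Qed.

(** Regular part of [jump_distr]. Its value at [p] is 0, as [heaviside] vanishes at 0; the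
    information at [p] is in the one-sided limits. *)
Definition glue p f g x : C := f x * heaviside (p - x) + g x * heaviside (x - p).

Lemma glue_lt p f g x : x < p -> glue p f g x = f x.
Proof.
move=> xp; rewrite /glue /heaviside !subr_gt0 xp (ltNge p) (ltW xp)/=.
by rewrite mulr1 mulr0 addr0.
Qed.

Lemma glue_gt p f g x : p < x -> glue p f g x = g x.
Proof.
move=> px; rewrite /glue /heaviside !subr_gt0 px (ltNge x) (ltW px)/=.
by rewrite mulr1 mulr0 add0r.
Qed.

Lemma smooth_side_limits f n p : smooth f ->
  ccvg_to p^'- (cderivn n f) (cderivn n f p) /\
  ccvg_to p^'+ (cderivn n f) (cderivn n f p).
Proof.
by move=> sf; split; apply: ccvg_sub (cderivable_cvg (sf n p)); exact: cvg_within.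
Qed.

(** The test is [q <= p] here and [q < p] in [glue_rlim]: at [q = p] the left limit comes from [f]
    and the right limit from [g]. Hence the mixed sum a_{0-} + a_{1+} at xi_0. *)
Lemma glue_llim p f g q n : smooth f -> smooth g ->
  ccvg_to q^'- (cderivn n (glue p f g)) (cderivn n (if q <= p then f else g) q).
Proof.
move=> sf sg; case: leP => qp.
  apply: near_ccvg (smooth_side_limits n q sf).1.
  have : q^'- [set y | y < q] by exact: nbhs_left_lt.
  apply: filterS => y yq; have yp : y < p by exact: lt_le_trans qp.
  by apply: (@eq_on_cderivn _ _ [set x | x < p]) => // z /= zp; rewrite glue_lt.
apply: near_ccvg (smooth_side_limits n q sg).1.
have : q^'- [set y | p < y] by exact: nbhs_left_gt.
apply: filterS => y yp.
by apply: (@eq_on_cderivn _ _ [set x | p < x]) => // z /= zp; rewrite glue_gt.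
Qed.

Lemma glue_rlim p f g q n : smooth f -> smooth g ->
  ccvg_to q^'+ (cderivn n (glue p f g)) (cderivn n (if q < p then f else g) q).
Proof.
move=> sf sg; case: ltP => qp.
  apply: near_ccvg (smooth_side_limits n q sf).2.
  have : q^'+ [set y | y < p] by exact: nbhs_right_lt.
  apply: filterS => y yp.
  by apply: (@eq_on_cderivn _ _ [set x | x < p]) => // z /= zp; rewrite glue_lt.
apply: near_ccvg (smooth_side_limits n q sg).2.
have : q^'+ [set y | q < y] by exact: nbhs_right_gt.
apply: filterS => y yq; have yp : p < y by exact: le_lt_trans qp _.
by apply: (@eq_on_cderivn _ _ [set x | p < x]) => // z /= zp; rewrite glue_gt.
Qed.

Lemma psmooth_glue p f g : smooth f -> smooth g -> psmooth [:: p] (glue p f g).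
Proof.
move=> sf sg; split; last first.
  move=> n x; split; eexists; [exact: glue_llim|exact: glue_rlim].
move=> n x; rewrite /offs/= inE neq_lt => /orP[xp|px].
- have E z : [set y | y < p] z -> f z = glue p f g z by move=> /= zp; rewrite glue_lt.
  have sfU : smooth_on [set y | y < p] f by move=> k z _; exact: sf.
  exact: (eq_smooth_on (@open_lt R p) E sfU n xp).
- have E z : [set y | p < y] z -> g z = glue p f g z by move=> /= zp; rewrite glue_gt.
  have sgU : smooth_on [set y | p < y] g by move=> k z _; exact: sg.
  exact: (eq_smooth_on (@open_gt R p) E sgU n px).
Qed.

Lemma jump_distr_rep s p f g n (c : 'I_n -> C) : uniq s -> p \in s ->
  smooth f -> smooth g -> exists d, psmooth s (glue p f g) /\
  jump_distr p f g c = rep s (glue p f g) d.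
Proof.
move=> us ps sf sg.
have sub : {subset [:: p] <= s} by move=> x; rewrite inE => /eqP ->.
exists (fun q => if q \in [:: p] then \sum_(j < n) c j *: 'X^j else 0); split.
  exact: psmooth_sub sub (psmooth_glue p sf sg).
rewrite -(rep_extend (s := [:: p]) _ (fun=> _))// /rep /jump_distr big_seq1.
congr (_ + _); rewrite dpoly_sum; apply: eq_bigr => j _.
by rewrite dpolyZ dpolyXn.
Qed.

Lemma ord_le_size s f c n p : uniq s -> psmooth s f -> ord_le (rep s f c) n ->
  p \in s -> (size (c p) <= n)%N.
Proof.
move=> us pf [k [kn [[g [lg gE]] _]]] ps; apply: leq_trans kn.
exact: rep_size_le us pf lg gE ps.
Qed.

End Representation.

(** * Comparison of the delta coefficients in the equation *)

Section Equation.
Variables (R : realType) (s : seq R) (w : R[i]).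
Local Notation C := R[i].
Variables (a0 a1 b0 b1 f : R -> C) (ca0 ca1 cb0 cb1 c : R -> {poly C}).
Hypotheses (us : uniq s) (pa0 : psmooth s a0) (pa1 : psmooth s a1).
Hypotheses (pb0 : psmooth s b0) (pb1 : psmooth s b1) (pf : psmooth s f).

(** Delta part at [p] of the [i]-th summand of the equation, as given by [star_rep]; [eq_low] plays
    the same role for the terms multiplied by w^2. *)
Definition eq_term i p : {poly C} :=
  (pmul (fun k => rlim (cderivn k (cderivn (4 - i) f)) p) (dcoef a0 ca0 i p) +
   pmul (fun k => llim (cderivn k (cderivn i a0)) p) (dcoef f c (4 - i) p) +
   (pmul (fun k => rlim (cderivn k (cderivn i a1)) p) (dcoef f c (4 - i) p) +
    pmul (fun k => llim (cderivn k (cderivn (4 - i) f)) p) (dcoef a1 ca1 i p)))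
  *+ 'C(2, i).

Definition eq_low p : {poly C} :=
  pmul (fun k => rlim (cderivn k f) p) (cb0 p) +
  pmul (fun k => llim (cderivn k b0) p) (c p) +
  (pmul (fun k => rlim (cderivn k b1) p) (c p) +
   pmul (fun k => llim (cderivn k f) p) (cb1 p)).

Lemma equation_coef :
  \sum_(i < 3) (star (dderivn i (rep s a0 ca0)) (dderivn (4 - i) (rep s f c)) +
     star (dderivn (4 - i) (rep s f c)) (dderivn i (rep s a1 ca1))) *+ 'C(2, i)
  - w ^+ 2 *: (star (rep s b0 cb0) (rep s f c) +
               star (rep s f c) (rep s b1 cb1)) = 0 ->
  forall p, p \in s ->
    eq_term 0 p + eq_term 1 p + eq_term 2 p + (- w ^+ 2) *: eq_low p = 0.
Proof.
have term i : has_rep s ((star (dderivn i (rep s a0 ca0)) (dderivn (4 - i) (rep s f c)) +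
     star (dderivn (4 - i) (rep s f c)) (dderivn i (rep s a1 ca1))) *+ 'C(2, i))
     (eq_term i).
  rewrite !dderivn_rep//; apply: has_repMn; apply: has_repD; apply: has_rep_star;
    exact: psmooth_cderivn.
have low : has_rep s (star (rep s b0 cb0) (rep s f c) +
    star (rep s f c) (rep s b1 cb1)) eq_low.
  by apply: has_repD; exact: has_rep_star.
rewrite !big_ord_recl big_ord0 addr0 addrA -scaleNr.
have [g pg ->] := has_repD (has_repD (has_repD (term 0) (term 1)) (term 2))
  (has_repZ (- w ^+ 2) low).
by move=> r0 p ps; rewrite (rep_inj0 us pg r0 ps).
Qed.

Hypothesis eqn : \sum_(i < 3) (star (dderivn i (rep s a0 ca0)) (dderivn (4 - i) (rep s f c)) +
     star (dderivn (4 - i) (rep s f c)) (dderivn i (rep s a1 ca1))) *+ 'C(2, i)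
  - w ^+ 2 *: (star (rep s b0 cb0) (rep s f c) +
               star (rep s f c) (rep s b1 cb1)) = 0.

Lemma coef_pmul_big u (d : {poly C}) N : (size d <= N)%N -> (pmul u d)`_N = 0.
Proof. by move=> dN; rewrite nth_default// (leq_trans (size_pmul _ _)). Qed.

Lemma coef_pmul4_0 u1 u2 u3 u4 (d1 d2 d3 d4 : {poly C}) n N :
  (size d1 <= N)%N -> (size d2 <= N)%N -> (size d3 <= N)%N -> (size d4 <= N)%N ->
  ((pmul u1 d1 + pmul u2 d2 + (pmul u3 d3 + pmul u4 d4)) *+ n)`_N = 0.
Proof.
move=> s1 s2 s3 s4; rewrite coefMn !coefD.
by rewrite (coef_pmul_big u1 s1) (coef_pmul_big u2 s2) (coef_pmul_big u3 s3)
  (coef_pmul_big u4 s4) !addr0 mul0rn.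
Qed.

Lemma coef_pmul4_top u1 u2 u3 u4 (d1 d d4 : {poly C}) N :
  (size d1 <= N)%N -> (size d <= N.+1)%N -> (size d4 <= N)%N ->
  ((pmul u1 d1 + pmul u2 d + (pmul u3 d + pmul u4 d4)) *+ 1)`_N =
  (u2 0%N + u3 0%N) * d`_N.
Proof.
move=> s1 s2 s4; rewrite mulr1n !coefD.
rewrite (coef_pmul_big u1 s1) (coef_pmul_big u4 s4) add0r addr0.
by rewrite (coef_pmul_top u2 s2) (coef_pmul_top u3 s2) mulrDl.
Qed.

(* Only a0 * phi^(4) + phi^(4) * a1 contributes to the coefficient of         *)
(* delta^(N) when all the other delta parts have order below N.               *)
Lemma top_coef N p : p \in s -> llim a0 p + rlim a1 p != 0 ->
  (forall i, (i <= 2)%N -> (size (dcoef a0 ca0 i p) <= N)%N /\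
                           (size (dcoef a1 ca1 i p) <= N)%N) ->
  (size (cb0 p) <= N)%N -> (size (cb1 p) <= N)%N -> (size (c p) <= N)%N ->
  (size (dcoef f c 2 p) <= N)%N -> (size (dcoef f c 3 p) <= N)%N ->
  (size (dcoef f c 4 p) <= N.+1)%N -> (dcoef f c 4 p)`_N = 0.
Proof.
move=> ps al sa sb0 sb1 sc s2 s3 s4.
have [sa00 sa10] := sa 0%N isT; have [sa01 sa11] := sa 1%N isT.
have [sa02 sa12] := sa 2%N isT.
have T1 : (eq_term 1 p)`_N = 0 by exact: (coef_pmul4_0 _ _ _ _ _ sa01 s3 s3 sa11).
have T2 : (eq_term 2 p)`_N = 0 by exact: (coef_pmul4_0 _ _ _ _ _ sa02 s2 s2 sa12).
have L0 : (eq_low p)`_N = 0 by exact: (@coef_pmul4_0 _ _ _ _ _ _ _ _ 1 _ sb0 sc sc sb1).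
have T0 : (eq_term 0 p)`_N = (llim a0 p + rlim a1 p) * (dcoef f c 4 p)`_N.
  exact: (coef_pmul4_top _ _ _ _ sa00 s4 sa10).
have E := congr1 (fun d : {poly C} => d`_N) (equation_coef eqn ps).
move: (eq_term 0 p) (eq_term 1 p) (eq_term 2 p) (eq_low p) T0 T1 T2 L0 E.
move=> e0 e1 e2 l T0 T1 T2 L0 E.
rewrite !coefD coefZ T0 T1 T2 L0 coef0 mulr0 !addr0 in E.
by move/eqP: E; rewrite mulf_eq0 (negbTE al) orFb => /eqP.
Qed.

Hypothesis al : forall p, p \in s -> llim a0 p + rlim a1 p != 0.

(** All coefficient functions contribute size at most 3: size 1 raised by at most two derivatives
    for the a_i, and size 3 for the b_i. If [c p] had degree m, [top_coef] with N = m + 4 would kill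
    its leading coefficient. Once [c p] is 0, the choice N = 3 kills the jump of [f]. *)
Lemma solution_regular :
  (forall p, p \in s -> (size (ca0 p) <= 1)%N /\ (size (ca1 p) <= 1)%N) ->
  (forall p, p \in s -> (size (cb0 p) <= 3)%N /\ (size (cb1 p) <= 3)%N) ->
  forall p, p \in s -> c p = 0 /\ jump f p = 0.
Proof.
move=> sa sb p ps; have [sa0 sa1] := sa p ps; have [sb0 sb1] := sb p ps.
have saN N i : (3 <= N)%N -> (i <= 2)%N -> (size (dcoef a0 ca0 i p) <= N)%N /\
                           (size (dcoef a1 ca1 i p) <= N)%N.
  move=> N3 i2; have iN : (i + 1 <= N)%N by rewrite (leq_trans _ N3)// addn1 ltnS.
  have h0 := @size_dcoef _ a0 ca0 p 0 1 i sa0.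
  have h1 := @size_dcoef _ a1 ca1 p 0 1 i sa1.
  by rewrite addn0 in h0 h1; split; apply: leq_trans iN.
have sn n : (size (dcoef f c n p) <= n + size (c p))%N.
  by have := @size_dcoef _ f c p 0 (size (c p)) n; rewrite addn0; apply.
have c0 : c p = 0.
  apply/eqP/negPn/negP => cp; pose m := (size (c p)).-1.
  have cm : size (c p) = m.+1 by rewrite prednK// size_poly_gt0.
  have N3 : (3 <= m.+4)%N by [].
  have : (dcoef f c 4 p)`_m.+4 = 0.
    apply: (top_coef ps (al ps)) => [i|||||  |]; first exact: saN.
    - exact: leq_trans sb0 N3.
    - exact: leq_trans sb1 N3.
    - by rewrite cm ltnS -addn3 leq_addr.
    - by apply: leq_trans (sn 2%N) _; rewrite cm !addSn add0n leqnSn.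
    - by apply: leq_trans (sn 3%N) _; rewrite cm !addSn add0n.
    - by apply: leq_trans (sn 4%N) _; rewrite cm !addSn add0n.
  rewrite (coef_dcoef f c p 0 m 4) => /eqP.
  by rewrite -[(dcoef _ _ _ _)`_m]/(lead_coef (c p)) lead_coef_eq0 (negbTE cp).
split=> //; have {}sn n : (size (dcoef f c n p) <= n)%N.
  by have := sn n; rewrite c0 size_poly0 addn0.
have : (dcoef f c 4 p)`_3 = 0.
  apply: (top_coef ps (al ps)) => [i|||||  |] //; first exact: saN.
  - by rewrite c0 size_poly0.
  - exact: leq_trans (sn 2%N) _.
by rewrite (coef_dcoef f c p 1 0 3) /= c0 mul0r add0r coefC.
Qed.

(** Now [top_coef] is used with N = 2. Without delta parts, the i-th derivatives of the a_i have
    size at most i <= 2, and since the jump of [f] vanishes, phi^(n+1) has size at most n. *)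
Lemma solution_regular_deriv :
  (forall p, p \in s -> ca0 p = 0 /\ ca1 p = 0) ->
  (forall p, p \in s -> (size (cb0 p) <= 2)%N /\ (size (cb1 p) <= 2)%N) ->
  forall p, p \in s -> jump (cderiv f) p = 0.
Proof.
move=> sa sb p ps; have [sa0 sa1] := sa p ps; have [sb0 sb1] := sb p ps.
have [c0 j0] : c p = 0 /\ jump f p = 0.
  apply: solution_regular => // q qs.
    by have [-> ->] := sa q qs; rewrite size_poly0.
  by have [h0 h1] := sb q qs; split; exact: leqW.
have d1 : (size (dcoef f c 1 p) <= 0)%N.
  by rewrite /= c0 mul0r add0r j0 size_polyC eqxx.
have sn n : (size (dcoef f c (n + 1) p) <= n)%N.
  by have := size_dcoef n d1; rewrite addn0.
have : (dcoef f c 4 p)`_2 = 0.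
  apply: (top_coef ps (al ps)) => [i i2|||||  |] //.
  - have z0 : (size (dcoef a0 ca0 0 p) <= 0)%N by rewrite /= sa0 size_poly0.
    have z1 : (size (dcoef a1 ca1 0 p) <= 0)%N by rewrite /= sa1 size_poly0.
    have := size_dcoef i z0; have := size_dcoef i z1; rewrite !addn0 => h1 h0.
    by split; apply: leq_trans i2.
  - by rewrite c0 size_poly0.
  - exact: leq_trans (sn 1%N) _.
  - exact: (sn 2%N).
  - exact: (sn 3%N).
by rewrite (coef_dcoef f c p 2 0 2) /= coefD coefMX coefC/= add0r.
Qed.

End Equation.

(** The three nonvanishing hypotheses match the three positions of [p] relative to [xi0]. *)
Lemma glue_coef_neq0 (R : realType) (xi0 : R) (am ap : 'I_2 -> R -> R[i]) p :
  (forall i, smooth (am i)) -> (forall i, smooth (ap i)) ->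
  am 0 xi0 + ap 1 xi0 != 0 -> (forall x, am 0 x + am 1 x != 0) ->
  (forall x, ap 0 x + ap 1 x != 0) ->
  llim (glue xi0 (am 0) (ap 0)) p + rlim (glue xi0 (am 1) (ap 1)) p != 0.
Proof.
move=> sm sp h0 hm hp.
rewrite (llimE (glue_llim xi0 p 0 (sm 0) (sp 0))).
rewrite (rlimE (glue_rlim xi0 p 0 (sm 1) (sp 1))) /=.
by case: ltgtP => [_|_|->].
Qed.

Theorem corollary3p3 (R : realType) (xi0 : R) (w : R[i])
    (am ap bm bp : 'I_2 -> R -> R[i])
    (A : 'I_2 -> 'I_2 -> R[i]) (B : 'I_2 -> 'I_4 -> R[i])
    (a b : 'I_2 -> functional R)
    (smooth_am : forall i, smooth (am i)) (smooth_ap : forall i, smooth (ap i))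
    (smooth_bm : forall i, smooth (bm i)) (smooth_bp : forall i, smooth (bp i))
    (aE : forall i, a i = jump_distr xi0 (am i) (ap i) (A i))
    (bE : forall i, b i = jump_distr xi0 (bm i) (bp i) (B i))
    (a_xi0 : am 0 xi0 + ap 1 xi0 != 0)
    (a_minus : forall x, am 0 x + am 1 x != 0)
    (a_plus : forall x, ap 0 x + ap 1 x != 0) :
  ((forall i, ord_le (a i) 1 /\ ord_le (b i) 3) ->
    forall phi : functional R, is_solution w a b phi ->
      exists f : R -> R[i], ccontinuous f /\ phi = regdist f) /\
  ((forall i, has_ord (a i) 0 /\ ord_le (b i) 2) ->
    forall phi : functional R, is_solution w a b phi ->
      exists f : R -> R[i], continuously_differentiable f /\ phi = regdist f).

Proof.
have sol phi : is_solution w a b phi -> exists s f c da db, [/\ uniq s /\ psmooth s f,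
    phi = rep s f c,
    forall i, psmooth s (glue xi0 (am i) (ap i)) /\
      a i = rep s (glue xi0 (am i) (ap i)) (da i),
    forall i, psmooth s (glue xi0 (bm i) (bp i)) /\
      b i = rep s (glue xi0 (bm i) (bp i)) (db i) &
    \sum_(i < 3) (star (dderivn i (rep s (glue xi0 (am 0) (ap 0)) (da 0)))
                       (dderivn (4 - i) (rep s f c)) +
     star (dderivn (4 - i) (rep s f c))
          (dderivn i (rep s (glue xi0 (am 1) (ap 1)) (da 1)))) *+ 'C(2, i)
    - w ^+ 2 *: (star (rep s (glue xi0 (bm 0) (bp 0)) (db 0)) (rep s f c) +
               star (rep s f c) (rep s (glue xi0 (bm 1) (bp 1)) (db 1))) = 0].
  move=> [/in_A_rep[s0 [f [c [us0 pf phiE]]]] eqn].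
  (* One duplicate-free list for all distributions involved: the singular points of [phi] together
     with [xi0], where the coefficients are singular. *)
  pose s := undup (xi0 :: s0); have us : uniq s by exact: undup_uniq.
  have xs : xi0 \in s by rewrite mem_undup mem_head.
  have s0s : {subset s0 <= s} by move=> x xs0; rewrite mem_undup inE xs0 orbT.
  have /choice[da daE] : forall i, exists d, psmooth s (glue xi0 (am i) (ap i)) /\
      a i = rep s (glue xi0 (am i) (ap i)) d.
    by move=> i; rewrite aE; exact: jump_distr_rep.
  have /choice[db dbE] : forall i, exists d, psmooth s (glue xi0 (bm i) (bp i)) /\
      b i = rep s (glue xi0 (bm i) (bp i)) d.
    by move=> i; rewrite bE; exact: jump_distr_rep.
  have phiE' := etrans phiE (rep_extend f c us0 us s0s).
  exists s, f; eexists; exists da, db; split; [|exact: phiE'|exact: daE|exact: dbE|].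
    by split=> //; exact: psmooth_sub pf.
  by rewrite -phiE' -(daE 0).2 -(daE 1).2 -(dbE 0).2 -(dbE 1).2.
have al p : llim (glue xi0 (am 0) (ap 0)) p + rlim (glue xi0 (am 1) (ap 1)) p != 0.
  exact: glue_coef_neq0.
split=> ord phi /sol[s [f [c [da [db [[us pf] phiE daE dbE eqn]]]]]].
- have [[pa0 a0E] [pa1 a1E]] := (daE 0, daE 1).
  have [[pb0 b0E] [pb1 b1E]] := (dbE 0, dbE 1).
  have reg : forall p, p \in s -> c p = 0 /\ jump f p = 0.
    apply: (solution_regular us pa0 pa1 pb0 pb1 pf eqn) => // p ps.
      have [[h0 _] [h1 _]] := (ord 0, ord 1); rewrite a0E in h0; rewrite a1E in h1.
      by split; [exact: ord_le_size h0 ps|exact: ord_le_size h1 ps].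
    have [[_ h0] [_ h1]] := (ord 0, ord 1); rewrite b0E in h0; rewrite b1E in h1.
    by split; [exact: ord_le_size h0 ps|exact: ord_le_size h1 ps].
  have jf p : p \in s -> jump f p = 0 by move=> /reg[].
  (* The values of [f] on [s] are arbitrary; [rlim f] agrees with [f] off this finite list and is
     the continuous representative. *)
  exists (rlim f); split; first exact: rlim_ccontinuous pf jf.
  rewrite phiE -(rlim_regdist pf jf) (rep_regdist s f).
  by apply: eq_rep => p /reg[].
- have [[pa0 a0E] [pa1 a1E]] := (daE 0, daE 1).
  have [[pb0 b0E] [pb1 b1E]] := (dbE 0, dbE 1).
  have sa p : p \in s -> da 0 p = 0 /\ da 1 p = 0.
    move=> ps.
    have ha0 : ord_le (a 0) 0 by exists 0%N; split=> //; case: (ord 0).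
    have ha1 : ord_le (a 1) 0 by exists 0%N; split=> //; case: (ord 1).
    rewrite a0E in ha0; rewrite a1E in ha1.
    have := ord_le_size us pa0 ha0 ps; have := ord_le_size us pa1 ha1 ps.
    by rewrite !leqn0 !size_poly_eq0 => /eqP -> /eqP ->.
  have sb p : p \in s -> (size (db 0%R p) <= 2)%N /\ (size (db 1%R p) <= 2)%N.
    move=> ps; have [[_ h0] [_ h1]] := (ord 0, ord 1).
    rewrite b0E in h0; rewrite b1E in h1.
    by split; [exact: ord_le_size h0 ps|exact: ord_le_size h1 ps].
  have reg : forall p, p \in s -> c p = 0 /\ jump f p = 0.
    apply: (solution_regular us pa0 pa1 pb0 pb1 pf eqn) => // p ps.
      by have [-> ->] := sa p ps; rewrite size_poly0.
    by have [h0 h1] := sb p ps; split; exact: leqW.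
  have jf p : p \in s -> jump f p = 0 by move=> /reg[].
  have jf' := solution_regular_deriv us pa0 pa1 pb0 pb1 pf eqn (fun p _ => al p) sa sb.
  have D := rlim_cderivable pf jf jf'.
  exists (rlim f); split.
    split; first by move=> x; have [] := D x.
    rewrite (_ : cderiv (rlim f) = rlim (cderiv f)).
      exact: rlim_ccontinuous (psmooth_cderiv pf) jf'.
    by apply/funext => x; have [] := D x.
  rewrite phiE -(rlim_regdist pf jf) (rep_regdist s f).
  by apply: eq_rep => p /reg[].
Qed.
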